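(* Let $X$ be a Banach space, $K\subseteq X^*$ a non-empty, absolutely convex, weak$^*$-compact set, $\delta,\theta>0$ positive real numbers, $(\epsilon_n)_{n<\omega}$ a family of positive real numbers, $(\xi_n)_{n<\omega}$ a family of countable ordinals such that $s_{\epsilon_n}^{\xi_n}(K)\neq\emptyset$ for all $n<\omega$, and $\mathfrak{T}=((\mathcal{T}_n,\preceq_n))_{n<\omega}$ a family of countable, well-founded, rooted trees such that $\rho(\mathcal{T}_n)\leq\xi_n+1$ for all $n<\omega$. (i) There exist families $(x_t^* )_{t\in[[\mathfrak{T}]]^\star}\subseteq K$ and $(x_t)_{t\in[[\mathfrak{T}]]^\star}\subseteq S_X$ such that for all $s,t\in[[\mathfrak{T}]]^\star$ and $n<\omega$: $$\langle x_t^*,x_s\rangle=\begin{cases}\langle x_s^*,x_s\rangle>\dfrac{\epsilon_n}{8+\theta}&\text{if } s\preceq_{\mathfrak{T}}t\in\{n\}\times\mathcal{T}_n^\star,\\ 0&\text{if } s\not\preceq_{\mathfrak{T}}t.\end{cases}$$ Moreover, for any bijection $\tau:\omega\to[[\mathfrak{T}]]$ such that $\tau(l)\preceq_{\mathfrak{T}}\tau(m)$ implies $l\leq m$, we may choose $(x_t)_{t\in[[\mathfrak{T}]]^\star}$ so that $(x_{\tau(m)})_{m=1}^\infty$ is a basic sequence with basis constant not exceeding $1+\delta$. (ii) If $X^*$ is norm separable then (for such a bijection $\tau$) the families $(x_t^* )_{t\in[[\mathfrak{T}]]^\star}$ and $(x_t)_{t\in[[\mathfrak{T}]]^\star}$ in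 (i) may be chosen so that $(x_{\tau(m)})_{m=1}^\infty$ is shrinking and $(Qx_{\tau(m)})_{m=1}^\infty$ is a shrinking basis for $X/Z$ with basis constant not exceeding $1+\delta$, where $Z=\bigcap_{t\in[[\mathfrak{T}]]^\star}\ker(x_t^* )$ and $Q:X\to X/Z$ is the quotient map.
   Context: Banach spaces are over $\mathbb{R}$ or $\mathbb{C}$; $S_X$ is the unit sphere of $X$. Szlenk derivation. For $\epsilon>0$ and a weak$^*$-compact set $K\subseteq X^*$ let $s_\epsilon(K)=\{x^*\in K : \operatorname{diam}(U\cap K)>\epsilon \text{ for every weak}^*\text{-open } U\ni x^*\}$ (norm diameter); $s_\epsilon^0(K)=K$, $s_\epsilon^{\xi+1}(K)=s_\epsilon(s_\epsilon^\xi(K))$, and $s_\epsilon^\xi(K)=\bigcap_{\zeta<\xi}s_\epsilon^\zeta(K)$ for limit $\xi$. Trees. A tree is a partially ordered set $(\mathcal{T},\preceq)$ such that $\{s\in\mathcal{T}: s\preceq t\}$ is well-ordered for every $t\in\mathcal{T}$. $MIN(\cdot)$ and $MAX(\cdot)$ denote sets of minimal and maximal elements. $\mathcal{T}$ is rooted if $|MIN(\mathcal{T})|\leq1$; it is well-founded if it contains no infinite branch (a branch is a maximal totally ordered subset). $\mathcal{T}^\star=\mathcal{T}\setminus MIN(\mathcal{T})$, with the induced order. Put $\mathcal{T}^{(0)}=\mathcal{T}$, $\mathcal{T}^{(\xi+1)}=\mathcal{T}^{(\xi)}\setminus MAX(\mathcal{T}^{(\xi)})$, and $\mathcal{T}^{(\xi)}=\bigcap_{\xi'<\xi}\mathcal{T}^{(\xi')}$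 for limit $\xi$; for well-founded $\mathcal{T}$ the rank is $\rho(\mathcal{T})=\min\{\xi:\mathcal{T}^{(\xi)}=\emptyset\}$. Amalgamated tree. For a family $\mathfrak{T}=((\mathcal{T}_n,\preceq_n))_{n<\omega}$ of rooted trees, $[[\mathfrak{T}]]:=\{\emptyset\}\cup\bigcup_{n<\omega}(\{n\}\times\mathcal{T}_n^\star)$, a rooted tree under the order $\preceq_{\mathfrak{T}}$ given by $\emptyset\preceq_{\mathfrak{T}}t$ for all $t\in[[\mathfrak{T}]]$ and $(n_1,t_1)\preceq_{\mathfrak{T}}(n_2,t_2)$ if and only if $n_1=n_2$ and $t_1\preceq_{n_1}t_2$. In particular $[[\mathfrak{T}]]^\star=[[\mathfrak{T}]]\setminus\{\emptyset\}$, and any bijection $\tau$ as in the statement has $\tau(0)=\emptyset$. A basic sequence is a Schauder basis of its closed linear span; it is called shrinking if it is a shrinking basis of its closed linear span. *)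

(* Defs.v *)
From HB Require Import structures.
From mathcomp Require Import all_boot all_order all_algebra.
From mathcomp Require Import generic_quotient.
From mathcomp Require Import complex.
From mathcomp Require Import all_classical all_reals.
From mathcomp Require Import ereal topology normedtype sequences.
Set Implicit Arguments.
Unset Strict Implicit.
Unset Printing Implicit Defensive.
Import Order.TTheory GRing.Theory Num.Theory.
Import numFieldNormedType.Exports.
Local Open Scope classical_set_scope.
Local Open Scope ring_scope.

Variant scalar_kind := RealScalars | ComplexScalars.

Definition scalar_field (R : realType) (k : scalar_kind) : numFieldType :=
  match k with RealScalars => R | ComplexScalars => R[i] end.

(* A normed module over R[i] has its norm valued in R[i]; the next two maps
   pass between R and the scalars, so that suprema and infima of norms can be
   taken in R. *)
Definition of_real (R : realType) (k : scalar_kind) : R -> scalar_field R k :=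
  match k with
  | RealScalars => fun x => x
  | ComplexScalars => fun x => x%:C%C
  end.
Arguments of_real {R} k x.

Definition to_real (R : realType) (k : scalar_kind) : scalar_field R k -> R :=
  match k with
  | RealScalars => fun x => x
  | ComplexScalars => fun x => complex.Re x
  end.
Arguments to_real {R k} x.

Definition rnorm (R : realType) (k : scalar_kind)
  (V : normedModType (scalar_field R k)) (x : V) : R := to_real `|x|.

Section ScalarFacts.
Variables (R : realType) (k : scalar_kind).
Local Notation K := (scalar_field R k).

Lemma of_realK : cancel (of_real k) (@to_real R k).
Proof. by case: k. Qed.

Lemma of_real_le (x y : R) : (of_real k x <= of_real k y) = (x <= y).
Proof. by case: k => //=; rewrite lecR. Qed.

Lemma of_realD (x y : R) : of_real k (x + y) = of_real k x + of_real k y.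
Proof. by case: k => //=; rewrite rmorphD. Qed.

Lemma of_realM (x y : R) : of_real k (x * y) = of_real k x * of_real k y.
Proof. by case: k => //=; rewrite rmorphM. Qed.

Lemma of_real0 : of_real k (0 : R) = 0.
Proof. by case: k. Qed.

Lemma of_real1 : of_real k (1 : R) = 1.
Proof. by case: k. Qed.

Lemma to_realK (x : K) : 0 <= x -> of_real k (to_real x) = x.
Proof.
case: k x => [//|[a b]]; rewrite lecE /= => /andP[/eqP -> _] //.
Qed.

Section Norm.
Variable V : normedModType K.
Implicit Types x y : V.

Lemma rnormE x : of_real k (rnorm x) = `|x|.
Proof. exact: (to_realK (normr_ge0 x)). Qed.

Lemma rnorm_ge0 x : 0 <= rnorm x.
Proof. by rewrite -of_real_le of_real0 rnormE. Qed.

Lemma rnormD x y : rnorm (x + y) <= rnorm x + rnorm y.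
Proof. by rewrite -of_real_le of_realD !rnormE ler_normD. Qed.

Lemma rnormZ (a : K) x : rnorm (a *: x) = to_real `|a| * rnorm x.
Proof.
by apply: (can_inj of_realK); rewrite of_realM !rnormE normrZ to_realK.
Qed.

Lemma rnorm0 : rnorm (0 : V) = 0.
Proof. by apply: (can_inj of_realK); rewrite rnormE normr0 of_real0. Qed.

End Norm.

Lemma rnorm_homogeneous (W : lmodType K) (p : W -> R) :
  (forall w, 0 <= p w) -> (forall a w, p (a *: w) <= to_real `|a| * p w) ->
  forall a w, p (a *: w) = to_real `|a| * p w.
Proof.
move=> p0 pZ a w; apply/eqP; rewrite eq_le pZ /=.
have [->|a0] := eqVneq a 0.
  by rewrite normr0 -[0 : K]of_real0 of_realK mul0r p0.
have na0 : 0 < to_real `|a|.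
  rewrite lt_neqAle (rnorm_ge0 (a : K^o)) andbT eq_sym.
  apply: contra_neq a0 => a0; apply/normr0_eq0.
  by rewrite -(to_realK (normr_ge0 a)) a0 of_real0.
rewrite -ler_pdivlMl//.
have {1}-> : w = a^-1 *: (a *: w) by rewrite scalerA mulVf// scale1r.
apply: le_trans (pZ _ _) _.
suff -> : to_real `|a^-1| = (to_real `|a|)^-1 by [].
apply: (mulfI (lt0r_neq0 na0)); rewrite mulfV ?lt0r_neq0//.
apply: (can_inj of_realK).
by rewrite of_realM !to_realK// normfV mulfV ?normr_eq0// of_real1.
Qed.

End ScalarFacts.

Section Dual.
Variables (R : realType) (k : scalar_kind).
Local Notation K := (scalar_field R k).
Variable V : normedModType K.

Definition functional : pred (V -> K^o) :=
  fun f => `[< linear f /\ continuous f >].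

Lemma functional_submod : submod_closed functional.
Proof.
split.
  apply/asboolP; split; first by move=> a x y; rewrite /= scaler0 addr0.
  exact: cst_continuous.
move=> a f g /asboolP[lf cf] /asboolP[lg cg]; apply/asboolP; split.
  move=> b x y; rewrite /= !fctE lf lg.
  by rewrite !scalerDr !scalerA (mulrC a b) addrACA.
by move=> x; apply: cvgD; [apply: cvgZr; exact: cf|exact: cg].
Qed.

HB.instance Definition _ :=
  GRing.isSubmodClosed.Build K (V -> K^o) functional functional_submod.

Record dual := Dual {
  dual_fun : V -> K^o ; dual_funP : dual_fun \in functional }.

HB.instance Definition _ := [isSub for dual_fun].
HB.instance Definition _ := [Choice of dual by <:].
HB.instance Definition _ := [SubChoice_isSubLmodule of dual by <:].

End Dual.
Coercion dual_fun : dual >-> Funclass.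

Section DualNorm.
Variables (R : realType) (k : scalar_kind).
Local Notation K := (scalar_field R k).
Variable V : normedModType K.
Implicit Types f g : dual V.

Lemma dual_linear f : linear f.
Proof. by have /asboolP[] := dual_funP f. Qed.

Lemma dual_continuous f : continuous f.
Proof. by have /asboolP[] := dual_funP f. Qed.

Lemma dual_addE f g x : (f + g) x = f x + g x. Proof. by []. Qed.

Lemma dual_scaleE (a : K) f x : (a *: f) x = a *: f x. Proof. by []. Qed.

Lemma dual_zeroE x : (0 : dual V) x = 0. Proof. by []. Qed.

Lemma dual_ext f g : f =1 g -> f = g.
Proof. by move=> fg; apply: val_inj; apply/funext. Qed.

Lemma dualZ f (a : K) x : f (a *: x) = a *: f x.
Proof.
have f0 : f 0 = 0.
  have := dual_linear f 1 0 0.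
  by rewrite !scale1r addr0 -{1}[f 0]addr0 => /addrI.
by have := dual_linear f a x 0; rewrite f0 !addr0.
Qed.

Definition unit_ball_values f : set R :=
  [set rnorm (f x) | x in [set x : V | rnorm x <= 1]].

Lemma unit_ball_values_sup f : has_sup (unit_ball_values f).
Proof.
split; first by exists (rnorm (f 0)), 0 => //=; rewrite rnorm0.
pose F : {linear V -> K^o} :=
  HB.pack (dual_fun f) (GRing.isLinear.Build _ _ _ _ _ (dual_linear f)).
have : bounded_near F (nbhs (0 : V)).
  by apply/linear_bounded_continuous; exact: dual_continuous.
move/bounded_funP => /(_ 1) [M FM].
exists (to_real M) => _ [x /= x1 <-].
have {}x1 : `|x| <= 1 by rewrite -rnormE -(@of_real1 R) of_real_le.
have := FM x x1; rewrite -rnormE => le_M.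
have M0 : 0 <= M.
  by apply: le_trans le_M; rewrite -(@of_real0 R) of_real_le rnorm_ge0.
by rewrite -(@of_real_le R k) (to_realK M0).
Qed.

Definition opnorm f : R := sup (unit_ball_values f).

Lemma opnorm_ub f x : rnorm x <= 1 -> rnorm (f x) <= opnorm f.
Proof.
by move=> x1; apply: ub_le_sup; [case: (unit_ball_values_sup f)|exists x].
Qed.

Lemma opnorm_le f c : (forall x, rnorm x <= 1 -> rnorm (f x) <= c) ->
  opnorm f <= c.
Proof.
move=> fc; apply: ge_sup; first by case: (unit_ball_values_sup f).
by move=> _ [x x1 <-]; exact: fc.
Qed.

Lemma opnorm_ge0 f : 0 <= opnorm f.
Proof.
by apply: le_trans (opnorm_ub f (x := 0) _); rewrite ?rnorm_ge0 // rnorm0.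
Qed.

Lemma opnormD f g : opnorm (f + g) <= opnorm f + opnorm g.
Proof.
apply: opnorm_le => x x1; rewrite dual_addE (le_trans (rnormD _ _))//.
by rewrite lerD ?opnorm_ub.
Qed.

Lemma opnormZ_le (a : K) f : opnorm (a *: f) <= to_real `|a| * opnorm f.
Proof.
apply: opnorm_le => x x1; rewrite dual_scaleE rnormZ ler_wpM2l ?opnorm_ub//.
exact: (@rnorm_ge0 _ _ K^o a).
Qed.

Lemma opnormZ (a : K) f : opnorm (a *: f) = to_real `|a| * opnorm f.
Proof. exact: rnorm_homogeneous opnorm_ge0 opnormZ_le a f. Qed.

Lemma opnorm_eq0 f : opnorm f = 0 -> f = 0.
Proof.
move=> f0; apply: dual_ext => x; rewrite dual_zeroE.
have [->|x0] := eqVneq x 0.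
  by rewrite -(scale0r (0 : V)) dualZ scale0r.
have nx0 : `|x| != 0 by rewrite normr_eq0.
have /opnorm_ub-/(_ f) : rnorm (`|x|^-1 *: x) <= 1.
  rewrite -(@of_real_le R k) rnormE normrZ normfV normr_id mulVf//.
  by rewrite of_real1.
rewrite f0 dualZ => le0; have /eqP : rnorm (`|x|^-1 *: f x) = 0.
  by apply/eqP; rewrite eq_le le0 rnorm_ge0.
rewrite -(inj_eq (can_inj (@of_realK R k))) rnormE of_real0 normr_eq0.
by rewrite scaler_eq0 invr_eq0 (negbTE nx0) => /eqP.
Qed.

Lemma dual_normD f g :
  of_real k (opnorm (f + g)) <= of_real k (opnorm f) + of_real k (opnorm g).
Proof. by rewrite -of_realD of_real_le opnormD. Qed.

Lemma dual_normZ (a : K) f :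
  of_real k (opnorm (a *: f)) = `|a| * of_real k (opnorm f).
Proof. by rewrite opnormZ of_realM to_realK. Qed.

Lemma dual_norm_eq0 f : of_real k (opnorm f) = 0 -> f = 0.
Proof.
move=> f0; apply: opnorm_eq0; apply: (can_inj (@of_realK R k)).
by rewrite f0 of_real0.
Qed.

HB.instance Definition _ :=
  Lmodule_isNormed.Build K (dual V) dual_normD dual_normZ dual_norm_eq0.

End DualNorm.

Section Subspaces.
Variables (R : realType) (k : scalar_kind).
Local Notation K := (scalar_field R k).
Variable V : normedModType K.

Record closed_subspace := ClosedSubspace {
  csub : set V ;
  csub0 : csub 0 ;
  csub_lin : forall (a : K) x y, csub x -> csub y -> csub (a *: x + y) ;
  csub_closed : closed csub }.

Definition closed_span (A : set V) : set V :=
  [set x | forall Y : closed_subspace, A `<=` csub Y -> csub Y x].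

Lemma closed_span0 A : closed_span A 0.
Proof. by move=> Y _; exact: csub0. Qed.

Lemma closed_span_lin A (a : K) x y :
  closed_span A x -> closed_span A y -> closed_span A (a *: x + y).
Proof. by move=> Ax Ay Y AY; apply: csub_lin; [exact: Ax|exact: Ay]. Qed.

Lemma closed_span_closed A : closed (closed_span A).
Proof.
rewrite (_ : closed_span A =
    \bigcap_(Y in [set Y : closed_subspace | A `<=` csub Y]) csub Y).
  by apply: closed_bigI => Y _; exact: csub_closed.
by [].
Qed.

Definition cspan (A : set V) : closed_subspace :=
  ClosedSubspace (@closed_span0 A) (@closed_span_lin A) (@closed_span_closed A).

Lemma sub_cspan (A : set V) : A `<=` csub (cspan A).
Proof. by move=> x Ax Y; apply. Qed.

Variable Y : closed_subspace.

Definition in_csub : pred V := fun x => `[< csub Y x >].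

Lemma in_csub_submod : submod_closed in_csub.
Proof.
split; first by apply/asboolP; exact: csub0.
by move=> a x y /asboolP Yx /asboolP Yy; apply/asboolP; exact: csub_lin.
Qed.

HB.instance Definition _ :=
  GRing.isSubmodClosed.Build K V in_csub in_csub_submod.

Record subspace_of := SubspaceOf {
  sub_val : V ; sub_valP : sub_val \in in_csub }.

HB.instance Definition _ := [isSub for sub_val].
HB.instance Definition _ := [Choice of subspace_of by <:].
HB.instance Definition _ := [SubChoice_isSubLmodule of subspace_of by <:].

Let sub_normD (x y : subspace_of) :
  `|sub_val (x + y)| <= `|sub_val x| + `|sub_val y|.
Proof. exact: ler_normD. Qed.

Let sub_normZ (a : K) (x : subspace_of) :
  `|sub_val (a *: x)| = `|a| * `|sub_val x|.
Proof. exact: normrZ. Qed.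

Let sub_norm_eq0 (x : subspace_of) : `|sub_val x| = 0 -> x = 0.
Proof. by move=> /normr0_eq0 x0; exact: val_inj. Qed.

HB.instance Definition _ :=
  Lmodule_isNormed.Build K subspace_of sub_normD sub_normZ sub_norm_eq0.

Definition same_coset : rel V := fun x y => `[< csub Y (x - y) >].

Lemma csubN x : csub Y x -> csub Y (- x).
Proof.
by move=> Yx; have := csub_lin (-1) Yx (csub0 Y); rewrite scaleN1r addr0.
Qed.

Lemma csubD x y : csub Y x -> csub Y y -> csub Y (x + y).
Proof. by move=> Yx Yy; have := csub_lin 1 Yx Yy; rewrite scale1r. Qed.

Lemma csubZ (a : K) x : csub Y x -> csub Y (a *: x).
Proof. by move=> Yx; have := csub_lin a Yx (csub0 Y); rewrite addr0. Qed.

Lemma same_coset_equiv : equiv_class_of same_coset.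
Proof.
split=> [x|x y|y x z].
- by apply/asboolP; rewrite subrr; exact: csub0.
- by apply/asboolP/asboolP => /csubN; rewrite opprB.
- move=> /asboolP xy /asboolP yz; apply/asboolP.
  by have := csubD xy yz; rewrite subrKA.
Qed.

Canonical same_coset_equivRel := EquivRelPack same_coset_equiv.

Local Open Scope quotient_scope.

Definition quotient := {eq_quot same_coset_equivRel}.

HB.instance Definition _ := Choice.on quotient.
HB.instance Definition _ := EqQuotient.on quotient.

Definition quotient_map (x : V) : quotient := \pi_quotient x.

Lemma quotient_mapP x y : quotient_map x = quotient_map y <-> csub Y (x - y).
Proof.
split; first by move=> /eqquotP/asboolP.
by move=> xy; apply/eqquotP/asboolP.
Qed.

Lemma quotient_map_repr q : quotient_map (repr q) = q.
Proof. exact: reprK. Qed.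

Lemma quotient_map_surj q : exists x, q = quotient_map x.
Proof. by exists (repr q); rewrite quotient_map_repr. Qed.

Definition quotient_add (p q : quotient) := quotient_map (repr p + repr q).
Definition quotient_opp (p : quotient) := quotient_map (- repr p).
Definition quotient_scale (a : K) (p : quotient) := quotient_map (a *: repr p).

Lemma repr_quotient_map x : csub Y (repr (quotient_map x) - x).
Proof. by apply/quotient_mapP; rewrite quotient_map_repr. Qed.

Lemma quotient_map_add x y :
  quotient_add (quotient_map x) (quotient_map y) = quotient_map (x + y).
Proof.
apply/quotient_mapP; rewrite opprD addrACA.
by apply: csubD; exact: repr_quotient_map.
Qed.

Lemma quotient_map_opp x : quotient_opp (quotient_map x) = quotient_map (- x).
Proof.
apply/quotient_mapP; rewrite -opprD.
by apply: csubN; exact: repr_quotient_map.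
Qed.

Lemma quotient_map_scale (a : K) x :
  quotient_scale a (quotient_map x) = quotient_map (a *: x).
Proof.
apply/quotient_mapP; rewrite -scalerBr.
by apply: csubZ; exact: repr_quotient_map.
Qed.

Let quotient_addA : associative quotient_add.
Proof.
move=> p q r; have [[x ->] [[y ->] [z ->]]] :=
  (quotient_map_surj p, (quotient_map_surj q, quotient_map_surj r)).
by rewrite !quotient_map_add addrA.
Qed.

Let quotient_addC : commutative quotient_add.
Proof. by move=> p q; rewrite /quotient_add addrC. Qed.

Let quotient_add0 : left_id (quotient_map 0) quotient_add.
Proof.
by move=> p; have [x ->] := quotient_map_surj p; rewrite quotient_map_add add0r.
Qed.

Let quotient_addN : left_inverse (quotient_map 0) quotient_opp quotient_add.
Proof.
move=> p; have [x ->] := quotient_map_surj p.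
by rewrite quotient_map_opp quotient_map_add addNr.
Qed.

HB.instance Definition _ := GRing.isZmodule.Build quotient
  quotient_addA quotient_addC quotient_add0 quotient_addN.

Let quotient_scaleA (a b : K) p :
  quotient_scale a (quotient_scale b p) = quotient_scale (a * b) p.
Proof.
by have [x ->] := quotient_map_surj p; rewrite !quotient_map_scale scalerA.
Qed.

Let quotient_scale1 : left_id 1 quotient_scale.
Proof.
move=> p; have [x ->] := quotient_map_surj p.
by rewrite quotient_map_scale scale1r.
Qed.

Let quotient_scaleDr : right_distributive quotient_scale +%R.
Proof.
move=> a p q.
have [[x ->] [y ->]] := (quotient_map_surj p, quotient_map_surj q).
rewrite [_ + _]quotient_map_add !quotient_map_scale.
by rewrite [RHS]quotient_map_add scalerDr.
Qed.

Let quotient_scaleDl p : {morph quotient_scale^~ p : a b / a + b}.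
Proof.
move=> a b; have [x ->] := quotient_map_surj p.
by rewrite !quotient_map_scale [RHS]quotient_map_add scalerDl.
Qed.

HB.instance Definition _ := GRing.Zmodule_isLmodule.Build K quotient
  quotient_scaleA quotient_scale1 quotient_scaleDr quotient_scaleDl.

Lemma quotient_mapD x y :
  quotient_map (x + y) = quotient_map x + quotient_map y.
Proof. by rewrite [RHS]quotient_map_add. Qed.

Lemma quotient_mapZ (a : K) x : quotient_map (a *: x) = a *: quotient_map x.
Proof. by rewrite [RHS]quotient_map_scale. Qed.

Lemma quotient_map0 x : quotient_map x = 0 <-> csub Y x.
Proof.
by rewrite -[0]/(quotient_map 0); split => [/quotient_mapP|Yx];
  [rewrite subr0|apply/quotient_mapP; rewrite subr0].
Qed.

Definition coset_norms (q : quotient) : set R :=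
  [set rnorm x | x in [set x | quotient_map x = q]].

Definition quotient_norm (q : quotient) : R := inf (coset_norms q).

Lemma coset_norms_inf q : has_inf (coset_norms q).
Proof.
have [x ->] := quotient_map_surj q; split; first by exists (rnorm x), x.
by exists 0 => _ [y _ <-]; exact: rnorm_ge0.
Qed.

Lemma quotient_norm_le x : quotient_norm (quotient_map x) <= rnorm x.
Proof.
by apply: ge_inf; [case: (coset_norms_inf (quotient_map x))|exists x].
Qed.

Lemma quotient_norm_ge0 q : 0 <= quotient_norm q.
Proof.
apply: lb_le_inf; first by case: (coset_norms_inf q).
by move=> _ [x _ <-]; exact: rnorm_ge0.
Qed.

Lemma quotient_norm_adherent q (e : R) : 0 < e ->
  exists2 x, quotient_map x = q & rnorm x < quotient_norm q + e.
Proof.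
move=> e0; have [_ [x qx <-] lt_e] := inf_adherent e0 (coset_norms_inf q).
by exists x.
Qed.

Lemma quotient_norm_D p q :
  quotient_norm (p + q) <= quotient_norm p + quotient_norm q.
Proof.
apply/ler_addgt0Pr => e e0; have e20 : 0 < e / 2 by rewrite divr_gt0.
have [x <- /ltW lx] := quotient_norm_adherent p e20.
have [y <- /ltW ly] := quotient_norm_adherent q e20.
rewrite -quotient_mapD (le_trans (quotient_norm_le _))//.
rewrite (le_trans (rnormD _ _))// (le_trans (lerD lx ly))//.
by rewrite addrACA -splitr.
Qed.

Lemma quotient_norm_Z_le (a : K) q :
  quotient_norm (a *: q) <= to_real `|a| * quotient_norm q.
Proof.
have a0 : 0 <= to_real `|a| by exact: (@rnorm_ge0 _ _ K^o a).
apply/ler_addgt0Pr => e e0.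
have e20 : 0 < e / (to_real `|a| + 1) by rewrite divr_gt0// ltr_wpDl.
have [x <- /ltW lx] := quotient_norm_adherent q e20.
rewrite -quotient_mapZ (le_trans (quotient_norm_le _))// rnormZ.
rewrite (le_trans (ler_wpM2l a0 lx))// mulrDr lerD2l mulrCA ger_pMr//.
by rewrite ler_pdivrMr ?ltr_wpDl// mul1r lerDl.
Qed.

Lemma quotient_norm_eq0 q : quotient_norm q = 0 -> q = 0.
Proof.
have [x ->] := quotient_map_surj q => qx0; apply/quotient_map0.
apply: (@csub_closed Y) => B /nbhs_normP[e /= e0 xB].
have e0' : 0 < to_real e.
  rewrite lt_neqAle -(@of_real_le R k) of_real0 to_realK ?ltW// andbT.
  rewrite eq_sym; apply/eqP => e0'; move: (e0).
  by rewrite -(to_realK (ltW e0)) e0' of_real0 ltxx.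
have [y /quotient_mapP yx] := quotient_norm_adherent (quotient_map x) e0'.
rewrite qx0 add0r => ly.
exists (x - y); split; first by have := csubN yx; rewrite opprB.
apply: xB => /=; rewrite opprB addrCA subrr addr0.
rewrite lt_neqAle -rnormE -(to_realK (ltW e0)) of_real_le (ltW ly) andbT.
by rewrite (inj_eq (can_inj (@of_realK R k))) lt_eqF.
Qed.

Let quotient_normD p q : of_real k (quotient_norm (p + q)) <=
  of_real k (quotient_norm p) + of_real k (quotient_norm q).
Proof. by rewrite -of_realD of_real_le quotient_norm_D. Qed.

Let quotient_normZ (a : K) q :
  of_real k (quotient_norm (a *: q)) = `|a| * of_real k (quotient_norm q).
Proof.
rewrite -[in RHS](to_realK (normr_ge0 a)) -of_realM; congr of_real.
exact: rnorm_homogeneous quotient_norm_ge0 quotient_norm_Z_le a q.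
Qed.

Let quotient_norm_eq0' q : of_real k (quotient_norm q) = 0 -> q = 0.
Proof.
move=> q0; apply: quotient_norm_eq0; apply: (can_inj (@of_realK R k)).
by rewrite q0 of_real0.
Qed.

HB.instance Definition _ := Lmodule_isNormed.Build K quotient
  quotient_normD quotient_normZ quotient_norm_eq0'.

End Subspaces.

Section Szlenk.
Variables (R : realType) (k : scalar_kind).
Local Notation K := (scalar_field R k).
Variable V : normedModType K.

Definition weak_star : Type :=
  initial_topology (fun f : dual V => (dual_fun f : {ptws V -> K^o})).

HB.instance Definition _ := Topological.on weak_star.

Definition weak_star_compact (A : set (dual V)) := compact (A : set weak_star).

Definition absolutely_convex (A : set (dual V)) :=
  forall f g (a b : K), A f -> A g -> `|a| + `|b| <= 1 -> A (a *: f + b *: g).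

Definition diameter (A : set (dual V)) : \bar R :=
  ereal_sup [set (rnorm (f - g))%:E | f in A & g in A].

Definition szlenk_derivative (eps : R) (A : set (dual V)) : set (dual V) :=
  [set f | A f /\ forall U : set weak_star, open U -> U f ->
    (eps%:E < diameter (U `&` A))%E].

End Szlenk.

(* An ordinal is given by a well-ordered type, of which it is the order type. *)
Record ordinal_number := OrdinalNumber {
  ocar :> Type ;
  olt : ocar -> ocar -> Prop ;
  olt_wf : well_founded olt ;
  olt_trans : forall x y z, olt x y -> olt y z -> olt x z ;
  olt_total : forall x y, [\/ olt x y, x = y | olt y x] }.

Lemma olt_irr (a : ordinal_number) (x : a) : ~ olt x x.
Proof.
move: x; apply: (well_founded_ind (@olt_wf a)) => x IH xx; exact: (IH x xx xx).
Qed.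

(* For well-orders, a strictly increasing map exists if and only if the first
   one is isomorphic to an initial segment of the second one. *)
Definition ole (a b : ordinal_number) : Prop :=
  exists f : a -> b, forall x y, olt x y -> olt (f x) (f y).

Section Successor.
Variable a : ordinal_number.

Definition osucc_lt (x y : option a) : Prop :=
  match x, y with
  | Some u, Some v => olt u v
  | Some _, None => True
  | None, _ => False
  end.

Lemma osucc_lt_wf : well_founded osucc_lt.
Proof.
have accS : forall u, Acc osucc_lt (Some u).
  apply: (well_founded_ind (@olt_wf a)) => u IH.
  by apply: Acc_intro => -[v vu|[]]; exact: IH.
move=> [u|]; first exact: accS.
by apply: Acc_intro => -[v _|[]]; exact: accS.
Qed.

Lemma osucc_lt_trans x y z : osucc_lt x y -> osucc_lt y z -> osucc_lt x z.
Proof. by case: x y z => [x|] [y|] [z|] //=; exact: olt_trans. Qed.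

Lemma osucc_lt_total x y : [\/ osucc_lt x y, x = y | osucc_lt y x].
Proof.
case: x y => [x|] [y|] /=; [|exact: Or31|exact: Or33|exact: Or32].
by case: (olt_total x y) => [xy|->|yx];
  [exact: Or31|exact: Or32|exact: Or33].
Qed.

Definition osucc : ordinal_number :=
  OrdinalNumber osucc_lt_wf osucc_lt_trans osucc_lt_total.

End Successor.

Section Transfinite.
Variables (E : Type) (D : set E -> set E) (A : set E).

Definition is_zero (a : ordinal_number) (x : a) := forall y, ~ olt y x.

Definition is_succ_of (a : ordinal_number) (x y : a) :=
  olt y x /\ forall z, olt z x -> z = y \/ olt z y.

Definition is_limit (a : ordinal_number) (x : a) :=
  ~ is_zero x /\ forall y, ~ is_succ_of x y.

(* An element x of a well-ordered type a stands for the ordinal {y | y < x}.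
   Exactly one of the three clauses below applies to x; they say
     D^0(A) = A,  D^(y+1)(A) = D (D^y(A)),  D^x(A) = \bigcap_(y < x) D^y(A). *)
Definition transfinite_step (a : ordinal_number) (x : a)
    (D_ : forall y : a, olt y x -> set E) : set E :=
  [set p | [/\ is_zero x -> A p,
    forall y (yx : olt y x), is_succ_of x y -> D (D_ y yx) p &
    is_limit x -> forall y (yx : olt y x), D_ y yx p]].

Definition transfinite_at (a : ordinal_number) : a -> set E :=
  Fix (@olt_wf a) (fun _ => set E) (@transfinite_step a).

(* D^a(A), read at the top element of a + 1. *)
Definition transfinite (a : ordinal_number) : set E :=
  transfinite_at (None : osucc a).

Lemma transfinite_atE (a : ordinal_number) (x : a) :
  transfinite_at x = transfinite_step (fun y (_ : olt y x) => transfinite_at y).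
Proof.
rewrite /transfinite_at Fix_eq// => {}x f g fg.
suff -> : f = g by [].
by apply: functional_extensionality_dep => y; apply/funext => h; exact: fg.
Qed.

Lemma is_succ_of_inj (a : ordinal_number) (x y z : a) :
  is_succ_of x y -> is_succ_of x z -> y = z.
Proof.
move=> [yx xy] [zx xz]; case: (xz _ yx) => // yz; case: (xy _ zx) => // zy.
by case: (@olt_irr _ y); exact: olt_trans yz zy.
Qed.

Lemma transfinite_at_zero (a : ordinal_number) (x : a) :
  is_zero x -> transfinite_at x = A.
Proof.
move=> x0; rewrite transfinite_atE; apply/seteqP; split=> [p [/(_ x0)]//|p Ap].
split=> // [y yx|[]//]; by case: (x0 y).
Qed.

Lemma transfinite_at_succ (a : ordinal_number) (x y : a) :
  is_succ_of x y -> transfinite_at x = D (transfinite_at y).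
Proof.
move=> xy; rewrite transfinite_atE; apply/seteqP; split=> [p [_ + _]|p Dp].
  by apply=> //; case: xy.
split=> [x0|z zx xz|[_ /(_ y)]//]; first by case: xy => /x0.
by rewrite (is_succ_of_inj xz xy).
Qed.

Lemma transfinite_at_limit (a : ordinal_number) (x : a) :
  is_limit x ->
  transfinite_at x = \bigcap_(y in [set y | olt y x]) transfinite_at y.
Proof.
move=> xl; rewrite transfinite_atE.
apply/seteqP; split=> [p [_ _ /(_ xl)]//|p Dp].
split=> [x0|y yx xy|_ y yx]; last exact: Dp.
  by case: xl => /(_ x0).
by case: xl => _ /(_ y).
Qed.

Lemma transfinite_at_Some (a : ordinal_number) (x : a) :
  transfinite_at (Some x : osucc a) = transfinite_at x.
Proof.
move: x; apply: (well_founded_ind (@olt_wf a)) => x IH.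
have zeroE : is_zero (Some x : osucc a) <-> is_zero x.
  by split=> [x0 y /(x0 (Some y))//|x0 [y|]//= /x0].
have succE y : is_succ_of (Some x : osucc a) (Some y) <-> is_succ_of x y.
  split=> -[yx xy]; split=> //.
    by move=> z /(xy (Some z)) [[]|]; [left|right].
  by move=> [z|]//= /xy [->|]; [left|right].
have limitE : is_limit (Some x : osucc a) <-> is_limit x.
  split=> -[x0 xs]; split; rewrite ?zeroE// -?zeroE// => y.
    by rewrite -succE; exact: xs.
  by case: y => [y|[]//]; rewrite succE; exact: xs.
rewrite !transfinite_atE; apply/seteqP; split=> p [p0 ps pl]; split.
- by rewrite -zeroE.
- by move=> y yx; rewrite -succE -(IH y yx) => xy; exact: (ps (Some y)).
- by rewrite -limitE => xl y yx; rewrite -(IH y yx); exact: (pl xl (Some y)).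
- by rewrite zeroE.
- by move=> [y|//] yx; rewrite succE (IH y yx) => xy; exact: (ps y).
- by rewrite limitE => xl [y|//] yx; rewrite (IH y yx); exact: (pl xl y).
Qed.

Lemma transfinite_osucc (a : ordinal_number) :
  transfinite (osucc a) = D (transfinite a).
Proof.
rewrite /transfinite (@transfinite_at_succ (osucc (osucc a)) None (Some None)).
  by rewrite transfinite_at_Some.
by split=> // -[[x|]|]//= _; [right|left].
Qed.

End Transfinite.

Definition szlenk_derived (R : realType) (k : scalar_kind)
    (V : normedModType (scalar_field R k)) (eps : R) (xi : ordinal_number)
    (A : set (dual V)) : set (dual V) :=
  transfinite (szlenk_derivative eps) A xi.

Section Trees.
Variables (d : Order.disp_t) (T : porderType d).
Implicit Types A B C : set T.

Definition well_ordered A := forall B, B `<=` A -> B !=set0 ->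
  exists2 m, B m & forall b, B b -> (m <= b)%O.

Definition is_tree := forall t : T, well_ordered [set s | (s <= t)%O].

Definition minimals A : set T :=
  [set t | A t /\ forall s, A s -> (s <= t)%O -> s = t].

Definition maximals A : set T :=
  [set t | A t /\ forall s, A s -> (t <= s)%O -> s = t].

Definition rooted := is_subset1 (minimals setT).

Definition is_chain A := forall s t, A s -> A t -> (s <= t)%O \/ (t <= s)%O.

Definition is_branch A :=
  is_chain A /\ forall B, is_chain B -> A `<=` B -> B = A.

Definition well_founded_tree := forall A, is_branch A -> finite_set A.

Definition tree_derived (xi : ordinal_number) : set T :=
  transfinite (fun A => A `\` maximals A) setT xi.

Definition is_tree_rank (rho : ordinal_number) :=
  tree_derived rho = set0 /\
  forall xi, tree_derived xi = set0 -> ole rho xi.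

Definition tree_star : Type := set_type (~` minimals [set: T]).

End Trees.

Section Amalgam.
Variables (d : Order.disp_t) (T : nat -> porderType d).

Definition amalgam_star : Type := {n : nat & tree_star (T n)}.

(* None is the root. *)
Definition amalgam : Type := option amalgam_star.

Variant amalgam_le : amalgam -> amalgam -> Prop :=
| AmalgamRoot t : amalgam_le None t
| AmalgamNode n (s t : tree_star (T n)) :
    (set_val s <= set_val t)%O ->
    amalgam_le (Some (existT _ n s)) (Some (existT _ n t)).

End Amalgam.

Section Bases.
Variables (R : realType) (k : scalar_kind).
Local Notation K := (scalar_field R k).

Section WholeSpace.
Variables (V : normedModType K) (e : nat -> V).

Definition expansion (a : nat -> K) (x : V) :=
  (\sum_(i < n) a i *: e i) @[n --> \oo] --> x.

Definition schauder_basis := forall x, exists! a, expansion a x.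

Definition coefficients (x : V) : nat -> K :=
  xget (fun=> 0) [set a | expansion a x].

Definition basis_projection (n : nat) (x : V) : V :=
  \sum_(i < n) coefficients x i *: e i.

(* sup_n ||P_n||, the two suprema being taken at once. *)
Definition basis_constant : \bar R :=
  ereal_sup [set (rnorm (basis_projection n x))%:E |
    n in [set: nat] & x in [set x | rnorm x <= 1]].

Definition tail_norm (f : dual V) (n : nat) : \bar R :=
  ereal_sup [set (rnorm (f x))%:E |
    x in csub (cspan [set e i | i in [set i | (n <= i)%N]]) `&`
         [set x | rnorm x <= 1]].

(* This is the convention in which a basis is shrinking when, for every
   functional f on the space, the norm of the restriction of f to the closed
   span of (e i)_(i >= n) tends to 0 as n grows. *)
Definition shrinking := forall f : dual V, tail_norm f n @[n --> \oo] --> 0%E.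

End WholeSpace.

Section Basic.
Variables (V : normedModType K) (e : nat -> V).

Lemma in_range_span n : e n \in in_csub (cspan (range e)).
Proof. by apply/asboolP; apply: sub_cspan; exists n. Qed.

Definition in_span (n : nat) : subspace_of (cspan (range e)) :=
  SubspaceOf (in_range_span n).

Definition basic_sequence := schauder_basis in_span.
Definition basic_constant := basis_constant in_span.
Definition shrinking_basic_sequence := basic_sequence /\ shrinking in_span.

End Basic.
End Bases.

Definition norm_separable (R : realType) (k : scalar_kind)
    (V : normedModType (scalar_field R k)) :=
  exists2 A : set V, countable A & dense A.

Section Annihilator.
Variables (R : realType) (k : scalar_kind).
Local Notation K := (scalar_field R k).
Variables (V : normedModType K) (I : Type) (f : I -> dual V).

Definition common_kernel : set V := \bigcap_i [set x | f i x = 0].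

Lemma common_kernel0 : common_kernel 0.
Proof. by move=> i _ /=; rewrite -(scale0r (0 : V)) dualZ scale0r. Qed.

Lemma common_kernel_lin (a : K) x y :
  common_kernel x -> common_kernel y -> common_kernel (a *: x + y).
Proof.
by move=> Zx Zy i _ /=; rewrite dual_linear Zx// Zy// scaler0 addr0.
Qed.

Lemma common_kernel_closed : closed common_kernel.
Proof.
apply: closed_bigI => i _.
apply: (@preimage_closed _ _ (f i) [set 0]) => [x _|].
  exact: dual_continuous.
exact: accessible_closed_set1 (hausdorff_accessible (@norm_hausdorff _ K^o)) 0.
Qed.

Definition kernel_subspace : closed_subspace V :=
  ClosedSubspace common_kernel0 common_kernel_lin common_kernel_closed.

End Annihilator.

Section Families.
Variables (R : realType) (k : scalar_kind).
Local Notation K := (scalar_field R k).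
Variables (X : normedModType K) (A : set (dual X)) (theta : R) (eps : nat -> R).
Variables (d : Order.disp_t) (T : nat -> porderType d).

Definition admissible_families
    (xs : amalgam_star T -> dual X) (x : amalgam_star T -> X) :=
  [/\ forall t, A (xs t), forall t, `|x t| = 1 &
    forall s t : amalgam_star T,
      (amalgam_le (Some s) (Some t) -> xs t (x s) = xs s (x s) /\
         of_real k (eps (tag t) / (8 + theta)) < xs s (x s)) /\
      (~ amalgam_le (Some s) (Some t) -> xs t (x s) = 0)].

Definition enumeration (tau : nat -> amalgam T) :=
  bijective tau /\ forall l m, amalgam_le (tau l) (tau m) -> (l <= m)%N.

(* Shifted by one: the n-th term is x_(tau(n+1)). As tau 0 is the root, the
   default value 0 is never taken. *)
Definition along (tau : nat -> amalgam T) (x : amalgam_star T -> X) (n : nat)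
  : X :=
  oapp x 0 (tau n.+1).

End Families.

(* Main.v *)
From HB Require Import structures.
Require Import Defs.
From mathcomp Require Import all_boot all_order all_algebra.
From mathcomp Require Import complex.
From mathcomp Require Import all_classical all_reals.
From mathcomp Require Import ereal topology normedtype sequences.
From mathcomp Require Import ring lra zify.
Set Implicit Arguments.
Unset Strict Implicit.
Unset Printing Implicit Defensive.
Import Order.TTheory GRing.Theory Num.Theory.
Import numFieldNormedType.Exports.
Local Open Scope classical_set_scope.
Local Open Scope ring_scope.

(** Let [a] be a point of the Szlenk derivative of a set [A] contained in [K],
    and consider a finite set [G] of vectors and a finite set [Phi] of
    functionals.  A weak-star neighbourhood of [a] meets [A] in two points at
    distance more than [eps], so [A] has a point [z] as near to [a] as wanted on
    [G], but at norm distance about [eps / 2] at least from [a].  Since [K] is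
    absolutely convex, a small multiple of [K] contains a [w] such that
    [u = z - a - w] vanishes exactly on [G].  If [G] is large enough with respect
    to [Phi], then every vector of the unit ball agrees on [Phi] with some vector
    of the span of [G] of norm nearly at most one; subtracting it from a vector
    at which [u] is large gives a vector [x] of norm about 2 in the common kernel
    of [Phi], with the same value of [u].  After normalization, [u x] is about
    [eps / 4].  This is [szlenk_step]; it needs [K] to be bounded in norm
    ([uniform_boundedness]), and [small_correction] and [lifting_exists].

    The step is iterated over the nodes of the amalgamated tree, in an order of
    type omega which extends that of the tree.  The point [a] used at a node is
    the point [z] found at its parent: the derived set attached to a node is of
    higher order than those of its successors, because the derivation of the tree
    removes the node later ([tree_levels], [amalgam_levels]).  Let [y t] be the
    increment [u] found at the node [t], divided by [2 + o(1)].  Each new [y t]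
    vanishes on the past vectors and each new [x t] is killed by the past
    functionals, so [y s (x t) = 0] for distinct [s] and [t].  The functional of
    the node [t] is the sum of the increments [y s] over the predecessors [s] of
    [t].  Up to corrections it telescopes to a difference of two points of [K]
    divided by [2 + o(1)], so it belongs to [K]; its value at [x s] is
    [y s (x s)] when [s] is below [t], and zero otherwise.  The constant 8 is the
    product of this factor 2 with the factor 4 of one step.

    The sets [Phi] and [G] can be enlarged at will.  Putting in [Phi] functionals
    which nearly norm the span of the past vectors (Mazur's lemma,
    [nearly_orthogonal_kernel], which uses the Hahn-Banach theorem) makes the
    vectors a basic sequence with constant at most [1 + delta].  When the dual is
    separable, its dense sequence [F] is also put in [Phi], and [G] receives a
    sequence [d] which spans a dense subspace.  All but finitely many vectors are
    then killed by any given [F j], whence the sequence is shrinking, after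
    extension of functionals from the closed span to the whole space.

    For the quotient by the common kernel [Z], let [u] be in the unit ball and let
    [u'] be the vector of the span of the [n]-th set [G] which agrees with [u] on
    the [n]-th set [Phi].  The increments found before the stage [n] take the same
    values at [u] and [u'], the other ones vanish at [u'], so [u'] represents in
    the quotient the [n]-th partial sum of the expansion of the class of [u].
    This bounds the partial sums by [1 + delta].  Almost all increments vanish on
    each [d j], whose class is therefore a finite combination of the classes of
    the vectors; this gives density ([system_quotient_basis]).  Finally, let [u]
    represent a vector of the tail.  Then [u'] is in [Z], so that a functional
    which vanishes on [Z] takes the same value at [u] and [u - u'], and this value
    is small when the functional is near some [F j], as [F j] vanishes at
    [u - u'] ([system_quotient_shrinking]). *)

(** * Scalars, norms and functionals *)

Section Scalars.
Variables (R : realType) (k : scalar_kind).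
Local Notation K := (scalar_field R k).
Implicit Types (a b : K) (r s : R).

Definition modulus a : R := @rnorm R k K^o a.

Lemma modulusE a : of_real k (modulus a) = `|a|.
Proof. exact: (@rnormE R k K^o). Qed.

Lemma modulus_ge0 a : 0 <= modulus a.
Proof. exact: rnorm_ge0. Qed.

Lemma modulusM a b : modulus (a * b) = modulus a * modulus b.
Proof. by apply: (can_inj (@of_realK R k)); rewrite of_realM !modulusE normrM. Qed.

Lemma modulus1 : modulus 1 = 1.
Proof.
by apply: (can_inj (@of_realK R k)); rewrite modulusE normr1 of_real1.
Qed.

Lemma modulus0 : modulus 0 = 0.
Proof. exact: (@rnorm0 _ _ K^o). Qed.

Lemma modulus_eq0 a : modulus a = 0 -> a = 0.
Proof.
by move=> a0; apply/normr0_eq0; rewrite -modulusE a0 of_real0.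
Qed.

Lemma modulusV a : modulus a^-1 = (modulus a)^-1.
Proof.
have [->|a0] := eqVneq a 0; first by rewrite invr0 modulus0 invr0.
have ma : modulus a != 0 by apply: contra_neq a0 => /modulus_eq0.
by apply: (mulfI ma); rewrite -modulusM !mulfV// modulus1.
Qed.

Lemma of_realN r : of_real k (- r) = - of_real k r.
Proof. by apply/eqP; rewrite -addr_eq0 -of_realD addNr of_real0. Qed.

Lemma of_real_lt r s : (of_real k r < of_real k s) = (r < s).
Proof.
by rewrite !lt_neqAle of_real_le (inj_eq (can_inj (@of_realK R k))).
Qed.

Lemma modulus_real r : modulus (of_real k r) = `|r|.
Proof.
apply: (can_inj (@of_realK R k)); rewrite modulusE.
case: (lerP 0 r) => r0.
  by rewrite [in RHS]ger0_norm//; apply: ger0_norm; rewrite -(@of_real0 R k) of_real_le.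
rewrite [in RHS]ltr0_norm// of_realN; apply: ltr0_norm.
by rewrite -(@of_real0 R k) of_real_lt.
Qed.

Lemma modulusD a b : modulus (a + b) <= modulus a + modulus b.
Proof. exact: (@rnormD _ _ K^o). Qed.

Lemma modulusN a : modulus (- a) = modulus a.
Proof. by rewrite /modulus /rnorm normrN. Qed.

Lemma modulusB a b : modulus (a - b) <= modulus a + modulus b.
Proof. by rewrite (le_trans (modulusD _ _))// modulusN. Qed.

(** Rotating a vector by this scalar makes the value [a] of a functional at it
    real and nonnegative. *)
Lemma phase a : exists2 b, modulus b = 1 & b * a = of_real k (modulus a).
Proof.
have [->|a0] := eqVneq a 0.
  by exists 1; rewrite ?modulus1// mulr0 modulus0 of_real0.
have ma : modulus a != 0 by apply: contra_neq a0 => /modulus_eq0.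
exists (of_real k (modulus a) / a); last by rewrite mulfVK.
by rewrite modulusM modulus_real modulusV ger0_norm ?modulus_ge0// mulfV.
Qed.

End Scalars.

Section Norms.
Variables (R : realType) (k : scalar_kind).
Local Notation K := (scalar_field R k).
Variable V : normedModType K.
Implicit Types (a b : K) (x y z : V).

Lemma rnormZm a x : rnorm (a *: x) = modulus a * rnorm x.
Proof. exact: rnormZ. Qed.

Lemma rnormZr (r : R) x : 0 <= r -> rnorm (of_real k r *: x) = r * rnorm x.
Proof. by move=> r0; rewrite rnormZm modulus_real ger0_norm. Qed.

Lemma rnormN x : rnorm (- x) = rnorm x.
Proof. by rewrite /rnorm normrN. Qed.

Lemma rnormB x y : rnorm (x - y) <= rnorm x + rnorm y.
Proof. by rewrite (le_trans (rnormD _ _))// rnormN. Qed.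

Lemma rdistC x y : rnorm (x - y) = rnorm (y - x).
Proof. by rewrite -rnormN opprB. Qed.

Lemma rnorm_eq0 x : rnorm x = 0 -> x = 0.
Proof. by move=> x0; apply/normr0_eq0; rewrite -rnormE x0 of_real0. Qed.

Lemma rdist_triangle y x z : rnorm (x - z) <= rnorm (x - y) + rnorm (y - z).
Proof. by rewrite -[x - z](subrKA y); exact: rnormD. Qed.

Lemma rnorm_triangle y x : rnorm x <= rnorm y + rnorm (x - y).
Proof. by rewrite -{1}[x](subrKC y) rnormD. Qed.

Lemma rnorm_sum (I : Type) (r : seq I) (P : pred I) (F : I -> V) :
  rnorm (\sum_(i <- r | P i) F i) <= \sum_(i <- r | P i) rnorm (F i).
Proof.
elim/big_ind2: _ => [|x u y v xu yv|//]; first by rewrite rnorm0.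
by rewrite (le_trans (rnormD _ _))// lerD.
Qed.

Lemma nbhs_rnormP x (A : set V) :
  nbhs x A <-> exists2 e : R, 0 < e & forall y, rnorm (x - y) < e -> A y.
Proof.
split=> [/nbhs_normP[e /= e0 xA]|[e e0 xA]].
  have ee : of_real k (to_real e) = e by rewrite to_realK// ltW.
  exists (to_real e); first by rewrite -(@of_real_lt R k) ee of_real0.
  by move=> y xy; apply: xA; rewrite /= -rnormE -ee of_real_lt.
apply/nbhs_normP; exists (of_real k e); first by rewrite /= -(@of_real0 R k) of_real_lt.
by move=> y /= xy; apply: xA; rewrite -(@of_real_lt R k) rnormE.
Qed.

Lemma cvg_rnormP (u : nat -> V) x : u @ \oo --> x <->
  forall e : R, 0 < e -> exists N, forall n, (N <= n)%N -> rnorm (x - u n) < e.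
Proof.
split=> [ux e e0|ux A /nbhs_rnormP[e e0 xA]].
  have : nbhs x [set y | rnorm (x - y) < e] by apply/nbhs_rnormP; exists e.
  by move=> /ux[N _ uN]; exists N => n Nn; exact: uN.
by have [N uN] := ux e e0; exists N => // n /= Nn; apply: xA; exact: uN.
Qed.

Lemma closure_rnormP (A : set V) x :
  closure A x <-> forall e : R, 0 < e -> exists2 y, A y & rnorm (x - y) < e.
Proof.
split=> [Ax e e0|Ax B /nbhs_rnormP[e e0 xB]].
  have /Ax[y [Ay xy]] : nbhs x [set y | rnorm (x - y) < e].
    by apply/nbhs_rnormP; exists e.
  by exists y.
by have [y Ay xy] := Ax e e0; exists y; split=> //; exact: xB.
Qed.

End Norms.

Section DualBasics.
Variables (R : realType) (k : scalar_kind).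
Local Notation K := (scalar_field R k).
Variable V : normedModType K.
Implicit Types (a b : K) (x y z : V) (f g : dual V).

Lemma dualD f x y : f (x + y) = f x + f y.
Proof. by have := dual_linear f 1 x y; rewrite !scale1r. Qed.

Lemma dual0 f : f 0 = 0.
Proof. by rewrite -(scale0r (0 : V)) dualZ scale0r. Qed.

Lemma dualN f x : f (- x) = - f x.
Proof. by rewrite -scaleN1r dualZ scaleN1r. Qed.

Lemma dualB f x y : f (x - y) = f x - f y.
Proof. by rewrite dualD dualN. Qed.

Lemma dual_sum (I : Type) (r : seq I) (P : pred I) (F : I -> V) f :
  f (\sum_(i <- r | P i) F i) = \sum_(i <- r | P i) f (F i).
Proof. by elim/big_rec2: _ => [|i u v _ <-]; rewrite ?dual0// dualD. Qed.

Lemma dual_oppE f x : (- f) x = - f x. Proof. by []. Qed.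

Lemma dual_subE f g x : (f - g) x = f x - g x. Proof. by []. Qed.

Lemma dual_sumE (I : Type) (r : seq I) (P : pred I) (F : I -> dual V) x :
  (\sum_(i <- r | P i) F i) x = \sum_(i <- r | P i) F i x.
Proof. by elim/big_rec2: _ => [//|i u v _ <-]; rewrite dual_addE. Qed.

Lemma dual_bound f x : modulus (f x) <= opnorm f * rnorm x.
Proof.
have [x0|x0] := eqVneq (rnorm x) 0.
  by rewrite (rnorm_eq0 x0) dual0 modulus0 rnorm0 mulr0.
have x1 : rnorm (of_real k (rnorm x)^-1 *: x) <= 1.
  by rewrite rnormZm modulus_real ger0_norm ?invr_ge0 ?rnorm_ge0// mulVf.
have := opnorm_ub f x1; rewrite dualZ rnormZm modulus_real.
rewrite ger0_norm ?invr_ge0 ?rnorm_ge0// mulrC ler_pdivrMr//.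
by rewrite lt_neqAle eq_sym x0 rnorm_ge0.
Qed.

Lemma opnorm_rnorm f : rnorm f = opnorm f.
Proof. by rewrite /rnorm /= of_realK. Qed.

Lemma dual_of_bounded (f : V -> K) (M : R) :
  (forall a x y, f (a *: x + y) = a * f x + f y) ->
  (forall x, modulus (f x) <= M * rnorm x) ->
  exists2 F : dual V, forall x, F x = f x & opnorm F <= `|M|.
Proof.
move=> flin fM.
pose F : {linear V -> K^o} :=
  HB.pack (f : V -> K^o) (GRing.isLinear.Build _ _ _ _ (f : V -> K^o) flin).
have cF : continuous F.
  apply/linear_bounded_continuous/bounded_funP => r.
  exists (of_real k (`|M| * to_real r)) => x xr.
  rewrite -(rnormE (F x : K^o)) of_real_le (le_trans (fM x))//.
  have r0 : 0 <= r by rewrite (le_trans _ xr).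
  rewrite (@le_trans _ _ (`|M| * rnorm x))//.
    by rewrite ler_wpM2r ?rnorm_ge0// ler_norm.
  by rewrite ler_wpM2l// -(@of_real_le R k) rnormE to_realK.
have Ff : (F : V -> K^o) \in @functional R k V by apply/asboolP; split.
exists (Dual Ff) => //; apply: opnorm_le => x x1 /=.
apply: le_trans (fM x) _; rewrite (@le_trans _ _ (`|M| * rnorm x))//.
  by rewrite ler_wpM2r ?rnorm_ge0// ler_norm.
exact: ler_piMr.
Qed.

End DualBasics.

(** * The Hahn-Banach theorem *)

Section HahnBanachReal.
Variables (R : realType) (k : scalar_kind).
Local Notation K := (scalar_field R k).
Variables (V : normedModType K) (c : R).
Hypothesis c_ge0 : 0 <= c.
Implicit Types (S : set (V * R)) (u v : V * R) (x y : V) (r s : R).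

(** A partially defined real linear functional is handled through its graph;
    the domination makes the graph of a linear relation functional. *)
Definition dominated_graph S :=
  (forall r u v, S u -> S v -> S (of_real k r *: u.1 + v.1, r * u.2 + v.2)) /\
  (forall u, S u -> u.2 <= c * rnorm u.1).

Lemma dominated_graph_fun S x r s :
  dominated_graph S -> S (x, r) -> S (x, s) -> r = s.
Proof.
move=> [Slin Sdom] Sr Ss; apply/eqP; rewrite eq_le; apply/andP; split.
  have := Sdom _ (Slin (-1) _ _ Ss Sr) => /=.
  by rewrite of_realN of_real1 scaleN1r addNr rnorm0 mulr0 mulN1r; lra.
have := Sdom _ (Slin (-1) _ _ Sr Ss) => /=.
by rewrite of_realN of_real1 scaleN1r addNr rnorm0 mulr0 mulN1r; lra.
Qed.

Lemma dominated_graph0 S : dominated_graph S -> S !=set0 -> S (0, 0).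
Proof.
move=> [Slin _] [u Su]; have := Slin (-1) _ _ Su Su.
by rewrite of_realN of_real1 scaleN1r addNr mulN1r addNr.
Qed.

(** The values allowed at the new point form a non-empty interval, as the
    domination of the sum of two elements of the graph shows. *)
Lemma dominated_graph_step S x0 : dominated_graph S -> S (0, 0) ->
  exists S', [/\ dominated_graph S', S `<=` S' & exists s, S' (x0, s)].
Proof.
move=> [Slin Sdom] S0.
pose lo := [set u.2 - c * rnorm (u.1 - x0) | u in S].
have lo_le u v : S u -> S v ->
    u.2 - c * rnorm (u.1 - x0) <= c * rnorm (v.1 + x0) - v.2.
  move=> Su Sv; have := Sdom _ (Slin 1 _ _ Su Sv).
  rewrite /= of_real1 scale1r mul1r => uv.
  have : rnorm (u.1 + v.1) <= rnorm (u.1 - x0) + rnorm (v.1 + x0).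
    have -> : u.1 + v.1 = (u.1 - x0) + (v.1 + x0) by rewrite addrACA addNr addr0.
    exact: rnormD.
  by move/(ler_wpM2l c_ge0); rewrite mulrDr; lra.
have sup_lo : has_sup lo.
  split; first by exists (0 - c * rnorm (0 - x0)), (0, 0).
  by exists (c * rnorm (0 + x0) - 0) => _ [u Su <-]; exact: (lo_le u (0, 0)).
pose s0 := sup lo.
have s0_ge u : S u -> u.2 - c * rnorm (u.1 - x0) <= s0.
  by move=> Su; apply: ub_le_sup; [case: sup_lo|exists u].
have s0_le v : S v -> s0 <= c * rnorm (v.1 + x0) - v.2.
  move=> Sv; apply: ge_sup; first by case: sup_lo.
  by move=> _ [u Su <-]; exact: lo_le.
have scale_mem r u : S u -> S (of_real k r *: u.1, r * u.2).
  by move=> Su; have := Slin r _ _ Su S0; rewrite /= !addr0.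
exists [set w | exists u r, S u /\
  w = (u.1 + of_real k r *: x0, u.2 + r * s0)].
split; [split|by move=> u Su; exists u, 0; rewrite of_real0 scale0r mul0r !addr0; case: u Su|].
- move=> r _ _ [u [a [Su ->]]] [v [b [Sv ->]]].
  exists (of_real k r *: u.1 + v.1, r * u.2 + v.2), (r * a + b); split.
    exact: Slin.
  rewrite /= of_realD of_realM scalerDl -scalerA scalerDr; congr pair; last lra.
  by rewrite addrACA.
- move=> _ [u [r [Su ->]]] /=.
  have [r0|r0|->] := ltrgt0P r; last first.
  + by rewrite of_real0 scale0r mul0r !addr0; exact: Sdom.
  + have := s0_ge _ (scale_mem (- r)^-1 _ Su) => /=.
    have rE : rnorm (of_real k (- r)^-1 *: u.1 - x0) =
        (- r)^-1 * rnorm (u.1 + of_real k r *: x0).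
      have nr : 0 <= (- r)^-1 by rewrite invr_ge0 oppr_ge0 ltW.
      rewrite -rnormZr// scalerDr scalerA -of_realM.
      have -> : (- r)^-1 * r = -1 by rewrite invrN mulNr mulVf// lt_eqF.
      by rewrite (of_realN k 1) of_real1 scaleN1r.
    rewrite rE mulrCA -mulrBr mulrC ler_pdivrMr ?oppr_gt0//; lra.
  + have := s0_le _ (scale_mem r^-1 _ Su) => /=.
    have rE : rnorm (of_real k r^-1 *: u.1 + x0) =
        r^-1 * rnorm (u.1 + of_real k r *: x0).
      have nr : 0 <= r^-1 by rewrite invr_ge0 ltW.
      rewrite -rnormZr// scalerDr scalerA.
      by rewrite -of_realM mulVf ?gt_eqF// of_real1 scale1r.
    rewrite rE mulrCA -mulrBr mulrC ler_pdivlMr//; lra.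
- exists s0, (0, 0), 1; split=> //=.
  by rewrite of_real1 scale1r mul1r !add0r.
Qed.

Lemma hahn_banach_real S : dominated_graph S -> S !=set0 ->
  exists G : V -> R, [/\ forall r x y, G (of_real k r *: x + y) = r * G x + G y,
    forall x, G x <= c * rnorm x & forall u, S u -> G u.1 = u.2].
Proof.
move=> Sd S_neq0.
(* The empty graph is admitted only because it is the union of the empty
   chain. *)
pose P := [set S' : set (V * R) | S' = set0 \/ (S `<=` S' /\ dominated_graph S')].
have [F FP totF|M [PM Mmax]] := @Zorn_bigcup _ P.
  have [F0|] := pselect (forall A, F A -> A = set0).
    by left; rewrite -subset0 => u [A FA]; rewrite (F0 _ FA).
  move=> /existsNP[A0 /not_implyP[FA0 A0n]]; right.
  have [//|[SA0 dA0]] := FP _ FA0; split.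
    by move=> u Su; exists A0 => //; exact: SA0.
  split=> [r u v [A FA Au] [B FB Bv]|u [A FA Au]].
    have [AB|BA] := totF _ _ FA FB.
      have [B0|[_ [Blin _]]] := FP _ FB; first by rewrite B0 in Bv.
      by exists B => //; apply: Blin => //; exact: AB.
    have [A0'|[_ [Alin _]]] := FP _ FA; first by rewrite A0' in Au.
    by exists A => //; apply: Alin => //; exact: BA.
  by have [A0'|[_ [_]]] := FP _ FA; [rewrite A0' in Au|exact].
have {PM}[M0|[SM Md]] := PM.
  exfalso; apply: (Mmax S); last by right; split.
  by rewrite M0; split; [exact: sub0set|move=> S0; case: S_neq0 => u /S0].
have M0 : M (0, 0) by apply: dominated_graph0 => //; case: S_neq0 => u /SM; exists u.
have Mtot x : exists s, M (x, s).
  have [S' [S'd MS' [s S's]]] := dominated_graph_step x Md M0.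
  have [S'M|S'M] := pselect (S' `<=` M); first by exists s; exact: S'M.
  exfalso; apply: (Mmax S'); last by right; split=> //; exact: subset_trans MS'.
  by split.
have [G MG] := choice Mtot; exists G; split.
- move=> r x y; apply: (dominated_graph_fun Md (MG _)).
  exact: (Md.1 r (x, G x) (y, G y)).
- by move=> x; exact: (Md.2 (x, G x)).
- by move=> [x s] /SM Mxs; exact: dominated_graph_fun Md (MG x) Mxs.
Qed.

End HahnBanachReal.

Section RealPart.
Variables (R : realType) (k : scalar_kind).
Local Notation K := (scalar_field R k).
Implicit Types (a b : K) (r s : R).

(** With [0] in place of the imaginary unit, the formulas which recover a
    complex functional from its real part remain true over the reals. *)
Definition imaginary : K :=
  match k return scalar_field R k with
  | RealScalars => 0
  | ComplexScalars => 'i%C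
  end.

Lemma to_realD a b : to_real (a + b) = to_real a + to_real b.
Proof. by move: a b; case: k => //= -[? ?] [? ?]. Qed.

Lemma to_realMl r a : to_real (of_real k r * a) = r * to_real a.
Proof. by move: a; case: k => //= -[? ?] /=; rewrite mul0r subr0. Qed.

Lemma to_real_le_modulus a : to_real a <= modulus a.
Proof.
rewrite /modulus /rnorm; move: a; case: k => /= a; first exact: ler_norm.
have : complex.Re a <= `|complex.Re a| by exact: ler_norm.
move=> /le_trans; apply.
by have := normc_ge_Re a; rewrite lecE /= => /andP[_].
Qed.

Lemma to_real_imaginary a :
  a = of_real k (to_real a) - imaginary * of_real k (to_real (imaginary * a)).
Proof.
rewrite /imaginary; move: a; case: k => /= [a|[a b]]; first by rewrite mul0r subr0.
apply/eqP; rewrite eq_complex /=; apply/andP; split; apply/eqP; lra.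
Qed.

Lemma imaginary_sqr : imaginary = 0 \/ imaginary * imaginary = -1.
Proof.
rewrite /imaginary; case: k; [by left|right].
by apply/eqP; rewrite eq_complex /=; apply/andP; split; apply/eqP; lra.
Qed.

End RealPart.
Arguments imaginary {R k}.

Section HahnBanach.
Variables (R : realType) (k : scalar_kind).
Local Notation K := (scalar_field R k).
Variable V : normedModType K.

(** The real part of [f] is extended as a real functional, and the extension is
    the real part of a functional over the scalars.  The modulus of a value is
    the real part of the value at a rotated vector, hence the bound. *)
Theorem hahn_banach (Y : set V) (f : V -> K) (c : R) : 0 <= c -> Y 0 ->
  (forall (a : K) x y, Y x -> Y y -> Y (a *: x + y)) ->
  (forall (a : K) x y, Y x -> Y y -> f (a *: x + y) = a * f x + f y) ->
  (forall x, Y x -> modulus (f x) <= c * rnorm x) ->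
  exists2 F : dual V, (forall x, Y x -> F x = f x) & opnorm F <= c.
Proof.
move=> c0 Y0 Ylin flin fc.
have f0 : f 0 = 0.
  by have := flin (-1) _ _ Y0 Y0; rewrite scaleN1r addNr mulN1r addNr.
have YZ (a : K) x : Y x -> Y (a *: x).
  by move=> Yx; have := Ylin a _ _ Yx Y0; rewrite addr0.
have fZ (a : K) x : Y x -> f (a *: x) = a * f x.
  by move=> Yx; have := flin a _ _ Yx Y0; rewrite !addr0 f0 addr0.
pose S := [set u : V * R | Y u.1 /\ u.2 = to_real (f u.1)].
have Sd : dominated_graph c S.
  split=> [r [x s] [y t] [/= Yx ->] [/= Yy ->]|[x s] [/= Yx ->]].
    by split=> /=; [exact: Ylin|rewrite flin// to_realD to_realMl].
  exact: le_trans (to_real_le_modulus _) (fc _ Yx).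
have [|G [Glin Gc GS]] := hahn_banach_real c0 Sd.
  by exists (0, to_real (f 0)).
have G0 : G 0 = 0 by have := Glin (-1) 0 0; rewrite scaler0 addr0; lra.
have GD x y : G (x + y) = G x + G y.
  by have := Glin 1 x y; rewrite of_real1 scale1r mul1r.
have GZ r x : G (of_real k r *: x) = r * G x.
  by have := Glin r x 0; rewrite !addr0 G0 addr0.
pose F x : K := of_real k (G x) - imaginary * of_real k (G (imaginary *: x)).
have FD x y : F (x + y) = F x + F y.
  by rewrite /F GD scalerDr GD !of_realD mulrDr opprD addrACA.
have FZr r x : F (of_real k r *: x) = of_real k r * F x.
  rewrite /F GZ scalerA (mulrC imaginary (of_real k r)) -scalerA GZ !of_realM mulrBr.
  by rewrite [imaginary * (_ * _)]mulrCA.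
have FZi x : F (imaginary *: x) = imaginary * F x.
  rewrite /F scalerA; have [i0|ii] := imaginary_sqr R k.
    by rewrite {1}i0 scale0r G0 of_real0 [X in _ - X * _]i0 i0 !mul0r subrr.
  rewrite ii scaleN1r mulrBr mulrA ii mulN1r opprK addrC.
  have -> : - x = of_real k (-1) *: x by rewrite of_realN of_real1 scaleN1r.
  by rewrite GZ of_realM of_realN of_real1 mulN1r mulrN opprK.
have Flin (a : K) x y : F (a *: x + y) = a * F x + F y.
  rewrite FD; congr (_ + _).
  have FN z : F (- z) = - F z.
    have -> : - z = of_real k (-1) *: z by rewrite of_realN of_real1 scaleN1r.
    by rewrite FZr of_realN of_real1 mulN1r.
  rewrite {1}(to_real_imaginary a) scalerBl FD FN -scalerA FZi !FZr.
  by rewrite [in RHS](to_real_imaginary a) mulrBl mulrA.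
have reF x : to_real (F x) = G x.
  rewrite /F; move: (G (imaginary *: x)) (G x) => v u; rewrite /imaginary.
  by case: k => /=; [rewrite mul0r subr0|rewrite mul0r mulr0 subrr subr0].
have Fc x : modulus (F x) <= c * rnorm x.
  have [b b1 bF] := phase (F x).
  have Fbx : F (b *: x) = of_real k (modulus (F x)).
    have := Flin b x 0; rewrite addr0 bF => ->.
    by rewrite {2}/F scaler0 G0 of_real0 mulr0 subr0 addr0.
  rewrite -(of_realK k (modulus (F x))) -Fbx reF (le_trans (Gc _))//.
  by rewrite rnormZm b1 mul1r.
have [H HF Hc] := dual_of_bounded Flin Fc.
exists H; last by rewrite (le_trans Hc)// ger0_norm.
have GY y : Y y -> G y = to_real (f y) by move=> Yy; exact: (GS (y, _)).
by move=> x Yx; rewrite HF /F !GY ?fZ -?to_real_imaginary//; exact: YZ.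
Qed.

Lemma norming_functional (x : V) :
  exists2 f : dual V, opnorm f <= 1 & f x = of_real k (rnorm x).
Proof.
have [->|x0] := eqVneq x 0.
  exists 0; last by rewrite dual_zeroE rnorm0 of_real0.
  by apply: opnorm_le => y _; rewrite dual_zeroE rnorm0.
pose Y := [set y | exists a : K, y = a *: x].
pose f y : K := xget 0 [set a : K | y = a *: x] * of_real k (rnorm x).
have fE (a : K) : f (a *: x) = a * of_real k (rnorm x).
  congr (_ * _); case: xgetP => [b _ /eqP|/(_ a)/(_ erefl)//].
  by rewrite -subr_eq0 -scalerBl scaler_eq0 (negbTE x0) orbF subr_eq0 => /eqP.
have [||||F FY F1] := @hahn_banach Y f 1 ler01.
- by exists 0; rewrite scale0r.
- move=> a _ _ [b ->] [c ->].
  by exists (a * b + c); rewrite scalerDl scalerA.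
- move=> a _ _ [b ->] [c ->].
  by rewrite scalerA -scalerDl !fE mulrDl mulrA.
- move=> _ [b ->].
  by rewrite fE modulusM modulus_real ger0_norm ?rnorm_ge0// mul1r rnormZm.
exists F => //; rewrite FY; last by exists 1; rewrite scale1r.
by rewrite -[X in f X]scale1r fE mul1r.
Qed.

End HahnBanach.

(** * Finite nets for finitely many functionals *)

Section Nets.
Variables (R : realType) (k : scalar_kind).
Local Notation K := (scalar_field R k).

Lemma real_cells (M eta : R) : 0 < eta ->
  exists (N : nat) (c : R -> 'I_N.+1), forall r s : R,
    `|r| <= M -> `|s| <= M -> c r = c s -> `|r - s| <= eta.
Proof.
move=> eta0; pose q r := Num.truncn ((r + M) / eta).
exists (Num.truncn ((M + M) / eta)), (fun r => inord (q r)) => r s rM sM.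
have q_ge0 t : `|t| <= M -> 0 <= (t + M) / eta.
  by rewrite ler_norml => /andP[? _]; rewrite divr_ge0 ?(ltW eta0)//; lra.
have q_lt t : `|t| <= M -> (q t < (Num.truncn ((M + M) / eta)).+1)%N.
  rewrite ltnS => tM; apply: le_truncn.
  by rewrite ler_pM2r ?invr_gt0// lerD2r (le_trans (ler_norm t)).
move=> /(congr1 val); rewrite /= !inordK ?q_lt// => qrs.
have := truncn_itv (q_ge0 _ rM); have := truncn_itv (q_ge0 _ sM).
rewrite -/(q r) -/(q s) qrs -natr1.
rewrite !ler_pdivlMr// !ltr_pdivrMr// mulrDl mul1r => /andP[? ?] /andP[? ?].
by rewrite ler_norml; apply/andP; split; lra.
Qed.

Lemma scalar_cells (M eta : R) : 0 < eta ->
  exists (C : finType) (c : K -> C), forall a b : K,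
    modulus a <= M -> modulus b <= M -> c a = c b -> modulus (a - b) <= eta.
Proof.
move=> eta0; have eta20 : 0 < eta / 2 by rewrite divr_gt0.
have [N [c cP]] := real_cells M eta20.
exists ('I_N.+1 * 'I_N.+1)%type,
  (fun a => (c (to_real a), c (to_real (imaginary * a)))) => a b aM bM [cre cim].
have i1 : modulus (imaginary : K) <= 1.
  have [->|ii] := imaginary_sqr R k; first by rewrite modulus0.
  have := congr1 (@modulus R k) ii; rewrite modulusM modulusN modulus1.
  by rewrite -expr2 => /eqP; rewrite sqrp_eq1 ?modulus_ge0// => /eqP ->.
have ReM (z : K) : modulus z <= M -> `|to_real z| <= M.
  move=> zM; rewrite ler_norml (le_trans (to_real_le_modulus z) zM) andbT.
  rewrite lerNl -mulN1r -(to_realMl (-1) z) of_realN of_real1 mulN1r.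
  by rewrite (le_trans (to_real_le_modulus _))// modulusN.
have ImM (z : K) : modulus z <= M -> `|to_real (imaginary * z)| <= M.
  move=> zM; apply: ReM; rewrite modulusM (le_trans _ zM)//.
  by rewrite ler_piMl ?modulus_ge0.
have to_realB (x y : K) : to_real (x - y) = to_real x - to_real y.
  rewrite to_realD -(mulN1r y) -of_real1 -of_realN to_realMl.
  by rewrite mulN1r.
rewrite (to_real_imaginary (a - b)) (le_trans (modulusB _ _))//.
rewrite modulusM !modulus_real mulrBr !to_realB [leRHS]splitr lerD//.
  by apply: cP => //; exact: ReM.
rewrite (@le_trans _ _ `|to_real (imaginary * a) - to_real (imaginary * b)|)//.
  by rewrite ler_piMl.
by apply: cP => //; exact: ImM.
Qed.

Variable V : normedModType K.
Implicit Types (Phi : seq (dual V)) (x y : V) (G : seq V).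

Lemma functional_cells Phi (eta : R) : 0 < eta ->
  exists (C : finType) (c : V -> C), forall x y,
    rnorm x <= 1 -> rnorm y <= 1 -> c x = c y ->
    forall f, f \in Phi -> modulus (f (x - y)) <= eta.
Proof.
move=> eta0; elim: Phi => [|f Phi [C [c cP]]]; first by exists unit, (fun=> tt).
have [D [d dP]] := scalar_cells (opnorm f) eta0.
exists (C * D)%type, (fun x => (c x, d (f x))) => x y x1 y1 [cxy dxy] g.
rewrite in_cons => /orP[/eqP ->|gPhi]; last exact: cP.
by rewrite dualB; apply: dP => //; exact: opnorm_ub.
Qed.

(** The functionals are bounded on the unit ball, which falls into finitely many
    cells on which they are nearly constant; a net has one point in each non-empty
    cell. *)
Lemma finite_net Phi (S : set V) (eta : R) : 0 < eta ->
  (forall x, S x -> rnorm x <= 1) ->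
  exists2 G : seq V, (forall g, g \in G -> S g) & forall x, S x ->
    exists2 g, g \in G & forall f, f \in Phi -> modulus (f (x - g)) <= eta.
Proof.
move=> eta0 S1; have [C [c cP]] := functional_cells Phi eta0.
pose rep (j : C) := match pselect (exists x, S x /\ c x = j) with
  | left h => Some (sval (cid h)) | right _ => None end.
have repP j g : rep j = Some g -> S g /\ c g = j.
  by rewrite /rep; case: pselect => // h [<-]; exact: (svalP (cid h)).
exists (pmap rep (enum C)).
  by move=> g; rewrite mem_pmap => /mapP[j _ /esym/repP[]].
move=> x Sx; case rE : (rep (c x)) => [g|]; last first.
  by move: rE; rewrite /rep; case: pselect => // -[]; exists x.
have [Sg cg] := repP _ _ rE.
exists g; last by apply: cP => //; exact: S1.
by rewrite mem_pmap -rE map_f// mem_enum.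
Qed.

(** A vector on which finitely many functionals are small is close to a common
    zero of these functionals, and differs from it by a vector of a fixed
    finite-dimensional space. *)
Lemma kernel_approximation Phi : exists (C : R) (B : seq V), 0 <= C /\
  forall x (eta : R), 0 <= eta ->
  (forall f, f \in Phi -> modulus (f x) <= eta) ->
  exists m, [/\ forall f, f \in Phi -> f m = 0, rnorm (x - m) <= C * eta &
    forall u : dual V, (forall b, b \in B -> u b = 0) -> u (x - m) = 0].
Proof.
elim: Phi => [|f Phi [C [B [C0 CB]]]].
  exists 0, [::]; split=> // x eta eta0 _; exists x; split=> //.
    by rewrite subrr rnorm0 mul0r.
  by move=> u _; rewrite subrr dual0.
have [fker|] := pselect (forall m, (forall g, g \in Phi -> g m = 0) -> f m = 0).
  exists C, B; split=> // x eta eta0 xeta.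
  have [|m [mPhi mC mB]] := CB x eta eta0.
    by move=> g gPhi; apply: xeta; rewrite in_cons gPhi orbT.
  exists m; split=> // g; rewrite in_cons => /orP[/eqP ->|]; last exact: mPhi.
  exact: fker.
move=> /existsNP[b0 /not_implyP[b0Phi /eqP fb0]].
pose b := (f b0)^-1 *: b0.
have fb : f b = 1 by rewrite dualZ [_ *: _]mulVf.
have bPhi g : g \in Phi -> g b = 0 by move=> /b0Phi gb0; rewrite dualZ gb0 scaler0.
exists (C + (1 + opnorm f * C) * rnorm b), (b :: B); split.
  by rewrite addr_ge0// mulr_ge0 ?rnorm_ge0// addr_ge0// mulr_ge0 ?opnorm_ge0.
move=> x eta eta0 xeta.
have [|m [mPhi mC mB]] := CB x eta eta0.
  by move=> g gPhi; apply: xeta; rewrite in_cons gPhi orbT.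
have xmE : x - (m - f m *: b) = (x - m) + f m *: b by rewrite opprB addrA addrAC.
exists (m - f m *: b); split.
- move=> g; rewrite in_cons => /orP[/eqP ->|gPhi]; rewrite dualB dualZ.
    by rewrite fb [_ *: 1]mulr1 subrr.
  by rewrite mPhi// bPhi// scaler0 subr0.
- rewrite xmE (le_trans (rnormD _ _))// rnormZm mulrDl lerD// mulrAC.
  rewrite ler_wpM2r ?rnorm_ge0//.
  have -> : f m = f x - f (x - m) by rewrite -dualB subKr.
  rewrite (le_trans (modulusB _ _))// mulrDl mul1r lerD//.
    by apply: xeta; rewrite mem_head.
  by rewrite (le_trans (dual_bound _ _))// -mulrA ler_wpM2l ?opnorm_ge0.
- move=> u uB; rewrite xmE dualD mB ?add0r; last first.
    by move=> g gB; apply: uB; rewrite in_cons gB orbT.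
  by rewrite dualZ uB ?mem_head// scaler0.
Qed.

(** The values of finitely many functionals on the unit ball are already taken,
    up to [1 + delta], on a finite-dimensional space: a functional which
    vanishes on [G] vanishes on that space. *)
Definition lifting Phi (delta : R) G := forall x, rnorm x <= 1 ->
  exists x', [/\ rnorm x' <= 1 + delta, forall f, f \in Phi -> f x' = f x &
    forall u : dual V, (forall g, g \in G -> u g = 0) -> u x' = 0].

(** A vector differs from a point of a finite net by a vector on which [Phi] is
    small, that is, by a common zero of [Phi] and a small vector of a fixed
    finite-dimensional space. *)
Lemma lifting_exists Phi (delta : R) : 0 < delta -> exists G, lifting Phi delta G.
Proof.
move=> delta0; have [C [B [C0 CB]]] := kernel_approximation Phi.
have C1 : 0 < C + 1 by rewrite ltr_wpDl.
have eta0 : 0 < delta / (C + 1) by rewrite divr_gt0.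
have [G G1 netG] := @finite_net Phi [set x | rnorm x <= 1] _ eta0 (fun=> id).
exists (G ++ B) => x x1; have [g gG xg] := netG x x1.
have [m [mPhi mC mB]] := CB (x - g) _ (ltW eta0) xg.
exists (x - m); split.
- have -> : x - m = g + (x - g - m) by rewrite addrA subrKC.
  rewrite (le_trans (rnormD _ _))// lerD//; first exact: G1.
  rewrite (le_trans mC)// mulrCA ger_pMr// ler_pdivrMr// mul1r lerDl.
  exact: ler01.
- by move=> f fPhi; rewrite dualB mPhi// subr0.
- move=> u uGB; have -> : x - m = g + (x - g - m) by rewrite addrA subrKC.
  rewrite dualD uGB ?mem_cat ?gG// add0r; apply: mB => b bB.
  by apply: uGB; rewrite mem_cat bB orbT.
Qed.

Lemma lifting_sub Phi (delta : R) G G' :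
  {subset G <= G'} -> lifting Phi delta G -> lifting Phi delta G'.
Proof.
move=> GG' liftG x /liftG[x' [x'1 x'Phi x'G]]; exists x'; split=> // u uG'.
by apply: x'G => g /GG'; exact: uG'.
Qed.

(** Mazur's lemma: a finite-dimensional space [E], given by finitely many
    functionals which control its norm, is nearly orthogonal to the common
    kernel of suitable functionals. *)
Lemma nearly_orthogonal_kernel (E : set V) (Psi : seq (dual V)) (C delta : R) : 0 < delta ->
  0 <= C -> E 0 -> (forall (a : K) x y, E x -> E y -> E (a *: x + y)) ->
  (forall e (r : R), E e -> 0 <= r ->
    (forall f, f \in Psi -> modulus (f e) <= r) -> rnorm e <= C * r) ->
  exists N : seq (dual V), forall e x, E e ->
    (forall f, f \in N -> f x = 0) -> rnorm e <= (1 + delta) * rnorm (e + x).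
Proof.
move=> delta0 C0 E0 Elin EC.
have d1 : 0 < 1 + delta by rewrite addr_gt0.
have C1 : 0 < C + 1 by rewrite ltr_wpDl.
(* A norm one vector of [E] is within [C * eta] of the net; twice this distance
   must be at most [1 - (1 + delta)^-1]. *)
pose eta := delta / (1 + delta) / 2 / (C + 1).
have eta0 : 0 < eta by rewrite !divr_gt0.
have Ceta : C * eta <= delta / (1 + delta) / 2.
  rewrite /eta mulrCA ger_pMr ?divr_gt0// ler_pdivrMr// mul1r; lra.
have [|G GS netG] := @finite_net Psi [set x | E x /\ rnorm x <= 1] _ eta0.
  by move=> x [].
have nf x : exists f : dual V, opnorm f <= 1 /\ f x = of_real k (rnorm x).
  by have [f ? ?] := norming_functional x; exists f.
have [F FP] := choice nf.
exists (map F G) => e x Ee xN.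
have [->|e0] := eqVneq (rnorm e) 0; first by rewrite mulr_ge0 ?rnorm_ge0// ltW.
have epos : 0 < rnorm e by rewrite lt_neqAle eq_sym e0 rnorm_ge0.
have EZ (a : K) y : E y -> E (a *: y).
  by move=> Ey; have := Elin a _ _ Ey E0; rewrite addr0.
pose e1 := of_real k (rnorm e)^-1 *: e.
have e11 : rnorm e1 = 1 by rewrite rnormZr ?invr_ge0 ?rnorm_ge0// mulVf.
have [|g gG eg] := netG e1; first by split; [exact: EZ|rewrite e11].
have [Eg g1] := GS _ gG.
have e1g : rnorm (e1 - g) <= delta / (1 + delta) / 2.
  rewrite (le_trans _ Ceta)//; apply: EC => //; last exact: ltW.
  have -> : e1 - g = (-1) *: g + e1 by rewrite scaleN1r addrC.
  by apply: Elin => //; exact: EZ.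
have [Fg1 Fgg] := FP g.
have Fbound y : modulus (F g y) <= rnorm y.
  rewrite (le_trans (dual_bound _ _))// ler_piMl//; exact: rnorm_ge0.
have Fge : modulus (F g g) <= modulus (F g e1) + modulus (F g (e1 - g)).
  have -> : F g g = F g e1 - F g (e1 - g) by rewrite -dualB subKr.
  exact: modulusB.
rewrite Fgg modulus_real ger0_norm ?rnorm_ge0// in Fge.
have e1norm := rnorm_triangle g e1; rewrite e11 in e1norm.
have Fe1 : modulus (F g e1) <= (rnorm e)^-1 * rnorm (e + x).
  have -> : F g e1 = of_real k (rnorm e)^-1 * F g (e + x).
    by rewrite dualZ dualD [F g x]xN ?addr0//; apply: map_f.
  rewrite modulusM modulus_real ger0_norm ?invr_ge0 ?rnorm_ge0//.
  by rewrite ler_wpM2l ?invr_ge0 ?rnorm_ge0.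
have := Fbound (e1 - g) => Feg.
have le1 : 1 - delta / (1 + delta) <= (rnorm e)^-1 * rnorm (e + x) by lra.
have dE : 1 - delta / (1 + delta) = (1 + delta)^-1.
  by rewrite -[X in X - _](mulfV (lt0r_neq0 d1)) -mulrBl addrK mul1r.
move: le1; rewrite dE mulrC ler_pdivlMr// mulrC ler_pdivrMr// mulrC.
by [].
Qed.

End Nets.

(** * Weak-star compact sets *)

Section WeakStar.
Variables (R : realType) (k : scalar_kind).
Local Notation K := (scalar_field R k).
Variable X : normedModType K.
Implicit Types (f g u v w : dual X) (x y : X) (A : set (dual X)) (G : seq X).

Lemma weak_star_eval_continuous x :
  continuous (fun f : weak_star X => (f : dual X) x : K^o).
Proof.
move=> f; apply: (@continuous_comp (weak_star X) {ptws X -> K^o} K^o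
  (fun f : dual X => dual_fun f : {ptws X -> K^o}) (fun h => h x)).
  exact: (@initial_continuous _ _ (fun f : dual X => dual_fun f : {ptws X -> K^o})).
exact: (@proj_continuous X (fun=> K^o) x).
Qed.

Lemma weak_star_nbhs (f : dual X) G (rho : R) : 0 < rho ->
  exists U : set (weak_star X), [/\ open U, U f &
    forall g, U g -> forall x, x \in G -> modulus (g x - f x) < rho].
Proof.
move=> rho0; elim: G => [|x G [U [Uo Uf UG]]].
  by exists setT; split=> //; exact: openT.
pose B := [set a : K^o | rnorm (f x - a) < rho].
have Bo : open B.
  rewrite openE => a Ba; apply/nbhs_rnormP; exists (rho - rnorm (f x - a)).
    by rewrite subr_gt0.
  move=> b ab; rewrite /B /= (le_lt_trans (rdist_triangle a _ _))//.
  by rewrite -ltrBrDl.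
exists (U `&` (fun g : weak_star X => (g : dual X) x : K^o) @^-1` B); split.
- apply: openI => //; apply: open_comp => // g _.
  exact: weak_star_eval_continuous.
- by split=> //; rewrite /B /= subrr rnorm0.
- move=> g [Ug gB] y; rewrite in_cons => /orP[/eqP ->|yG]; last exact: UG.
  by rewrite /modulus rdistC.
Qed.

Lemma weak_star_compact_pointwise_bounded A : weak_star_compact A ->
  forall x, exists M : R, forall f, A f -> modulus (f x) <= M.
Proof.
move=> /compact_near_coveringP cA x.
have [|N _ NA] := cA nat \oo (fun n (f : weak_star X) =>
  modulus ((f : dual X) x) <= n%:R) _; last first.
  by exists N%:R => f Af; apply: NA => /=.
move=> f Af.
pose n0 := (Num.truncn (modulus ((f : dual X) x)) + 2)%N.
have [U [Uo Uf UG]] := weak_star_nbhs f [:: x] ltr01.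
exists (U, [set n | (n0 <= n)%N]) => /=.
  by split; [exact: open_nbhs_nbhs|exists n0].
move=> [g n] /= [Ug n0n].
have gx := UG g Ug x (mem_head _ _).
rewrite -[X in modulus X](subrKC (f x)) (le_trans (modulusD _ _))//.
rewrite (@le_trans _ _ n0%:R) ?ler_nat// /n0 addn2 -natr1.
rewrite lerD ?(ltW gx)// ltW// truncnS_gt//.
Qed.

End WeakStar.

Section UniformBoundedness.
Variables (R : realType) (k : scalar_kind).
Local Notation K := (scalar_field R k).
Variable X : completeNormedModType K.
Implicit Types (f : dual X) (x : X).

Lemma opnorm_nearly_attained f (c : R) : c < opnorm f ->
  exists2 x, rnorm x <= 1 & c < modulus (f x).
Proof.
move=> cf; apply/not_exists2P => xc; suff : opnorm f <= c by rewrite leNgt cf.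
apply: opnorm_le => x x1; have [//|/negP] := xc x.
by rewrite -leNgt.
Qed.

(** One of two opposite moves will do, since the values of [f] after them differ
    by twice the value of [f] at the move. *)
Lemma opnorm_move f x (r c : R) : 0 < r -> c < opnorm f ->
  exists2 y, rnorm (x - y) <= r & c * r <= modulus (f y).
Proof.
move=> r0 /opnorm_nearly_attained[w w1 cw].
pose v := of_real k r *: w.
have vr : rnorm v <= r by rewrite rnormZr ?(ltW r0)// ger_pMr.
have fv : c * r <= modulus (f v).
  rewrite dualZ modulusM modulus_real (gtr0_norm r0) mulrC ler_pM2l//.
  exact: ltW.
have [h|h] := leP (c * r) (modulus (f (x + v))).
  by exists (x + v) => //; rewrite opprD addrA subrr add0r rnormN.
exists (x - v); first by rewrite opprB addrC subrK.
have : modulus (f (x + v) - f (x - v)) <=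
    modulus (f (x + v)) + modulus (f (x - v)) by exact: modulusB.
have -> : f (x + v) - f (x - v) = of_real k 2 * f v.
  rewrite -dualB opprB addrC addrA subrK dualD -[2]/(1 + 1) of_realD of_real1.
  by rewrite mulrDl mul1r.
rewrite modulusM modulus_real ger0_norm//; lra.
Qed.

Lemma cvg_geometric_steps (u : nat -> X) :
  (forall n, rnorm (u n - u n.+1) <= 3^-1 ^+ n.+1) ->
  exists x, forall n, rnorm (x - u n) <= 3^-1 ^+ n / 2.
Proof.
move=> uS.
have q_gt0 n : 0 < 3^-1 ^+ n :> R by rewrite exprn_gt0// invr_gt0.
have uD n m : rnorm (u n - u (n + m)%N) <= 3^-1 ^+ n / 2 - 3^-1 ^+ (n + m) / 2.
  elim: m => [|m IH]; first by rewrite addn0 !subrr rnorm0.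
  rewrite (le_trans (rdist_triangle (u (n + m)%N) _ _))//.
  have := uS (n + m)%N; rewrite addnS exprS; lra.
have uC n m : (n <= m)%N -> rnorm (u n - u m) <= 3^-1 ^+ n / 2.
  by move=> /subnKC <-; rewrite (le_trans (uD _ _))// gerBl ltW// divr_gt0.
have q_small (e : R) : 0 < e -> exists n, 3^-1 ^+ n / 2 < e.
  move=> e0.
  have /cvgr_lt/(_ e e0)[n _ /(_ n (leqnn n)) /= ne] :
      (fun n => 3^-1 ^+ n : R) @ \oo --> 0.
    by apply: cvg_expr; rewrite ger0_norm ?invr_ge0// invf_lt1//; lra.
  by exists n; have := q_gt0 n; lra.
have /cvg_ex[x ux] : cvgn u.
  apply/cauchy_cvgP/cauchy_exP => _/posnumP[e].
  have e0 : 0 < to_real (e%:num : K).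
    by rewrite -(of_real_lt k) of_real0 to_realK.
  have [n ne] := q_small _ e0.
  exists (u n); exists n => // m /= nm; rewrite -ball_normE /=.
  rewrite -(to_realK (ltW (gt0 e))) -rnormE of_real_lt.
  exact: le_lt_trans (uC _ _ nm) ne.
exists x => n; apply/ler_addgt0Pr => e e0.
have /cvg_rnormP/(_ e e0)[N uN] := ux.
rewrite (le_trans (rdist_triangle (u (maxn n N)) _ _))// addrC lerD//.
  by rewrite rdistC uC// leq_maxl.
by rewrite ltW// uN// leq_maxr.
Qed.

(** A gliding argument: if the norms were unbounded, pick [T n] with norm at least
    [6 n 3 ^ (n + 1)] and move the [n]-th point by [3 ^- (n + 1)] so that the value
    of [T n] becomes at least two thirds of what this distance allows.  The limit
    is within half of this distance of the new point, so one sixth is left, and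
    [T n] is at least [n] at the limit. *)
Theorem uniform_boundedness (A : set (dual X)) :
  (forall x, exists M : R, forall f, A f -> modulus (f x) <= M) ->
  exists M : R, forall f, A f -> opnorm f <= M.
Proof.
move=> Abnd; apply: contrapT => Aunb.
have /choice[T TP] : forall n, exists f, A f /\ n%:R * 6 * 3 ^+ n.+1 < opnorm f.
  move=> n; apply: contrapT => nf; apply: Aunb; exists (n%:R * 6 * 3 ^+ n.+1).
  by move=> f Af; rewrite leNgt; apply/negP => lt_f; apply: nf; exists f.
have q_gt0 n : 0 < 3^-1 ^+ n :> R by rewrite exprn_gt0// invr_gt0.
have T0 n : 0 < opnorm (T n).
  by rewrite (le_lt_trans _ (TP n).2)// !mulr_ge0// exprn_ge0.
have step (p : nat * X) : exists y, rnorm (p.2 - y) <= 3^-1 ^+ p.1.+1 /\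
    opnorm (T p.1) * (2 / 3) * 3^-1 ^+ p.1.+1 <= modulus (T p.1 y).
  have [|y py Ty] := @opnorm_move (T p.1) p.2 _ (opnorm (T p.1) * (2 / 3)) (q_gt0 p.1.+1).
    by rewrite gtr_pMr//; lra.
  by exists y.
have [F FP] := choice step.
pose u := fix u n := if n is n'.+1 then F (n', u n') else 0.
have [x xu] := @cvg_geometric_steps u (fun n => (FP (n, u n)).1).
have [M AM] := Abnd x.
have nM n : n%:R <= M.
  apply: le_trans (AM _ (TP n).1).
  have := (FP (n, u n)).2; rewrite -/(u n.+1) => Tu.
  have Txu : modulus (T n (x - u n.+1)) <= opnorm (T n) * (3^-1 ^+ n.+1 / 2).
    by rewrite (le_trans (dual_bound _ _))// ler_pM2l//; exact: xu.
  have : modulus (T n (u n.+1)) <= modulus (T n x) + modulus (T n (x - u n.+1)).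
    have -> : T n (u n.+1) = T n x - T n (x - u n.+1) by rewrite -dualB subKr.
    exact: modulusB.
  have : n%:R * 6 <= opnorm (T n) * 3^-1 ^+ n.+1.
    by rewrite exprVn ler_pdivlMr ?exprn_gt0// ltW// (TP n).2.
  rewrite mulrA in Txu; move: Tu Txu; rewrite mulrAC; lra.
have := nM (Num.truncn M).+1; rewrite leNgt truncnS_gt//.
Qed.

End UniformBoundedness.

(** * Perturbation inside an absolutely convex set *)

Section Multiples.
Variables (R : realType) (k : scalar_kind).
Local Notation K := (scalar_field R k).
Variable X : normedModType K.
Variable B : set (dual X).
Hypotheses (B_neq0 : B !=set0) (B_convex : absolutely_convex B).
Implicit Types (f g u v w : dual X) (x y : X) (G : seq X) (c d r : R).

Definition multiple c u := exists2 v, B v & u = of_real k c *: v.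

Lemma convexZ (a : K) v : modulus a <= 1 -> B v -> B (a *: v).
Proof.
move=> a1 Bv; have := B_convex (a := a) (b := 0) Bv Bv.
rewrite scale0r addr0 normr0 addr0; apply.
by rewrite -modulusE -(@of_real1 R k) of_real_le.
Qed.

Lemma convex0 : B 0.
Proof.
by case: B_neq0 => v /(@convexZ 0); rewrite scale0r; apply; rewrite modulus0.
Qed.

Lemma multiple0 c : multiple c 0.
Proof. by exists 0; [exact: convex0|rewrite scaler0]. Qed.

Lemma multiple1 u : multiple 1 u <-> B u.
Proof.
split=> [[v Bv ->]|Bu]; first by rewrite of_real1 scale1r.
by exists u; rewrite // of_real1 scale1r.
Qed.

Lemma multipleD c d u v : 0 <= c -> 0 <= d ->
  multiple c u -> multiple d v -> multiple (c + d) (u + v).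
Proof.
move=> c0 d0 [u' Bu' ->] [v' Bv' ->].
have [cd0|cd0] := eqVneq (c + d) 0.
  have [-> ->] : c = 0 /\ d = 0 by split; lra.
  by rewrite of_real0 !scale0r !addr0; exact: multiple0.
have cdp : 0 < c + d by rewrite lt_neqAle eq_sym cd0 addr_ge0.
exists (of_real k (c / (c + d)) *: u' + of_real k (d / (c + d)) *: v').
  apply: B_convex => //; rewrite -!modulusE !modulus_real.
  by rewrite !ger0_norm ?divr_ge0 ?addr_ge0// -of_realD -mulrDl mulfV// of_real1.
by rewrite scalerDr !scalerA -!of_realM !(mulrC (c + d)) !mulfVK.
Qed.

Lemma multipleZ c (a : K) u : multiple c u -> multiple (modulus a * c) (a *: u).
Proof.
move=> [v Bv ->].
have [->|a0] := eqVneq a 0.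
  by rewrite scale0r; exact: multiple0.
have ma : modulus a != 0 by apply: contra_neq a0 => /modulus_eq0.
exists ((a / of_real k (modulus a)) *: v).
  apply: convexZ => //; rewrite modulusM modulusV modulus_real.
  by rewrite ger0_norm ?modulus_ge0// mulfV.
rewrite !scalerA; congr (_ *: _).
have m0 : of_real k (modulus a) != 0.
  by rewrite -(@of_real0 R k) (inj_eq (can_inj (@of_realK R k))).
by rewrite of_realM mulrAC mulrCA mulfV// mulr1.
Qed.

Lemma multipleN c u : multiple c u -> multiple c (- u).
Proof.
by move/(multipleZ (-1)); rewrite modulusN modulus1 mul1r scaleN1r.
Qed.

Lemma multiple_le c d u : 0 <= c -> c <= d -> multiple c u -> multiple d u.
Proof.
move=> c0 cd uc; rewrite -(subrKC c d) -[u]addr0.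
by apply: multipleD => //; [rewrite subr_ge0|exact: multiple0].
Qed.

Lemma multiple_opnorm (M : R) : (forall f, B f -> opnorm f <= M) ->
  forall c u, 0 <= c -> multiple c u -> opnorm u <= c * M.
Proof.
move=> BM c u c0 [v Bv ->].
have -> : opnorm (of_real k c *: v) = c * opnorm v.
  by rewrite -!opnorm_rnorm rnormZr.
by rewrite ler_wpM2l// BM.
Qed.

(** Small values on a finite set are corrected to zero by small multiples of
    [B], because [B] spans a finite-dimensional space of restrictions to that
    set, of which it contains a neighbourhood of the origin. *)
Lemma small_correction (M : R) G : (forall f, B f -> opnorm f <= M) ->
  forall eta, 0 < eta -> exists2 rho, 0 < rho & forall u, multiple 2 u ->
    (forall x, x \in G -> modulus (u x) <= rho) ->
    exists2 w, multiple eta w & forall x, x \in G -> w x = u x.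
Proof.
move=> BM.
have M0 : 0 <= M by case: B_neq0 => f /BM; apply: le_trans; exact: opnorm_ge0.
elim: G => [|x G IH] eta eta0.
  by exists 1 => // u _ _; exists 0 => //; exact: multiple0.
have [xG|] := pselect (forall c v, 0 <= c -> multiple c v ->
    (forall y, y \in G -> v y = 0) -> v x = 0).
  have [rho rho0 rhoP] := IH _ eta0; exists rho => // u u2 urho.
  have [|w weta wG] := rhoP u u2.
    by move=> y yG; apply: urho; rewrite in_cons yG orbT.
  exists w => // y; rewrite in_cons => /orP[/eqP ->|]; last exact: wG.
  apply/eqP; rewrite -subr_eq0; apply/eqP; apply: (xG (eta + 2) (w - u)).
  - by rewrite addr_ge0// ltW.
  - by apply: multipleD; [exact: ltW| |exact: weta|exact: multipleN].
  - by move=> z zG; rewrite dual_subE wG// subrr.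
move=> /existsNP[c0 /existsNP[v0 /not_implyP[c00 /not_implyP[v0c
  /not_implyP[v0G /eqP v0x]]]]].
pose v := (v0 x)^-1 *: v0; pose c := modulus (v0 x)^-1 * c0.
have c_ge0 : 0 <= c by rewrite mulr_ge0 ?modulus_ge0.
have vc : multiple c v by exact: multipleZ.
have vG y : y \in G -> v y = 0 by move=> yG; rewrite dual_scaleE (v0G y)// scaler0.
have vx : v x = 1 by rewrite dual_scaleE [_ *: _]mulVf.
pose L := M * rnorm x; have L0 : 0 <= L by exact: mulr_ge0 M0 (rnorm_ge0 x).
have Lc : 0 < 1 + L * c by rewrite ltr_pwDl// mulr_ge0.
have cc : 0 < 1 + c by rewrite ltr_pwDl.
pose eta' := eta / 2 / (1 + L * c).
have eta'0 : 0 < eta' by rewrite !divr_gt0.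
have eta'E : eta' + eta' * L * c = eta / 2.
  by rewrite -mulrA -{1}[eta']mulr1 -mulrDr /eta' mulfVK// gt_eqF.
have [rho rho0 rhoP] := IH _ eta'0.
(* The coefficient of [v] is at most [rho' + eta' * L], and [v] is in [c B]; the
   two constants make the total correction at most [eta]. *)
pose rho' := Num.min rho (eta / 2 / (1 + c)).
have rho'c : rho' * c <= eta / 2.
  have rho'le : rho' <= eta / 2 / (1 + c) by rewrite ge_min lexx orbT.
  rewrite (le_trans (ler_wpM2r c_ge0 rho'le))// mulrAC ler_pdivrMr//.
  by rewrite ler_wpM2l ?divr_ge0 ?(ltW eta0)// lerDr.
exists rho' => [|u u2 urho]; first by rewrite lt_min rho0 !divr_gt0.
have [|w weta wG] := rhoP u u2.
  move=> y yG; rewrite (@le_trans _ _ rho')//; last by rewrite ge_min lexx.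
  by apply: urho; rewrite in_cons yG orbT.
pose t := u x - w x.
have wx : modulus (w x) <= eta' * L.
  rewrite (le_trans (dual_bound _ _))// /L mulrA ler_wpM2r ?rnorm_ge0//.
  by apply: multiple_opnorm => //; exact: ltW.
have tle : modulus t <= rho' + eta' * L.
  by rewrite (le_trans (modulusB _ _))// lerD// urho// mem_head.
exists (w + t *: v).
  apply: (@multiple_le (eta' + modulus t * c)).
  - by rewrite addr_ge0 ?(ltW eta'0)// mulr_ge0 ?modulus_ge0.
  - by have := ler_wpM2r c_ge0 tle; rewrite mulrDl; lra.
  - apply: multipleD => //; [exact: ltW|by rewrite mulr_ge0 ?modulus_ge0|].
    exact: multipleZ.
move=> y; rewrite dual_addE dual_scaleE in_cons => /orP[/eqP ->|yG].
  by rewrite vx [_ *: 1]mulr1 subrKC.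
by rewrite vG// scaler0 addr0 wG.
Qed.

(** One step of the construction: [z] is a new point of [A] near [a], and [w]
    a correction which makes [z - a - w] vanish on [G].  A vector on which this
    functional is large is moved into the common kernel of [Phi] without
    changing the value of the functional, by subtracting a lifted vector; this
    costs a factor 2, and another one is lost by passing from the diameter of
    a set to the distance from the point [a]. *)
Lemma szlenk_step (A : set (dual X)) (M eps delta eta : R) Phi G a :
  (forall f, B f -> opnorm f <= M) -> A `<=` B -> 0 < eta -> 0 < delta ->
  2 * eta * M <= eps -> lifting Phi delta G -> szlenk_derivative eps A a ->
  exists z w x, [/\ A z, multiple eta w & rnorm x = 1] /\
    [/\ forall f, f \in Phi -> f x = 0,
        forall y, y \in G -> (z - a - w) y = 0 &
        exists2 r, (eps - 2 * eta * M) / (2 * (2 + delta)) < r &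
          (z - a - w) x = of_real k r].
Proof.
move=> BM AB eta0 delta0 eps_ge liftG [Aa a_szlenk].
have [rho rho0 rhoP] := small_correction G BM eta0.
have [U [Uo Ua UG]] := weak_star_nbhs a G rho0.
have := a_szlenk U Uo Ua; rewrite /diameter => /ereal_sup_gt.
move=> [_ [p [Up Ap] [q [Uq Aq] <-]]]; rewrite lte_fin opnorm_rnorm => pq.
have corr z : U z -> A z ->
    exists2 w, multiple eta w & forall x, x \in G -> (z - a - w) x = 0.
  move=> Uz Az; have [|x xG|w weta wG] := rhoP (z - a).
  - apply: multipleD => //; first exact/multiple1/AB.
    exact/multipleN/multiple1/AB.
  - by rewrite dual_subE; apply/ltW/UG.
  - by exists w => // x xG; rewrite dual_subE wG// subrr.
have [[wp wp_eta wpG] [wq wq_eta wqG]] := (corr p Up Ap, corr q Uq Aq).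
pose up := p - a - wp; pose uq := q - a - wq.
have pqE : p - q = (up - uq) + (wp - wq).
  rewrite /up /uq opprD !opprB; apply: dual_ext => x.
  rewrite !(dual_addE, dual_oppE); set t1 := p x; set t2 := q x.
  by rewrite opprK; ring.
have opN (u : dual X) : opnorm (- u) = opnorm u by rewrite -!opnorm_rnorm rnormN.
have w_norm w : multiple eta w -> opnorm w <= eta * M.
  by apply: multiple_opnorm => //; exact: ltW.
have upq : eps - 2 * eta * M < opnorm (up - uq).
  have : opnorm (p - q) <= opnorm (up - uq) + opnorm (wp - wq).
    by rewrite pqE; exact: opnormD.
  have : opnorm (wp - wq) <= opnorm wp + opnorm wq.
    by rewrite -(opN wq); exact: opnormD.
  have := w_norm _ wp_eta; have := w_norm _ wq_eta; lra.
have [x0 x01 x0pq] : exists2 x, rnorm x <= 1 &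
    eps - 2 * eta * M < modulus ((up - uq) x).
  apply/not_exists2P => xc; have : opnorm (up - uq) <= eps - 2 * eta * M.
    apply: opnorm_le => x x1; have [//|/negP] := xc x.
    by rewrite -leNgt.
  by rewrite leNgt upq.
have [x' [x'1 x'Phi x'G]] := liftG x0 x01.
pose y := x0 - x'.
have d2 : 0 < 2 + delta by rewrite addr_gt0.
have y2 : rnorm y <= 2 + delta by rewrite (le_trans (rnormB _ _))//; lra.
have yPhi f : f \in Phi -> f y = 0 by move=> fPhi; rewrite dualB x'Phi// subrr.
have : eps - 2 * eta * M < modulus (up y) + modulus (uq y).
  have -> : up y = up x0 by rewrite dualB (x'G up)// subr0.
  have -> : uq y = uq x0 by rewrite dualB (x'G uq)// subr0.
  by rewrite dual_subE in x0pq; apply: lt_le_trans (modulusB _ _).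
have fin z w : A z -> multiple eta w -> (forall x, x \in G -> (z - a - w) x = 0) ->
    (eps - 2 * eta * M) / 2 < modulus ((z - a - w) y) ->
    exists z w x, [/\ A z, multiple eta w & rnorm x = 1] /\
      [/\ forall f, f \in Phi -> f x = 0,
          forall y, y \in G -> (z - a - w) y = 0 &
          exists2 r, (eps - 2 * eta * M) / (2 * (2 + delta)) < r &
            (z - a - w) x = of_real k r].
  move=> Az weta wG large.
  have y0 : 0 < rnorm y.
    rewrite lt_neqAle rnorm_ge0 andbT eq_sym; apply/eqP => y0; move: large.
    by rewrite (rnorm_eq0 y0) dual0 modulus0; lra.
  have [b b1 by_real] := phase ((z - a - w) y).
  exists z, w, (of_real k (rnorm y)^-1 *: (b *: y)); split.
    split=> //; rewrite rnormZr ?invr_ge0 ?rnorm_ge0// rnormZm b1 mul1r.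
    by rewrite mulVf// gt_eqF.
  split=> //; first by move=> f fPhi; rewrite !dualZ yPhi// !scaler0.
  exists ((rnorm y)^-1 * modulus ((z - a - w) y)); last first.
    by rewrite !dualZ of_realM; congr (_ * _).
  rewrite [ltRHS]mulrC ltr_pdivlMr// invfM mulrA.
  apply: le_lt_trans large; rewrite mulrAC ler_pdivrMr// ler_wpM2l//.
  by rewrite divr_ge0// subr_ge0.
move=> large.
have [up_large|up_small] := ltP ((eps - 2 * eta * M) / 2) (modulus (up y)).
  exact: (fin p wp).
by apply: (fin q wq) => //; rewrite -/uq; lra.
Qed.

End Multiples.

(** * Bases from biorthogonal systems *)

Section FiniteCombinations.
Variables (R : realType) (k : scalar_kind).
Local Notation K := (scalar_field R k).
Variables (V : normedModType K) (e : nat -> V).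
Implicit Types (x y : V) (a b : nat -> K) (n m : nat).

Definition combination n a : V := \sum_(i < n) a i *: e i.

Lemma combination_widen n m a : (n <= m)%N ->
  combination n a = combination m (fun i => if (i < n)%N then a i else 0).
Proof.
move=> nm; rewrite /combination (big_ord_widen m (fun i => a i *: e i))//.
by rewrite big_mkcond; apply: eq_bigr => i _; case: ifP; rewrite ?scale0r.
Qed.

Definition combinations : set V := [set x | exists n a, x = combination n a].

Lemma combinations0 : combinations 0.
Proof. by exists 0%N, (fun=> 0); rewrite /combination big_ord0. Qed.

Lemma combinations_lin (c : K) x y :
  combinations x -> combinations y -> combinations (c *: x + y).
Proof.
move=> [n [a ->]] [m [b ->]].
rewrite (combination_widen a (leq_maxl n m)) (combination_widen b (leq_maxr n m)).
set a' := fun i => _; set b' := fun i => _.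
exists (maxn n m), (fun i => c * a' i + b' i).
rewrite /combination scaler_sumr -big_split /=; apply: eq_bigr => i _.
by rewrite scalerDl scalerA.
Qed.

Lemma closure_combinations_lin (c : K) x y : closure combinations x ->
  closure combinations y -> closure combinations (c *: x + y).
Proof.
move=> /closure_rnormP xL /closure_rnormP yL; apply/closure_rnormP => eps eps0.
have c1 : 0 < modulus c + 1 by rewrite ltr_wpDl ?modulus_ge0.
have [x' x'L xx'] := xL (eps / 2 / (modulus c + 1)) ltac:(by rewrite !divr_gt0).
have [y' y'L yy'] := yL (eps / 2) ltac:(by rewrite divr_gt0).
exists (c *: x' + y'); first exact: combinations_lin.
have -> : c *: x + y - (c *: x' + y') = c *: (x - x') + (y - y').
  by rewrite opprD addrACA scalerBr.
rewrite (le_lt_trans (rnormD _ _))// [ltRHS]splitr ler_ltD// rnormZm.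
move: xx'; rewrite ltr_pdivlMr// => /ltW; apply: le_trans.
by rewrite mulrC ler_wpM2l ?rnorm_ge0// lerDl.
Qed.

Lemma cspan_approx x : csub (cspan (range e)) x -> forall eps : R, 0 < eps ->
  exists n a, rnorm (x - combination n a) < eps.
Proof.
move=> xe.
have : closure combinations x.
  apply: (xe (ClosedSubspace (subset_closure combinations0)
    closure_combinations_lin (@closed_closure _ combinations))).
  move=> _ [n _ <-]; apply: subset_closure.
  exists n.+1, (fun i => (i == n)%:R).
  rewrite /combination big_ord_recr /= eqxx scale1r big1 ?add0r// => i _.
  by rewrite (ltn_eqF (ltn_ord i)) scale0r.
by move=> /closure_rnormP xL eps /xL[_ [n [a ->]]]; exists n, a.
Qed.

Lemma dual_eq0_cspan (A : set V) (f : dual V) : (forall x, A x -> f x = 0) ->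
  forall x, csub (cspan A) x -> f x = 0.
Proof.
move=> fA x /(_ (kernel_subspace (fun _ : unit => f))) xf.
by have := xf (fun y Ay _ _ => fA y Ay) tt I.
Qed.

End FiniteCombinations.

Section BiorthogonalBasis.
Variables (R : realType) (k : scalar_kind).
Local Notation K := (scalar_field R k).
Variables (V : normedModType K) (e : nat -> V) (g : nat -> dual V) (C : R).
Hypotheses (C_ge0 : 0 <= C) (g_e : forall i j, g i (e j) = (i == j)%:R).
Hypothesis e_dense : forall x (eps : R), 0 < eps ->
  exists n a, rnorm (x - combination e n a) < eps.
Hypothesis partial_sums : forall n m a,
  rnorm (combination e n (g^~ (combination e m a))) <= C * rnorm (combination e m a).

Lemma g_combination j n a : g j (combination e n a) = if (j < n)%N then a j else 0.
Proof.
rewrite /combination dual_sum; case: ifP => jn.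
  rewrite (bigD1 (Ordinal jn)) //= dualZ g_e eqxx [_ *: 1]mulr1 big1 ?addr0//.
  move=> i; rewrite -val_eqE /= => ij; rewrite dualZ g_e eq_sym (negbTE ij).
  by rewrite scaler0.
rewrite big1// => i _; rewrite dualZ g_e gtn_eqF ?scaler0//.
by rewrite (leq_trans (ltn_ord i))// leqNgt jn.
Qed.

Lemma partial_sums_bounded n x :
  rnorm (combination e n (g^~ x)) <= C * rnorm x.
Proof.
pose M := \sum_(i < n) opnorm (g i) * rnorm (e i).
have M0 : 0 <= M by apply: sumr_ge0 => i _; rewrite mulr_ge0 ?opnorm_ge0 ?rnorm_ge0.
have SM z : rnorm (combination e n (g^~ z)) <= M * rnorm z.
  rewrite (le_trans (rnorm_sum _ _ _))// /M mulr_suml ler_sum// => i _.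
  by rewrite rnormZm mulrAC ler_wpM2r ?rnorm_ge0// dual_bound.
apply/ler_addgt0Pr => eps eps0.
have MC : 0 < M + C + 1 by rewrite ltr_wpDl// addr_ge0.
have [m [a xa]] := e_dense x (divr_gt0 eps0 MC).
set y := combination e m a in xa.
have -> : combination e n (g^~ x) =
    combination e n (g^~ (x - y)) + combination e n (g^~ y).
  rewrite /combination -big_split; apply: eq_bigr => i _ /=.
  by rewrite dualB -scalerDl subrK.
have yx : rnorm y <= rnorm x + rnorm (x - y) by rewrite (rdistC x) rnorm_triangle.
rewrite (le_trans (rnormD _ _))// (le_trans (lerD (SM _) (partial_sums n m a)))//.
have : C * rnorm y <= C * (rnorm x + rnorm (x - y)) by rewrite ler_wpM2l.
move: xa; rewrite ltr_pdivlMr// => /ltW; have := rnorm_ge0 (x - y).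
rewrite -/y; lra.
Qed.

Lemma biorthogonal_expansion x : expansion e (g^~ x) x.
Proof.
apply/cvg_rnormP => eps eps0.
have C1 : 0 < C + 1 by rewrite ltr_wpDl.
have [m [a xa]] := e_dense x (divr_gt0 eps0 C1).
exists m => n mn; rewrite -/(combination e n (g^~ x)).
set y := combination e m a in xa.
have -> : x - combination e n (g^~ x) =
    (x - y) - combination e n (g^~ (x - y)).
  have yE : combination e n (g^~ y) = y.
    rewrite /y (combination_widen e a mn); apply: eq_bigr => i _.
    by rewrite g_combination ltn_ord.
  rewrite -{1}yE -addrA -opprD; congr (_ - _).
  rewrite /combination -big_split; apply: eq_bigr => i _ /=.
  by rewrite dualB -scalerDl subrKC.
rewrite (le_lt_trans (rnormB _ _))//.
move: xa; rewrite ltr_pdivlMr// mulrDr mulr1 addrC; apply: le_lt_trans.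
by rewrite lerD2l mulrC partial_sums_bounded.
Qed.

Lemma expansion_unique a x : expansion e a x -> a = g^~ x.
Proof.
move=> /cvg_rnormP ax; apply/funext => j; apply/eqP; rewrite eq_sym -subr_eq0.
apply/eqP/modulus_eq0/eqP; rewrite eq_le modulus_ge0 andbT.
apply/ler_addgt0Pr => eps eps0; rewrite add0r.
have G1 : 0 < opnorm (g j) + 1 by rewrite ltr_wpDl ?opnorm_ge0.
have [n /(_ (maxn n j.+1) (leq_maxl _ _))] := ax _ (divr_gt0 eps0 G1).
rewrite -/(combination e _ a) => xa.
have -> : g j x - a j = g j (x - combination e (maxn n j.+1) a).
  by rewrite dualB g_combination leq_maxr.
rewrite (le_trans (dual_bound _ _))//.
move: xa; rewrite ltr_pdivlMr// => /ltW; apply: le_trans.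
by rewrite mulrC ler_wpM2l ?rnorm_ge0// lerDl.
Qed.

Lemma biorthogonal_coefficients x : coefficients e x = g^~ x.
Proof.
rewrite /coefficients; case: xgetP => [a _ /expansion_unique//|].
by move=> /(_ (g^~ x)) []; exact: biorthogonal_expansion.
Qed.

(** The expansion converges on the dense set of finite combinations, where it is
    eventually constant; the uniform bound on the partial sums extends this to the
    whole space. *)
Theorem biorthogonal_basis : schauder_basis e /\ (basis_constant e <= C%:E)%E.
Proof.
split=> [x|].
  exists (g^~ x); split; first exact: biorthogonal_expansion.
  by move=> a /expansion_unique ->.
apply: ge_ereal_sup => _ [n _ [x /= x1 <-]]; rewrite lee_fin.
rewrite /basis_projection biorthogonal_coefficients.
rewrite (le_trans (partial_sums_bounded n x))// ler_piMr//.
Qed.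

Lemma shrinking_from_tails :
  (forall (f : dual V) (eps : R), 0 < eps -> exists n, forall x, rnorm x <= 1 ->
    csub (cspan [set e i | i in [set i | (n <= i)%N]]) x ->
    modulus (f x) <= eps) -> shrinking e.
Proof.
move=> tail f.
have tail_sub n m : (n <= m)%N ->
    csub (cspan [set e i | i in [set i | (m <= i)%N]]) `<=`
    csub (cspan [set e i | i in [set i | (n <= i)%N]]).
  move=> nm x xm Y nY; apply: xm => _ [i /= mi <-]; apply: nY.
  by exists i => //=; exact: leq_trans mi.
have tail_norm_ge0 n : (0 <= tail_norm e f n)%E.
  apply: ereal_sup_ubound; exists 0; last by rewrite dual0 rnorm0.
  by split; [exact: closed_span0|rewrite /= rnorm0].
have tail_small (eps : R) : 0 < eps ->
    exists n, forall m, (n <= m)%N -> (tail_norm e f m <= eps%:E)%E.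
  move=> /(tail f)[n nf]; exists n => m nm; apply: ge_ereal_sup.
  by move=> _ [x [xm /= x1] <-]; rewrite lee_fin nf//; exact: tail_sub xm.
have fin_tail (eps : R) m : (tail_norm e f m <= eps%:E)%E ->
    tail_norm e f m \is a fin_num /\ fine (tail_norm e f m) <= eps.
  move: (tail_norm_ge0 m); case: (tail_norm e f m) => [r _|//|//].
  by rewrite lee_fin => r_le; split.
apply/fine_cvgP; split.
  have [n nf] := tail_small 1 ltr01.
  by exists n => // m /= /nf/fin_tail[].
apply/cvgrPdist_le => eps /tail_small[n nf]; exists n => // m /= /nf/fin_tail[_ le_eps].
rewrite sub0r normrN ger0_norm//; exact: fine_ge0.
Qed.

End BiorthogonalBasis.

(** * Derivations and ranks of trees *)

Section Derivations.
Variables (E : Type) (D : set E -> set E) (A : set E).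
Hypothesis D_sub : forall S, D S `<=` S.

(** Below a limit index [y] there is an index strictly between [x] and [y], to
    which the induction hypothesis applies. *)
Lemma transfinite_at_lt (a : ordinal_number) (x y : a) : olt x y ->
  transfinite_at D A y `<=` D (transfinite_at D A x).
Proof.
move: y; apply: (well_founded_ind (@olt_wf a)) => y IH xy.
have [[z yz]|ysucc] := pselect (exists z, is_succ_of y z).
  rewrite (transfinite_at_succ D A yz); case: (yz) => zy zP.
  have [->//|xz] := zP _ xy.
  by apply: subset_trans (@D_sub _) _; exact: IH.
have ylim : is_limit y by split=> [/(_ x)|z yz]; [exact|apply: ysucc; exists z].
have [z [xz zy]] : exists z, olt x z /\ olt z y.
  apply: contrapT => nz; apply: ysucc; exists x; split=> // z zy.
  have [zx|->|xz] := olt_total z x; [by right|by left|].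
  by exfalso; apply: nz; exists z.
rewrite (transfinite_at_limit D A ylim) => p /(_ z zy).
by apply: IH.
Qed.

Lemma transfinite_at_sub (a : ordinal_number) (x : a) : transfinite_at D A x `<=` A.
Proof.
move: x; apply: (well_founded_ind (@olt_wf a)) => x IH.
have [x0|/existsNP[y /contrapT yx]] := pselect (is_zero x).
  by rewrite transfinite_at_zero.
apply: subset_trans (transfinite_at_lt yx) _.
by apply: subset_trans (@D_sub _) _; exact: IH.
Qed.

End Derivations.

Lemma olt_minimal (a : ordinal_number) (P : a -> Prop) x : P x ->
  exists2 m, P m & forall y, olt y m -> ~ P y.
Proof.
move: x; apply: (well_founded_ind (@olt_wf a)) => x IH Px.
have [[y [yx Py]]|nP] := pselect (exists y, olt y x /\ P y); first exact: IH Py.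
by exists x => // y yx Py; apply: nP; exists y.
Qed.

Section TreeLevels.
Variables (d : Order.disp_t) (T : porderType d).

Lemma tree_derivation_level (rho : ordinal_number) (t : T) :
  tree_derived rho = set0 :> set T ->
  exists y : rho, maximals (transfinite_at (fun A => A `\` maximals A) setT y) t.
Proof.
move=> rho0; set D := fun A : set T => A `\` maximals A.
have : ~ transfinite_at D setT (None : osucc rho) t.
  by rewrite -/(transfinite D setT rho) -/(tree_derived rho) rho0.
move=> /(@olt_minimal _ (fun x => ~ transfinite_at D setT x t))[x xt xmin].
have [x0|xn0] := pselect (is_zero x).
  by exfalso; apply: xt; rewrite transfinite_at_zero.
have [[z xz]|xsucc] := pselect (exists z, is_succ_of x z); last first.
  exfalso; apply: xt; rewrite transfinite_at_limit.
    by move=> y /= /xmin/contrapT.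
  by split=> // z xz; apply: xsucc; exists z.
have zt : transfinite_at D setT z t by apply: contrapT; apply: xmin; case: xz.
move: xt; rewrite (transfinite_at_succ D setT xz) => ztD.
have zmax : maximals (transfinite_at D setT z) t.
  by apply: contrapT => nmax; apply: ztD.
case: z xz zmax {zt ztD} => [y _|[]]; first by rewrite transfinite_at_Some; exists y.
by case: x {xmin xn0}.
Qed.

(** A node is sent to the index at which it is maximal in the derived tree.  A
    larger node cannot belong to the derived tree of that index, so its own index
    is smaller. *)
Lemma tree_levels (rho xi : ordinal_number) :
  tree_derived rho = set0 :> set T -> ole rho xi ->
  exists o : T -> xi, forall s t, (s < t)%O -> olt (o t) (o s).
Proof.
move=> rho0 [f fP].
have /choice[o oP] := fun t => @tree_derivation_level rho t rho0.
exists (f \o o) => s t st; apply: fP.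
have sub : transfinite_at (fun A : set T => A `\` maximals A) setT (o t) `<=`
    transfinite_at (fun A : set T => A `\` maximals A) setT (o s) -> False.
  move=> ts; have [_ smax] := oP s.
  have := smax t (ts _ (oP t).1) (ltW st).
  by move=> ts_eq; rewrite ts_eq ltxx in st.
have [//|ots|sot] := olt_total (o t) (o s).
  by exfalso; apply: sub; rewrite ots.
exfalso; apply: sub => p pt.
by have [] : (fun A : set T => A `\` maximals A)
  (transfinite_at (fun A : set T => A `\` maximals A) setT (o s)) p
  by apply: transfinite_at_lt sot p pt => S q [].
Qed.

End TreeLevels.

Section AmalgamOrder.
Variables (d : Order.disp_t) (T : nat -> porderType d).
Implicit Types s t u : amalgam_star T.

Definition below s t := amalgam_le (Some s) (Some t).

Lemma belowP n (s t : tree_star (T n)) :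
  below (existT _ n s) (existT _ n t) <-> (set_val s <= set_val t)%O.
Proof.
split=> [|st]; last exact: AmalgamNode.
rewrite /below; move sE : (Some _) => s'; move tE : (Some _) => t' le_st.
case: le_st sE tE => // m u v uv [] nm; subst m => su [] tv.
by rewrite (eq_from_Tagged su) (eq_from_Tagged tv).
Qed.

Lemma below_tag s t : below s t -> tag s = tag t.
Proof.
rewrite /below; move sE : (Some s) => s'; move tE : (Some t) => t' le_st.
by case: le_st sE tE => // n u v _ [->] [->].
Qed.

Lemma below_refl s : below s s.
Proof. by case: s => n s; apply/belowP. Qed.

Lemma below_trans t s u : below s t -> below t u -> below s u.
Proof.
move=> st tu; have := below_tag st; have := below_tag tu.
case: s t u st tu => [n s] [m t] [p u] /= + + mp nm; subst m p.
by move=> /belowP st /belowP tu; apply/belowP; exact: le_trans tu.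
Qed.

Lemma below_anti s t : below s t -> below t s -> s = t.
Proof.
move=> st ts; have := below_tag st.
case: s t st ts => [n s] [m t] /= + + nm; subst m.
move=> /belowP st /belowP ts; congr existT; apply: val_inj.
by apply/eqP; rewrite eq_le; apply/andP.
Qed.

Lemma below_chain (T_tree : forall n, is_tree (T n)) s t u :
  below s u -> below t u -> below s t \/ below t s.
Proof.
move=> su tu; have := below_tag su; have := below_tag tu.
case: s t u su tu => [n s] [m t] [p u] /= + + mp np; subst m p.
move=> /belowP su /belowP tu.
have [||b [->|->] bmin] := @T_tree n (set_val u) [set set_val s; set_val t].
- by move=> _ [->|->].
- by exists (set_val s); left.
- by left; apply/belowP/bmin; right.
- by right; apply/belowP/bmin; left.
Qed.

End AmalgamOrder.

(** * The inductive construction *)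

(** A node refers to its parent, which may come at any earlier stage; hence a
    choice which depends on the whole past. *)
Lemma choice_with_history (E : Type) (e0 : E)
    (P : nat -> (nat -> E) -> E -> Prop) :
  (forall m h h' e, (forall l, (l < m)%N -> h l = h' l) -> P m h e -> P m h' e) ->
  (forall m h, (forall l, (l < m)%N -> P l h (h l)) -> exists e, P m h e) ->
  exists f : nat -> E, forall m, P m f (f m).
Proof.
move=> Pext Pstep.
have ex_next h : exists e, (forall l, (l < size h)%N -> P l (nth e0 h) (nth e0 h l)) ->
    P (size h) (nth e0 h) e.
  have [hP|hP] := pselect (forall l, (l < size h)%N -> P l (nth e0 h) (nth e0 h l)).
    by have [e eP] := Pstep _ _ hP; exists e.
  by exists e0 => /hP.
have [next nextP] := choice ex_next.
pose hist := fix hist n := if n is n'.+1 then rcons (hist n') (next (hist n')) else [::].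
pose f n := next (hist n).
have hist_size n : size (hist n) = n by elim: n => //= n IH; rewrite size_rcons IH.
have hist_nth n l : (l < n)%N -> nth e0 (hist n) l = f l.
  elim: n => // n IH; rewrite ltnS /= nth_rcons hist_size => ln.
  case: ltnP => [/IH//|nl]; have -> : l = n by apply/eqP; rewrite eqn_leq ln.
  by rewrite eqxx.
exists f; elim/ltn_ind => m IH.
apply: (Pext m (nth e0 (hist m)) f); first by move=> l lm; exact: hist_nth.
have := nextP (hist m); rewrite hist_size; apply=> l lm; rewrite hist_nth//.
by apply: (Pext l f); [move=> j jl; rewrite hist_nth// (ltn_trans jl)|exact: IH].
Qed.

(** The nodes of a countable forest are indexed by natural numbers, in an order
    which extends that of the forest; [act] tells the indices of nodes.  The point
    chosen at the node [m] will be in [A m], and the points of the smaller nodes,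
    like the base point of the tree, are in the Szlenk derivative of [A m]. *)
Record forest_levels (R : realType) (k : scalar_kind)
    (X : normedModType (scalar_field R k)) (B : set (dual X))
    (act : nat -> Prop) (le : nat -> nat -> Prop) (eps : nat -> R)
    (base : nat -> dual X) (A : nat -> set (dual X)) : Prop := ForestLevels {
  level_refl : forall m, act m -> le m m ;
  level_trans : forall l m n, le l m -> le m n -> le l n ;
  level_leq : forall l m, le l m -> (l <= m)%N ;
  level_act : forall l m, le l m -> act l ;
  level_chain : forall l m n, le l n -> le m n -> (l <= m)%N -> le l m ;
  level_eps_gt0 : forall m, 0 < eps m ;
  level_base_le : forall l m, le l m -> base l = base m ;
  level_base_sub : forall m, act m -> B (base m) ;
  level_sub : forall m, act m -> A m `<=` B ;
  level_base : forall m, act m -> szlenk_derivative (eps m) (A m) (base m) ;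
  level_le : forall l m, le l m -> (l < m)%N ->
    A l `<=` szlenk_derivative (eps m) (A m) }.

Section Construction.
Variables (R : realType) (k : scalar_kind).
Local Notation K := (scalar_field R k).
Variables (X : normedModType K) (B : set (dual X)) (M : R).
Hypotheses (B_neq0 : B !=set0) (B_convex : absolutely_convex B).
Hypothesis BM : forall f, B f -> opnorm f <= M.
Variables (theta : R) (theta_gt0 : 0 < theta) (F : nat -> dual X) (d : nat -> X).
Variables (act : nat -> Prop) (le : nat -> nat -> Prop) (eps : nat -> R).
Variables (base : nat -> dual X) (A : nat -> set (dual X)).
Hypothesis levels : forest_levels B act le eps base A.

Definition is_parent m (o : option nat) :=
  if o is Some p then
    [/\ (p < m)%N, le p m & forall l, (l < m)%N -> le l m -> le l p]
  else forall l, (l < m)%N -> ~ le l m.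

Lemma parent_exists m : exists o, is_parent m o.
Proof.
have [[l0 [l0m lel0]]|none] := pselect (exists l, (l < m)%N /\ le l m); last first.
  by exists None => l lm lem; apply: none; exists l.
have [||p /andP[pm /asboolP lep] pmax] :=
    @ex_maxnP (fun l => (l < m)%N && `[< le l m >]) m.
- by exists l0; rewrite l0m; apply/asboolP.
- by move=> l /andP[/ltnW].
exists (Some p); split=> // l lm lel; apply: (level_chain levels lel lep).
by apply: pmax; rewrite lm; apply/asboolP.
Qed.

Record stage := Stage {
  stage_x : X ; stage_y : dual X ; stage_z : dual X ;
  stage_Phi : seq (dual X) ; stage_G : seq X }.

Variables (par : nat -> option nat) (t : R) (eta : nat -> R).
Hypotheses (parP : forall m, is_parent m (par m)) (t_gt0 : 0 < t)
  (t_le : t * (19 + theta) <= theta) (eta_gt0 : forall m, 0 < eta m)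
  (eta_le : forall m, 2 * eta m * M <= t * eps m).

(** The point near which the next one is sought: that of the parent node, or the
    base point of the tree when the parent is the root. *)
Definition origin m (z : nat -> dual X) : dual X :=
  if par m is Some p then z p else base m.

(** [stage_z] is a point of the derived set attached to the index, and
    [stage_y] the scaled and corrected increment of these points along the
    tree.  New vectors are killed by the past functionals in [stage_Phi], new
    functionals kill the past vectors in [stage_G]. *)
Record good_stage m (h : nat -> stage) (s : stage) : Prop := GoodStage {
  good_F : F m \in stage_Phi s ;
  good_y : forall l, (l < m)%N -> stage_y (h l) \in stage_Phi s ;
  good_Phi : forall l, (l < m)%N -> {subset stage_Phi (h l) <= stage_Phi s} ;
  good_mazur : forall a v, (forall f, f \in stage_Phi s -> f v = 0) ->
    rnorm (combination (stage_x \o h) m a) <=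
    (1 + t) * rnorm (combination (stage_x \o h) m a + v) ;
  good_d : d m \in stage_G s ;
  good_x : forall l, (l < m)%N -> stage_x (h l) \in stage_G s ;
  good_G : forall l, (l < m)%N -> {subset stage_G (h l) <= stage_G s} ;
  good_lift : lifting (stage_Phi s) t (stage_G s) ;
  good_act : act m ->
    [/\ A m (stage_z s), rnorm (stage_x s) = 1,
        forall f, f \in stage_Phi s -> f (stage_x s) = 0 &
        exists2 w, multiple B (eta m) w & stage_y s =
          of_real k (2 + t)^-1 *: (stage_z s - origin m (stage_z \o h) - w)] /\
    (exists2 r, eps m / (8 + theta) < r & stage_y s (stage_x s) = of_real k r) ;
  good_kill : forall x, x \in stage_G s -> stage_y s x = 0 ;
  good_inact : ~ act m -> stage_x s = 0 /\ stage_y s = 0 }.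

Lemma good_stage_ext m h h' s : (forall l, (l < m)%N -> h l = h' l) ->
  good_stage m h s -> good_stage m h' s.
Proof.
move=> hh' [gF gy gPhi gm gd gx gG gl ga gk gi].
have combE a : combination (stage_x \o h') m a = combination (stage_x \o h) m a.
  by apply: eq_bigr => i _ /=; rewrite hh'.
split=> //.
- by move=> l lm; rewrite -hh'//; exact: gy.
- by move=> l lm; rewrite -hh'//; exact: gPhi.
- by move=> a v vPhi; rewrite combE; exact: gm.
- by move=> l lm; rewrite -hh'//; exact: gx.
- by move=> l lm; rewrite -hh'//; exact: gG.
- move=> /ga[[? ? ? [w weta yE]] ?]; split=> //; split=> //; exists w => //.
  rewrite yE; congr (_ *: (_ - _ - _)); rewrite /origin.
  by have := parP m; case: par => //= p [pm _ _]; rewrite hh'.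
Qed.

(** Here [e'] is the part of [e] lost to the correction.  Of the factors of 8, one
    scales the difference of two points of [B] back into [B], one comes from the
    passage from a diameter to a distance, and one from the subtraction of a
    lifted vector. *)
Lemma stage_constant e r e' : 0 < e -> e' <= t * e ->
  (e - e') / (2 * (2 + t)) < r -> e / (8 + theta) < (2 + t)^-1 * r.
Proof.
move=> e0 e'_le; have t2 : 0 < 2 + t by rewrite addr_gt0.
have th8 : 0 < 8 + theta by rewrite addr_gt0.
rewrite ltr_pdivrMr ?mulr_gt0// => lt_r.
rewrite [ltRHS]mulrC ltr_pdivlMr// mulrAC ltr_pdivrMr//.
have t1 : t <= 1.
  rewrite leNgt; apply/negP => t1.
  have : 19 + theta < t * (19 + theta) by rewrite ltr_pMl// addr_gt0.
  by have := t_le; lra.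
have key : 2 * (2 + t) * (2 + t) <= (1 - t) * (8 + theta).
  have : t * t <= t by rewrite ler_piMr// ltW.
  by have := t_le; have := t_gt0; lra.
have := ler_wpM2l (ltW e0) key.
have : (e - e') * (8 + theta) < r * (2 * (2 + t)) * (8 + theta).
  by rewrite ltr_pM2r.
have : (1 - t) * e * (8 + theta) <= (e - e') * (8 + theta).
  by rewrite ler_pM2r//; lra.
move=> h1 h2 h3.
have : e * (2 + t) * (2 * (2 + t)) < r * (8 + theta) * (2 * (2 + t)) by lra.
by rewrite ltr_pM2r// mulr_gt0.
Qed.

Lemma good_stage_biorthogonal m h : (forall l, (l < m)%N -> good_stage l h (h l)) ->
  forall j l, (j < m)%N -> (l < m)%N -> j != l ->
  stage_y (h l) (stage_x (h j)) = 0.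
Proof.
move=> hP j l jm lm; rewrite neq_ltn => /orP[jl|lj].
  exact: good_kill (hP l lm) _ (good_x (hP l lm) jl).
have [aj|naj] := pselect (act j); last first.
  by have [-> _] := good_inact (hP j jm) naj; rewrite dual0.
have [[_ _ xj _] _] := good_act (hP j jm) aj.
exact: xj _ (good_y (hP j jm) lj).
Qed.

Lemma good_stage_diag m h s : good_stage m h s -> act m ->
  stage_y s (stage_x s) != 0.
Proof.
move=> sP am; have [_ [r rlt ->]] := good_act sP am.
rewrite -(@of_real0 R k) (inj_eq (can_inj (@of_realK R k))) gt_eqF//.
by rewrite (le_lt_trans _ rlt)// divr_ge0 ?ltW ?(level_eps_gt0 levels)// addr_gt0.
Qed.

(** The increments control the coefficients of a combination of the past vectors,
    hence its norm. *)
Lemma good_stage_mazur m h : (forall l, (l < m)%N -> good_stage l h (h l)) ->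
  exists N : seq (dual X), forall a v, (forall f, f \in N -> f v = 0) ->
    rnorm (combination (stage_x \o h) m a) <=
    (1 + t) * rnorm (combination (stage_x \o h) m a + v).
Proof.
move=> hP; pose x := stage_x \o h; pose y := stage_y \o h.
pose E := [set e | exists a, e = combination x m a].
pose C := \sum_(l < m) modulus (y l (x l))^-1 * rnorm (x l).
have C0 : 0 <= C.
  by apply: sumr_ge0 => l _; rewrite mulr_ge0 ?modulus_ge0 ?rnorm_ge0.
have yx a l : (l < m)%N -> y l (combination x m a) = a l * y l (x l).
  move=> lm; rewrite /combination dual_sum (bigD1 (Ordinal lm))//= big1 ?addr0 ?dualZ//.
  move=> i; rewrite -val_eqE /= => il; rewrite dualZ.
  by rewrite [y l _](good_stage_biorthogonal hP)// scaler0.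
have [||e r [a ->] r0 er|N NP] := @nearly_orthogonal_kernel _ _ _ E
    [seq y l | l <- iota 0 m] C t t_gt0 C0.
- by exists (fun=> 0); rewrite /combination big1// => i _; rewrite scale0r.
- move=> c _ _ [a ->] [b ->]; exists (fun i => c * a i + b i).
  rewrite /combination scaler_sumr -big_split; apply: eq_bigr => i _ /=.
  by rewrite scalerDl scalerA.
- rewrite (le_trans (rnorm_sum _ _ _))// /C mulr_suml ler_sum// => l _.
  have [al|nal] := pselect (act l); last first.
    have [xl _] := good_inact (hP l (ltn_ord l)) nal.
    by rewrite /x /= xl scaler0 rnorm0 mulr0 mul0r.
  have yl0 := good_stage_diag (hP l (ltn_ord l)) al.
  have -> : a l = (y l (x l))^-1 * y l (combination x m a).
    by rewrite yx// mulrCA mulVf// mulr1.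
  rewrite rnormZm modulusM mulrAC ler_wpM2l ?mulr_ge0 ?modulus_ge0 ?rnorm_ge0//.
  by apply: er; apply/mapP; exists (l : nat); rewrite // mem_iota /= add0n.
by exists N => a v vN; apply: NP => //; exists a.
Qed.

Lemma good_stage_step m h : (forall l, (l < m)%N -> good_stage l h (h l)) ->
  exists s, good_stage m h s.
Proof.
move=> hP; have [N NP] := good_stage_mazur hP.
pose past (T : Type) (g : stage -> T) := [seq g (h l) | l <- iota 0 m].
have pastP (T : eqType) (g : stage -> T) l : (l < m)%N -> g (h l) \in past T g.
  by move=> lm; apply/mapP; exists l; rewrite // mem_iota.
have flatP (T : eqType) (g : stage -> seq T) l u : (l < m)%N -> u \in g (h l) ->
    u \in flatten (past (seq T) g).
  by move=> lm ul; apply/flattenP; exists (g (h l)) => //; exact: pastP.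
pose Phi := F m :: past _ stage_y ++ flatten (past _ stage_Phi) ++ N.
have [G0 G0P] := lifting_exists Phi t_gt0.
pose G := d m :: past _ stage_x ++ flatten (past _ stage_G) ++ G0.
have liftG : lifting Phi t G.
  by apply: lifting_sub G0P => g gG; rewrite in_cons !mem_cat gG !orbT.
have mk s : stage_Phi s = Phi -> stage_G s = G ->
    (act m ->
    [/\ A m (stage_z s), rnorm (stage_x s) = 1,
        forall f, f \in stage_Phi s -> f (stage_x s) = 0 &
        exists2 w, multiple B (eta m) w & stage_y s =
          of_real k (2 + t)^-1 *: (stage_z s - origin m (stage_z \o h) - w)] /\
    (exists2 r, eps m / (8 + theta) < r & stage_y s (stage_x s) = of_real k r)) ->
    (forall x, x \in stage_G s -> stage_y s x = 0) ->
    (~ act m -> stage_x s = 0 /\ stage_y s = 0) -> good_stage m h s.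
  move=> PhiE GE sact skill sinact; split; rewrite ?PhiE ?GE //.
  - by rewrite mem_head.
  - by move=> l lm; rewrite in_cons !mem_cat pastP// orbT.
  - by move=> l lm f fl; rewrite in_cons !mem_cat (flatP _ stage_Phi l)// !orbT.
  - move=> a v vPhi; apply: NP => f fN; apply: vPhi.
    by rewrite in_cons !mem_cat fN !orbT.
  - by rewrite mem_head.
  - by move=> l lm; rewrite in_cons !mem_cat pastP// orbT.
  - by move=> l lm f fl; rewrite in_cons !mem_cat (flatP _ stage_G l)// !orbT.
  - by rewrite -PhiE.
  - by rewrite -GE.
have [am|nam] := pselect (act m); last first.
  by exists (Stage 0 0 0 Phi G); apply: mk.
have orig : szlenk_derivative (eps m) (A m) (origin m (stage_z \o h)).
  rewrite /origin; have := parP m; case: par => [p [pm lep _]|_]; last exact: (level_base levels).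
  apply: (level_le levels lep pm); have ap := level_act levels lep.
  by have [[]] := good_act (hP p pm) ap.
have eps_ge : 2 * eta m * M <= eps m.
  rewrite (le_trans (eta_le m))// ger_pMl ?(level_eps_gt0 levels)//.
  rewrite leNgt; apply/negP => t1.
  have : 19 + theta < t * (19 + theta) by rewrite ltr_pMl// addr_gt0.
  by have := t_le; lra.
have [z [w [x [[Az weta x1] [xPhi zG [r r_gt zx]]]]]] :=
  szlenk_step B_neq0 B_convex BM (level_sub levels am) (eta_gt0 m) t_gt0 eps_ge liftG orig.
pose y := of_real k (2 + t)^-1 *: (z - origin m (stage_z \o h) - w).
have yE v : y v = of_real k (2 + t)^-1 * (z - origin m (stage_z \o h) - w) v by [].
exists (Stage x y z Phi G); apply: mk => //.
- move=> _; split; first by split=> //; exists w.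
  exists ((2 + t)^-1 * r); first exact: (stage_constant (level_eps_gt0 levels m)) r_gt.
  by rewrite -[LHS]/(y x) yE zx of_realM.
- by move=> g gG; rewrite -[LHS]/(y g) yE zG// mulr0.
Qed.

Lemma good_stages_exist :
  exists f : nat -> stage, forall m, good_stage m f (f m).
Proof.
apply: (choice_with_history (Stage 0 0 0 [::] [::])).
- exact: good_stage_ext.
- exact: good_stage_step.
Qed.

Section Conclusions.
Hypothesis eta_sum : forall m, eta m <= t * 2^-1 ^+ m.+1.
Variables (h : nat -> stage) (hP : forall m, good_stage m h (h m)).
Local Notation x := (stage_x \o h).
Local Notation y := (stage_y \o h).
Local Notation z := (stage_z \o h).

Lemma stage_Phi_sub n m : (n <= m)%N -> {subset stage_Phi (h n) <= stage_Phi (h m)}.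
Proof.
by rewrite leq_eqVlt => /orP[/eqP -> //|nm]; move=> f; exact: (good_Phi (hP m) nm).
Qed.

Lemma stage_G_sub n m : (n <= m)%N -> {subset stage_G (h n) <= stage_G (h m)}.
Proof.
by rewrite leq_eqVlt => /orP[/eqP -> //|nm]; move=> g; exact: (good_G (hP m) nm).
Qed.

Lemma stage_x_kernel n m f : (n <= m)%N -> f \in stage_Phi (h n) -> f (x m) = 0.
Proof.
move=> nm fn; have [am|nam] := pselect (act m).
  have [[_ _ xm _] _] := good_act (hP m) am.
  exact/xm/stage_Phi_sub/fn.
by have [xm _] := good_inact (hP m) nam; rewrite /= xm dual0.
Qed.

Lemma stage_y_kernel n m g : (n <= m)%N -> g \in stage_G (h n) -> y m g = 0.
Proof. by move=> nm gn; exact/(good_kill (hP m))/stage_G_sub/gn. Qed.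

Definition tree_sum m : dual X := \sum_(l < m.+1 | `[< le l m >]) y l.

Lemma tree_sum_increment m : act m ->
  tree_sum m = y m + (if par m is Some p then tree_sum p else 0).
Proof.
move=> am; rewrite /tree_sum big_mkcond big_ord_recr /= -big_mkcond /=.
rewrite ifT; last exact/asboolP/(level_refl levels).
rewrite addrC; congr (_ + _); have := parP m; case: par => [p [pm lep plast]|none].
  rewrite (big_ord_widen_cond m (fun l => `[< le l p >]) (fun l => stage_y (h l)))//.
  apply: eq_bigl => l; apply/asboolP/andP => [lem|[/asboolP llep _]].
    have llep := plast l (ltn_ord l) lem; split; first exact/asboolP.
    by rewrite ltnS (level_leq levels llep).
  exact: (level_trans levels llep lep).
by rewrite big_pred0// => l; apply/asboolP; exact: none.
Qed.

(** The corrections made along a branch add up to a small multiple of [B]. *)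
Lemma tree_sum_telescope m : act m ->
  exists2 w, multiple B (t * (1 - 2^-1 ^+ m.+1)) w &
    tree_sum m = of_real k (2 + t)^-1 *: (z m - base m - w).
Proof.
have half_le n : 2^-1 ^+ n <= 1 :> R by rewrite exprn_ile1//; lra.
elim/ltn_ind: m => m IH am; rewrite tree_sum_increment//.
have [[_ _ _ [w weta yE]] _] := good_act (hP m) am.
have eta_half : eta m <= t * (1 - 2^-1 ^+ m.+1) - t * (1 - 2^-1 ^+ m).
  by have := eta_sum m; rewrite exprS; lra.
have := parP m; rewrite /= yE /origin; case: par => [p [pm lep _]|_].
  have [w' w'P ->] := IH p pm (level_act levels lep).
  exists (w + w'); last first.
    rewrite -scalerDr -(level_base_le levels lep) /=; congr (_ *: _).
    by rewrite opprD !addrA; apply: dual_ext => v; rewrite !(dual_addE, dual_oppE); ring.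
  apply: (@multiple_le _ _ _ _ B_neq0 B_convex
    (eta m + t * (1 - 2^-1 ^+ p.+1))).
  - by rewrite addr_ge0 ?(ltW (eta_gt0 m))// mulr_ge0 ?(ltW t_gt0) ?subr_ge0.
  - have : 2^-1 ^+ m <= 2^-1 ^+ p.+1 :> R by apply: ler_wiXn2l => //; lra.
    move=> /(ler_wpM2l (ltW t_gt0)); lra.
  - apply: multipleD => //; first exact/ltW/eta_gt0.
    by rewrite mulr_ge0 ?(ltW t_gt0) ?subr_ge0.
exists w; last by rewrite addr0.
apply: (@multiple_le _ _ _ _ B_neq0 B_convex (eta m)) => //; first exact/ltW/eta_gt0.
have : 0 <= t * (1 - 2^-1 ^+ m) by rewrite mulr_ge0 ?(ltW t_gt0) ?subr_ge0.
lra.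
Qed.

Lemma tree_sum_mem m : act m -> B (tree_sum m).
Proof.
move=> am; have [w wP ->] := tree_sum_telescope am.
have [[Az _ _ _] _] := good_act (hP m) am.
have t2 : 0 < 2 + t by have := t_gt0; lra.
have half_ge0 : 0 <= 2^-1 ^+ m.+1 :> R by rewrite exprn_ge0.
have half_le : 2^-1 ^+ m.+1 <= 1 :> R by rewrite exprn_ile1//; lra.
have scale1 : modulus (of_real k (2 + t)^-1) * (2 + t) = 1.
  by rewrite modulus_real ger0_norm ?invr_ge0 ?(ltW t2)// mulVf// gt_eqF.
set u := z m - base m - w.
suff u2 : multiple B (2 + t) u.
  by have := multipleZ B_neq0 B_convex (of_real k (2 + t)^-1) u2; rewrite scale1 => /multiple1.
have -> : 2 + t = 1 + 1 + t by lra.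
apply: multipleD => //; [exact/ltW/t_gt0| |].
  apply: multipleD => //; first exact/multiple1/(level_sub levels am).
  exact/multipleN/multiple1/(level_base_sub levels).
apply: multipleN => //; apply: multiple_le wP => //.
  by rewrite mulr_ge0 ?subr_ge0// ltW.
by rewrite ger_pMr//; lra.
Qed.

Lemma stage_partial_sums n N a : (n <= N)%N ->
  rnorm (combination x n a) <= (1 + t) * rnorm (combination x N a).
Proof.
move=> nN; pose v := combination x N a - combination x n a.
rewrite -[combination x N a](subrKC (combination x n a)) -/v.
apply: (good_mazur (hP n)) => f fn.
have -> : v = \sum_(n <= i < N) a i *: x i.
  rewrite /v /combination -(big_mkord xpredT (fun i => a i *: x i)).
  by rewrite (big_cat_nat (leq0n n) nN) /= big_mkord addrAC subrr add0r.
rewrite dual_sum big_nat big1// => i /andP[ni _].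
by rewrite dualZ (stage_x_kernel ni fn) scaler0.
Qed.

End Conclusions.

End Construction.
Arguments stage_x {R k X}.
Arguments stage_y {R k X}.
Arguments stage_z {R k X}.
Arguments stage_Phi {R k X}.
Arguments stage_G {R k X}.

(** The outcome of the construction: [y m] is the increment at the index [m] of the
    functionals [xs m] of the family.  The sequences [F] and [d] are arbitrary;
    they are dense when the space has a separable dual. *)
Record szlenk_system (R : realType) (k : scalar_kind)
    (X : normedModType (scalar_field R k)) (B : set (dual X)) (delta theta : R)
    (F : nat -> dual X) (d : nat -> X)
    (act : nat -> Prop) (le : nat -> nat -> Prop) (eps : nat -> R)
    (x : nat -> X) (y xs : nat -> dual X) : Prop := SzlenkSystem {
  system_mem : forall m, act m -> B (xs m) ;
  system_norm : forall m, act m -> rnorm (x m) = 1 ;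
  system_large : forall m, act m ->
    exists2 r, eps m / (8 + theta) < r & y m (x m) = of_real k r ;
  system_orth : forall l j, l != j -> y l (x j) = 0 ;
  system_sum : forall m, xs m = \sum_(l < m.+1 | `[< le l m >]) y l ;
  system_partial_sums : forall n N a, (n <= N)%N ->
    rnorm (combination x n a) <= (1 + delta) * rnorm (combination x N a) ;
  system_F : forall j m, (j <= m)%N -> F j (x m) = 0 ;
  system_d : forall j m, (j <= m)%N -> y m (d j) = 0 ;
  system_lift : forall n u, rnorm u <= 1 -> exists u',
    [/\ rnorm u' <= 1 + delta, forall l, (l < n)%N -> y l u' = y l u,
        forall m, (n <= m)%N -> y m u' = 0 &
        forall j, (j <= n)%N -> F j u' = F j u] }.

Theorem szlenk_system_exists (R : realType) (k : scalar_kind)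
    (X : normedModType (scalar_field R k)) (B : set (dual X)) (M delta theta : R)
    (F : nat -> dual X) (d : nat -> X)
    (act : nat -> Prop) (le : nat -> nat -> Prop) (eps : nat -> R)
    (base : nat -> dual X) (A : nat -> set (dual X)) :
  B !=set0 -> absolutely_convex B -> (forall f, B f -> opnorm f <= M) ->
  0 < delta -> 0 < theta -> forest_levels B act le eps base A ->
  exists x y xs, szlenk_system B delta theta F d act le eps x y xs.
Proof.
move=> B_neq0 B_convex BM delta0 theta0 levels.
have [par parP] := choice (parent_exists levels).
(* With [t <= 1], the inequality [2 * (2 + t) ^ 2 <= (1 - t) * (8 + theta)]
   follows from [t * (19 + theta) <= theta]. *)
pose t := Num.min delta (theta / (19 + theta)).
have th19 : 0 < 19 + theta by rewrite addr_gt0.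
have t0 : 0 < t by rewrite lt_min delta0 divr_gt0.
have t_le : t * (19 + theta) <= theta.
  by rewrite -ler_pdivlMr// ge_min lexx orbT.
have M0 : 0 <= M by case: B_neq0 => f /BM; apply: le_trans; exact: opnorm_ge0.
have M1 : 0 < 2 * M + 1 by rewrite ltr_wpDl// mulr_ge0.
have eps0 := level_eps_gt0 levels.
pose eta m := Num.min (t * 2^-1 ^+ m.+1) (t * eps m / (2 * M + 1)).
have eta0 m : 0 < eta m.
  by rewrite lt_min !mulr_gt0 ?invr_gt0 ?exprn_gt0 ?invr_gt0 ?eps0.
have eta_le m : 2 * eta m * M <= t * eps m.
  have : eta m <= t * eps m / (2 * M + 1) by rewrite ge_min lexx orbT.
  rewrite ler_pdivlMr//; have := eta0 m; lra.
have eta_sum m : eta m <= t * 2^-1 ^+ m.+1 by rewrite ge_min lexx.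
have [h hP] := good_stages_exist B_neq0 B_convex BM theta0 F d levels parP t0
  t_le eta0 eta_le.
have t1 : 1 + t <= 1 + delta by rewrite lerD2l ge_min lexx.
exists (stage_x \o h), (stage_y \o h), (tree_sum le h); split.
- exact: (tree_sum_mem B_neq0 B_convex levels parP t0 eta0 eta_sum hP).
- by move=> m /(good_act (hP m))[[]].
- by move=> m /(good_act (hP m))[].
- move=> l j lj; have lt_lj := lj; rewrite neq_ltn in lt_lj.
  case/orP: lt_lj => lt_lj.
    exact: (stage_x_kernel hP (leqnn j) (good_y (hP j) lt_lj)).
  exact: (stage_y_kernel hP (leqnn l) (good_x (hP l) lt_lj)).
- by [].
- move=> n N a nN; apply: le_trans (stage_partial_sums hP a nN) _.
  by rewrite ler_wpM2r ?rnorm_ge0.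
- move=> j m jm; exact: (stage_x_kernel hP jm (good_F (hP j))).
- move=> j m jm; exact: (stage_y_kernel hP jm (good_d (hP j))).
- move=> n u u1; have [u' [u'1 u'Phi u'G]] := good_lift (hP n) u1.
  exists u'; split; first exact: le_trans t1.
  + by move=> l ln; apply/u'Phi/(good_y (hP n) ln).
  + by move=> m nm; apply: u'G => g; exact: (stage_y_kernel hP nm).
  + by move=> j jn; apply/u'Phi/(stage_Phi_sub hP jn)/(good_F (hP j)).
Qed.

(** * Bases obtained from the construction *)

Section SystemBases.
Variables (R : realType) (k : scalar_kind).
Local Notation K := (scalar_field R k).
Variables (X : normedModType K) (B : set (dual X)) (delta theta : R).
Variables (F : nat -> dual X) (d : nat -> X) (le : nat -> nat -> Prop).
Variables (eps : nat -> R) (x : nat -> X) (y xs : nat -> dual X).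
Hypotheses (delta_gt0 : 0 < delta) (theta_gt0 : 0 < theta)
  (eps_gt0 : forall m, 0 < eps m).
Hypothesis S : szlenk_system B delta theta F d (fun=> True) le eps x y xs.

Let C_ge0 : 0 <= 1 + delta. Proof. by rewrite addr_ge0// ltW. Qed.

Lemma system_diag m : y m (x m) != 0.
Proof.
have [r rlt ->] := system_large S (I : True) (m := m).
rewrite -(@of_real0 R k) (inj_eq (can_inj (@of_realK R k))) gt_eqF//.
by rewrite (le_lt_trans _ rlt)// divr_ge0 ?(ltW (eps_gt0 m))// addr_ge0// ltW.
Qed.

Definition coordinate m : dual X := (y m (x m))^-1 *: y m.

Lemma coordinateE m u : coordinate m u = (y m (x m))^-1 * y m u.
Proof. by []. Qed.

Lemma coordinate_x i j : coordinate i (x j) = (i == j)%:R.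
Proof.
rewrite coordinateE; have [->|ij] := eqVneq i j; first by rewrite mulVf ?system_diag.
by rewrite (system_orth S ij) mulr0.
Qed.

Local Notation sub_type := (subspace_of (cspan (range x))).

Lemma sub_val_combination n a :
  sub_val (combination (in_span x) n a) = combination x n a.
Proof.
elim: n => [|n IH]; first by rewrite /combination !big_ord0.
by rewrite /combination !big_ord_recr /=; congr (_ + _).
Qed.

Lemma rnorm_sub_val (u : sub_type) : rnorm u = rnorm (sub_val u).
Proof. by []. Qed.

Lemma restriction (f : dual X) :
  exists g : dual sub_type, forall u, g u = f (sub_val u).
Proof.
have [|u|g gP _] := @dual_of_bounded _ _ sub_type (fun u => f (sub_val u)) (opnorm f).
- by move=> a u v; rewrite -[sub_val _]/(a *: sub_val u + sub_val v) dual_linear.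
- exact: dual_bound.
- by exists g.
Qed.

Lemma system_basic :
  basic_sequence x /\ (basic_constant x <= (1 + delta)%:E)%E.
Proof.
have [g gP] := choice (fun m => restriction (coordinate m)).
apply: (biorthogonal_basis (g := g) C_ge0).
- by move=> i j; rewrite gP coordinate_x.
- move=> u e e0.
  have /asboolP/cspan_approx/(_ e e0)[n [a ua]] := sub_valP u.
  by exists n, a; rewrite rnorm_sub_val -(sub_val_combination n a) in ua *.
- move=> n m a; rewrite !rnorm_sub_val !sub_val_combination.
  have ga j : g j (combination (in_span x) m a) = if (j < m)%N then a j else 0.
    by apply: g_combination => i l; rewrite gP coordinate_x.
  under [X in combination _ _ X]eq_fun do rewrite ga.
  have [nm|mn] := leqP n m.
    have -> : combination x n (fun j => if (j < m)%N then a j else 0) = combination x n a.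
      by apply: eq_bigr => i _; rewrite (leq_trans (ltn_ord i) nm).
    exact: (system_partial_sums S).
  by rewrite -combination_widen ?(ltnW mn)// ler_peMl ?rnorm_ge0// lerDl ltW.
Qed.

(** A functional on the closed span extends to the whole space, where it is near
    some [F j], which kills the tail from the index [j] on. *)
Lemma system_shrinking :
  (forall f (e : R), 0 < e -> exists j, opnorm (f - F j) <= e) ->
  shrinking (in_span x).
Proof.
move=> F_dense; apply: shrinking_from_tails => f e e0.
pose Y := csub (cspan (range x)).
pose f' u : K := if pselect (Y u) is left uY then f (SubspaceOf (asboolT uY)) else 0.
have f'E (u : sub_type) : f' (sub_val u) = f u.
  rewrite /f'; case: pselect => [uY|[]]; first by congr (f _); exact: val_inj.
  exact/asboolP/(sub_valP u).
have [||||h hf _] := @hahn_banach _ _ X Y f' (opnorm f) (opnorm_ge0 f).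
- exact: csub0.
- by move=> a u v uY vY; exact: csub_lin.
- move=> a u v uY vY.
  pose u' : sub_type := SubspaceOf (asboolT uY); pose v' : sub_type := SubspaceOf (asboolT vY).
  have := f'E (a *: u' + v'); rewrite -[sub_val _]/(a *: u + v) => ->.
  by rewrite dual_linear -(f'E u') -(f'E v').
- move=> u uY; rewrite -[u]/(sub_val (SubspaceOf (asboolT uY) : sub_type)) f'E.
  exact: dual_bound.
have [j hj] := F_dense h e e0; exists j => u u1 utail.
have Fu : F j (sub_val u) = 0.
  have [g gP] := restriction (F j); rewrite -gP.
  apply: dual_eq0_cspan utail => _ [m /= jm <-].
  by rewrite gP (system_F S jm).
rewrite -f'E -hf; last exact/asboolP/(sub_valP u).
have -> : h (sub_val u) = (h - F j) (sub_val u) by rewrite dual_subE Fu subr0.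
by rewrite (le_trans (dual_bound _ _))// (le_trans (ler_piMr _ u1))// opnorm_ge0.
Qed.

End SystemBases.

(** * Quotients and separability *)

Section Quotients.
Variables (R : realType) (k : scalar_kind).
Local Notation K := (scalar_field R k).
Variables (X : normedModType K) (Z : closed_subspace X).

Lemma rnorm_quotient (q : quotient Z) : rnorm q = quotient_norm q.
Proof. exact: of_realK. Qed.

Lemma rnorm_quotient_map u : rnorm (quotient_map Z u) <= rnorm u.
Proof. by rewrite rnorm_quotient quotient_norm_le. Qed.

Lemma quotient_lift (q : quotient Z) (e : R) : 0 < e ->
  exists2 u, quotient_map Z u = q & rnorm u < rnorm q + e.
Proof. by rewrite rnorm_quotient; exact: quotient_norm_adherent. Qed.

Lemma dual_pullback (f : dual (quotient Z)) :
  exists h : dual X, forall u, h u = f (quotient_map Z u).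
Proof.
have [|u|h hP _] := @dual_of_bounded _ _ X (fun u => f (quotient_map Z u)) (opnorm f).
- by move=> a u v; rewrite quotient_mapD quotient_mapZ dual_linear.
- rewrite (le_trans (dual_bound _ _))// ler_wpM2l ?opnorm_ge0//.
  exact: rnorm_quotient_map.
- by exists h.
Qed.

(** The norm of a class is an infimum over its representatives, at all of which
    the functional takes the same value. *)
Lemma dual_factor (f : dual X) : (forall u, csub Z u -> f u = 0) ->
  exists g : dual (quotient Z), forall u, g (quotient_map Z u) = f u.
Proof.
move=> fZ; pose g (q : quotient Z) : K := f (repr q).
have gE u : g (quotient_map Z u) = f u.
  apply/eqP; rewrite -subr_eq0 -dualB; apply/eqP/fZ.
  exact: repr_quotient_map.
have [||G GP _] := @dual_of_bounded _ _ (quotient Z) g (opnorm f).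
- move=> a p q; have [u ->] := quotient_map_surj p.
  have [v ->] := quotient_map_surj q.
  by rewrite -quotient_mapZ -quotient_mapD !gE dual_linear.
- move=> q; apply/ler_addgt0Pr => e e0.
  have M1 : 0 < opnorm f + 1 by rewrite ltr_wpDl ?opnorm_ge0.
  have [u uq u_lt] := quotient_lift q (divr_gt0 e0 M1).
  rewrite -{1}uq gE (le_trans (dual_bound _ _))//.
  rewrite (le_trans (ler_wpM2l (opnorm_ge0 f) (ltW u_lt)))// mulrDr lerD2l.
  rewrite mulrCA ger_pMr// ler_pdivrMr// mul1r lerDl.
  exact: ler01.
- by exists G => u; rewrite GP gE.
Qed.

End Quotients.

Section SystemQuotient.
Variables (R : realType) (k : scalar_kind).
Local Notation K := (scalar_field R k).
Variables (X : normedModType K) (B : set (dual X)) (delta theta : R).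
Variables (F : nat -> dual X) (d : nat -> X) (le : nat -> nat -> Prop).
Variables (eps : nat -> R) (x : nat -> X) (y xs : nat -> dual X).
Hypotheses (delta_gt0 : 0 < delta) (theta_gt0 : 0 < theta)
  (eps_gt0 : forall m, 0 < eps m).
Hypothesis S : szlenk_system B delta theta F d (fun=> True) le eps x y xs.
Hypothesis d_dense : forall u, csub (cspan (range d)) u.
Hypothesis F_dense :
  forall f (e : R), 0 < e -> exists j, opnorm (f - F j) <= e.
Variable Z : closed_subspace X.
Hypothesis ZP : forall u, csub Z u <-> forall m, y m u = 0.

Local Notation Q := (quotient_map Z).
Local Notation Qx := (fun m => Q (x m)).
Local Notation coord := (coordinate x y).

Lemma quotient_map_combination n a : Q (combination x n a) = combination Qx n a.
Proof.
elim: n => [|n IH].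
  by rewrite /combination !big_ord0; apply/quotient_map0; exact: csub0.
rewrite /combination !big_ord_recr /= quotient_mapD quotient_mapZ.
by congr (_ + _).
Qed.

Lemma y_combination n a j : y j (combination x n a) =
  if (j < n)%N then a j * y j (x j) else 0.
Proof.
have yj0 := system_diag theta_gt0 eps_gt0 S j.
have cx := coordinate_x theta_gt0 eps_gt0 S.
have -> : y j (combination x n a) = y j (x j) * coord j (combination x n a).
  by rewrite coordinateE mulVKf.
rewrite (g_combination (g := coord) cx).
by case: ifP => _; rewrite ?mulr0// mulrC.
Qed.

(** The increments separate the classes, and they cannot tell [u'] from the
    partial sum of order [n] of the expansion of [u]. *)
Lemma quotient_partial_sum n u u' : (forall l, (l < n)%N -> y l u' = y l u) ->
  (forall m, (n <= m)%N -> y m u' = 0) -> Q u' = combination Qx n (coord^~ u).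
Proof.
move=> u'u u'0; rewrite -quotient_map_combination; apply/quotient_mapP/ZP => m.
rewrite dualB y_combination; case: ltnP => [mn|nm]; last by rewrite u'0// subrr.
have ym0 := system_diag theta_gt0 eps_gt0 S m.
by rewrite coordinateE mulrAC mulVf// mul1r u'u// subrr.
Qed.

Lemma quotient_coordinates : exists g : nat -> dual (quotient Z),
  forall m u, g m (Q u) = coord m u.
Proof.
have ex m : exists g : dual (quotient Z), forall u, g (Q u) = coord m u.
  by apply: dual_factor => u /ZP yu; rewrite coordinateE yu mulr0.
by have [g gP] := choice ex; exists g.
Qed.

(** The class of each [d j] is a finite combination, because the increments from
    the index [j] on vanish at [d j]. *)
Lemma quotient_dense q (e : R) : 0 < e ->
  exists n a, rnorm (q - combination Qx n a) < e.
Proof.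
move=> e0; have [u ->] := quotient_map_surj q.
have [n [a ua]] := cspan_approx (d_dense u) e0.
have [N [b bE]] : combinations Qx (Q (combination d n a)).
  rewrite /combination; elim: n {ua} => [|n IH].
    rewrite big_ord0; have -> : Q 0 = 0 by apply/quotient_map0; exact: csub0.
    exact: combinations0.
  rewrite big_ord_recr /= addrC quotient_mapD quotient_mapZ.
  apply: combinations_lin => //; exists n, (coord^~ (d n)).
  by apply: quotient_partial_sum => // m nm; exact: (system_d S nm).
exists N, b; rewrite -bE; apply: le_lt_trans ua.
have <- : Q (u - combination d n a) = Q u - Q (combination d n a).
  by rewrite quotient_mapD -scaleN1r quotient_mapZ scaleN1r.
exact: rnorm_quotient_map.
Qed.

Lemma quotient_partial_sum_le n (g : nat -> dual (quotient Z)) q :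
  (forall m u, g m (Q u) = coord m u) ->
  rnorm (combination Qx n (g^~ q)) <= (1 + delta) * rnorm q.
Proof.
move=> gP; have C0 : 0 < 1 + delta by rewrite addr_gt0.
apply/ler_addgt0Pr => e e0.
have [u uq u_lt] := quotient_lift q (divr_gt0 e0 C0).
set r := rnorm q + _ in u_lt; have r0 : 0 < r by rewrite ltr_wpDl ?rnorm_ge0 ?divr_gt0.
pose v := of_real k r^-1 *: u.
have v1 : rnorm v <= 1.
  rewrite rnormZr ?invr_ge0 ?(ltW r0)// mulrC ler_pdivrMr// mul1r; exact: ltW.
have [v' [v'1 v'v v'0 _]] := system_lift S n v1.
have -> : combination Qx n (g^~ q) = of_real k r *: Q v'.
  rewrite (quotient_partial_sum v'v v'0) /combination scaler_sumr.
  apply: eq_bigr => i _; rewrite scalerA -uq gP; congr (_ *: _).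
  have -> : coord i v = of_real k r^-1 * coord i u by exact: dualZ.
  by rewrite mulrA -of_realM mulfV ?gt_eqF// of_real1 mul1r.
rewrite rnormZr ?(ltW r0)//.
rewrite (le_trans (ler_wpM2l (ltW r0) (le_trans (rnorm_quotient_map _ _) v'1)))//.
by rewrite mulrC /r mulrDr lerD2l mulrCA mulfV ?mulr1// gt_eqF.
Qed.

Lemma system_quotient_basis :
  schauder_basis Qx /\ (basis_constant Qx <= (1 + delta)%:E)%E.
Proof.
have [g gP] := quotient_coordinates.
have C0 : 0 <= 1 + delta by rewrite addr_ge0// ltW.
apply: (biorthogonal_basis (g := g) C0).
- by move=> i j; rewrite gP; exact: (coordinate_x theta_gt0 eps_gt0 S).
- exact: quotient_dense.
- by move=> n m a; exact: quotient_partial_sum_le.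
Qed.

(** A functional on the quotient is, on [X], close to some [F j].  Lifting shows
    that its value at a vector of the tail is unchanged by the subtraction of a
    vector of [Z] at which [F j] takes the same value. *)
Lemma system_quotient_shrinking : shrinking Qx.
Proof.
apply: shrinking_from_tails => f e e0.
have d2 : 0 < 2 + delta by rewrite addr_gt0.
have d22 : 0 < 2 * (2 + delta) by rewrite mulr_gt0.
have [h hP] := dual_pullback f.
have [j hj] := F_dense h (divr_gt0 e0 d22).
have [g gP] := quotient_coordinates.
exists j => q q1 qtail.
have [u uq u_lt] := quotient_lift q ltr01.
pose v := of_real k 2^-1 *: u.
have v1 : rnorm v <= 1 by rewrite rnormZr ?invr_ge0//; lra.
have yv l : (l < j)%N -> y l v = 0.
  move=> lj; rewrite dualZ; suff -> : y l u = 0 by rewrite scaler0.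
  have yl0 := system_diag theta_gt0 eps_gt0 S l.
  suff : coord l u = 0.
    by move=> /eqP; rewrite coordinateE mulf_eq0 invr_eq0 (negbTE yl0) => /eqP.
  rewrite -gP uq; apply: dual_eq0_cspan qtail => _ [i /= ji <-].
  rewrite gP (coordinate_x theta_gt0 eps_gt0 S) ltn_eqF//.
  exact: leq_trans lj ji.
have [v' [v'1 v'v v'0 v'F]] := system_lift S j v1.
have v'Z : csub Z v'.
  by apply/ZP => m; case: (ltnP m j) => [mj|/v'0//]; rewrite v'v// yv.
have hv' : h v' = 0 by rewrite hP (quotient_map0 Z v').2// dual0.
have -> : f q = of_real k 2 * (h - F j) (v - v').
  rewrite dual_subE !dualB hv' v'F// subrr !subr0 -uq -hP.
  have -> : h v = of_real k 2^-1 * h u by exact: dualZ.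
  by rewrite mulrA -of_realM mulfV// of_real1 mul1r.
rewrite modulusM modulus_real ger0_norm//.
have vv' : rnorm (v - v') <= 2 + delta.
  by rewrite (le_trans (rnormB _ _))//; lra.
have : modulus ((h - F j) (v - v')) <= e / (2 * (2 + delta)) * (2 + delta).
  rewrite (le_trans (dual_bound _ _))//.
  by apply: ler_pM => //; [exact: opnorm_ge0|exact: rnorm_ge0].
by rewrite invfM mulrA mulfVK ?gt_eqF//; lra.
Qed.

End SystemQuotient.

Section Separability.
Variables (R : realType) (k : scalar_kind).
Local Notation K := (scalar_field R k).
Variable X : completeNormedModType K.

Lemma separable_dual_sequence : norm_separable (dual X) ->
  exists F : nat -> dual X,
    forall f (e : R), 0 < e -> exists j, opnorm (f - F j) <= e.
Proof.
move=> [A /countable_injP[i i_inj] A_dense].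
exists (fun n => xget 0 [set a | A a /\ i a = n]) => f e e0.
pose U := [set g : dual X | rnorm (f - g) < e].
have Uo : open U.
  rewrite openE => g Ug; apply/nbhs_rnormP; exists (e - rnorm (f - g)).
    by rewrite subr_gt0.
  move=> h gh; rewrite /U /= (le_lt_trans (rdist_triangle g _ _))//.
  by rewrite -ltrBrDl.
have [|a [Ua Aa]] := A_dense U _ Uo.
  by exists f; rewrite /U /= subrr rnorm0.
exists (i a); case: xgetP => [b _ [Ab iba]|/(_ a)[]//].
have -> : b = a by apply: i_inj; rewrite ?inE.
by rewrite -opnorm_rnorm ltW.
Qed.

(** The vectors nearly norming a dense sequence of functionals span a dense
    space: a functional which vanishes on them is a limit of functionals of
    small norm. *)
Lemma separable_predual_sequence (F : nat -> dual X) :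
  (forall f (e : R), 0 < e -> exists j, opnorm (f - F j) <= e) ->
  exists d : nat -> X, forall u, csub (cspan (range d)) u.
Proof.
move=> F_dense.
have /choice[d dP] : forall j, exists x, rnorm x <= 1 /\
    opnorm (F j) / 2 <= modulus (F j x).
  move=> j; have := opnorm_ge0 (F j); rewrite le_eqVlt => /orP[/eqP Fj0|Fj0].
    by exists 0; rewrite rnorm0 -Fj0 mul0r modulus_ge0.
  have [|x x1 Fx] := @opnorm_nearly_attained _ _ _ (F j) (opnorm (F j) / 2).
    by lra.
  by exists x; split=> //; exact: ltW.
exists d => u; apply: contrapT => ud.
set D := cspan (range d).
have [f _ fu] := norming_functional (quotient_map D u).
have [h hP] := dual_pullback f.
have hd j : h (d j) = 0.
  rewrite hP (quotient_map0 D (d j)).2 ?dual0//.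
  by apply: sub_cspan; exists j.
have h0 : opnorm h = 0.
  apply/eqP; rewrite eq_le opnorm_ge0 andbT; apply/ler_addgt0Pr => e e0.
  have e3 : 0 < e / 3 by rewrite divr_gt0.
  have [j hj] := F_dense h _ e3; have [dj1 Fd] := dP j.
  have : modulus (F j (d j)) <= e / 3.
    have -> : F j (d j) = - (h - F j) (d j) by rewrite dual_subE hd sub0r opprK.
    rewrite modulusN (le_trans (dual_bound _ _))//.
    by rewrite (le_trans (ler_piMr _ dj1))// opnorm_ge0.
  have : opnorm h <= opnorm (h - F j) + opnorm (F j).
    by rewrite -{1}(subrK (F j) h); exact: opnormD.
  by lra.
apply: ud; apply/(quotient_map0 D u)/rnorm_eq0/(can_inj (@of_realK R k)).
by rewrite -fu -hP (opnorm_eq0 h0) of_real0.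
Qed.

End Separability.

(** * Indexing the amalgamated tree *)

Section FiniteBranches.
Variables (d : Order.disp_t) (T : porderType d).
Hypotheses (T_tree : is_tree T) (T_wf : well_founded_tree T).

(** The predecessors of a node form a chain, which extends to a branch. *)
Lemma finite_predecessors (t : T) : finite_set [set s | (s <= t)%O].
Proof.
set A0 := [set s | (s <= t)%O].
have A0_chain : is_chain A0.
  move=> s s' st s't; have [||b [->|->] bmin] := @T_tree t [set s; s'].
  - by move=> _ [->|->].
  - by exists s; left.
  - by left; apply: bmin; right.
  - by right; apply: bmin; left.
(* The sets added to the chain [A0] are maximized, so that the union of the empty
   family is a chain too. *)
have [H HP totH|A [A_chain A_max]] := @Zorn_bigcup _ [set A | is_chain (A0 `|` A)].
  move=> s s' [st|[A HA As]] [s't|[A' HA' As']].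
  - exact: A0_chain.
  - by apply: (HP _ HA'); [left|right].
  - by apply: (HP _ HA); [right|left].
  - have [AA'|A'A] := totH _ _ HA HA'.
      by apply: (HP _ HA'); right; [exact: AA'|].
    by apply: (HP _ HA); right; [|exact: A'A].
suff : finite_set (A0 `|` A) by apply: sub_finite_set => s; left.
apply: T_wf; split=> // A' A'_chain AA'; apply/seteqP; split=> //.
have [|A'A] := pselect (A' `<=` A); first by move=> A'A s /A'A; right.
exfalso; apply: (A_max A').
  by split=> // s As; apply: AA'; right.
have -> : [set A | is_chain (A0 `|` A)] A' = is_chain (A0 `|` A') by [].
have -> // : A0 `|` A' = A'.
by apply/seteqP; split=> [s [sA0|//]|s ?]; [apply: AA'; left|right].
Qed.

End FiniteBranches.

(** A sum over predecessors grows along the tree, and dominates the code of the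
    node; adding the code to its square is injective, and still increasing. *)
Lemma countable_order_embedding (I : Type) (le : I -> I -> Prop) (c : I -> nat) :
  injective c -> (forall s, le s s) -> (forall s t u, le s t -> le t u -> le s u) ->
  (forall s t, le s t -> le t s -> s = t) ->
  (forall t, finite_set [set s | le s t]) ->
  exists2 r : I -> nat, injective r & forall s t, le s t -> (r s <= r t)%N.
Proof.
elim/Pchoice: I => I in le c *; move=> c_inj le_refl le_trans le_anti le_fin.
have ex t : exists L : seq I, uniq L /\ forall s, s \in L <-> le s t.
  have /finite_seqP[L LE] := le_fin t; exists (undup L).
  rewrite undup_uniq; split=> // s; rewrite mem_undup.
  by rewrite -[le s t]/([set s | le s t] s) LE.
have [L LP] := choice ex.
pose a t := (\sum_(s <- L t) (c s).+1)%N.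
have aD s t : le s t -> s <> t -> (a s + (c t).+1 <= a t)%N.
  move=> st s_neq_t; rewrite /a [leqRHS](bigID (fun u => u \in L s)) /=.
  have LsE : perm_eq (L s) [seq u <- L t | u \in L s].
    apply: uniq_perm; rewrite ?filter_uniq ?(LP _).1// => u.
    rewrite mem_filter; case us: (u \in L s) => //=; apply/esym/(LP t).2.
    by apply: le_trans st; apply/(LP s).2.
  rewrite (perm_big _ LsE) big_filter leq_add2l.
  have tLt : t \in L t by apply/(LP t).2.
  rewrite (big_rem t)//= ifT; first exact: leq_addr.
  by apply/negP => /(LP s).2 ts; apply: s_neq_t; exact: le_anti.
have ca t : (c t < a t)%N.
  by rewrite /a (big_rem t) ?leq_addr//; apply/(LP t).2.
have sq_lt m n p q : (p < m)%N -> (m < n)%N -> (m * m + p < n * n + q)%N.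
  move=> pm mn; have : (m.+1 * m.+1 <= n * n)%N by exact: leq_mul.
  by rewrite mulSn mulnS; lia.
exists (fun t => a t * a t + c t)%N.
  move=> s t st; apply: c_inj; have [a_lt|a_lt|a_eq] := ltngtP (a s) (a t).
  - by have := sq_lt _ _ _ (c t) (ca s) a_lt; rewrite st ltnn.
  - by have := sq_lt _ _ _ (c s) (ca t) a_lt; rewrite st ltnn.
  - by move: st; rewrite a_eq => /addnI.
move=> s t st; have [->//|/eqP s_neq_t] := eqVneq s t.
apply/ltnW/sq_lt => //; apply: leq_trans (aD s t st s_neq_t).
by rewrite addnS ltnS leq_addr.
Qed.

Section AmalgamIndex.
Variables (d : Order.disp_t) (T : nat -> porderType d).
Implicit Types (s t : amalgam_star T) (nu : nat -> option (amalgam_star T)).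

(** The amalgamated tree may be finite, so some integers index no node. *)
Record node_index nu : Prop := NodeIndex {
  index_inj : forall m n t, nu m = Some t -> nu n = Some t -> m = n ;
  index_surj : forall t, exists m, nu m = Some t ;
  index_leq : forall m n s t,
    nu m = Some s -> nu n = Some t -> below s t -> (m <= n)%N }.

Lemma node_index_exists : (forall n, is_tree (T n)) ->
  (forall n, countable [set: T n]) -> (forall n, well_founded_tree (T n)) ->
  exists nu, node_index nu.
Proof.
move=> T_tree T_countable T_wf.
have ex n : exists c : T n -> nat, injective c.
  have /countable_injP[c c_inj] := T_countable n.
  by exists c => s t; apply: c_inj; rewrite inE.
pose c n := sval (cid (ex n)).
have c_inj n : injective (c n) := svalP (cid (ex n)).
have below_fin t : finite_set [set s | below s t].
  case: t => n t.
  have [e eP] : exists e : T n -> amalgam_star T,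
      forall u : tree_star (T n), e (set_val u) = existT _ n u.
    pose e u : amalgam_star T := if pselect (exists s : tree_star (T n), set_val s = u)
      is left su then existT _ n (sval (cid su)) else existT _ n t.
    exists e => s; rewrite /e; case: pselect => [su|[]]; last by exists s.
    by congr existT; apply: val_inj; exact: (svalP (cid su)).
  apply: (sub_finite_set _ (finite_image e
    (finite_predecessors (T_tree n) (T_wf n) (set_val t)))).
  move=> [m s] /= st; have nm := below_tag st; rewrite /= in nm; subst m.
  by exists (set_val s); [exact/belowP|exact: eP].
pose code (t : amalgam_star T) := pickle (tag t, c (tag t) (set_val (tagged t))).
have code_inj : injective code.
  move=> [n s] [m t] /(pcan_inj pickleK)[/= nm]; subst m => /c_inj st.
  by congr existT; exact: val_inj.
have [r r_inj r_le] := countable_order_embedding code_inj (@below_refl _ T)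
  (fun s t u => @below_trans _ T t s u) (@below_anti _ T) below_fin.
exists (fun m => if pselect (exists t, r t = m) is left rt
  then Some (sval (cid rt)) else None); split.
- move=> m n t; case: pselect => // mt [<-]; case: pselect => // nt [tt'].
  have := svalP (cid mt); have := svalP (cid nt).
  by rewrite tt' => -> ->.
- move=> t; exists (r t); case: pselect => [rt|[]]; last by exists t.
  by congr Some; apply: r_inj; exact: (svalP (cid rt)).
- move=> m n s t; case: pselect => // ms [<-]; case: pselect => // nt [<-] /r_le.
  by rewrite (svalP (cid ms)) (svalP (cid nt)).
Qed.

Lemma enumeration_index tau : enumeration tau ->
  node_index (fun m => tau m.+1).
Proof.
move=> [tau_bij tau_le]; split.
- by move=> m n t mt nt; apply/eqP; rewrite -eqSS; apply/eqP/(bij_inj tau_bij); rewrite mt.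
- move=> t; have [tau' _ tauK] := tau_bij.
  have tau0 : tau 0%N = None.
    case E : (tau' None) => [|m]; first by rewrite -E tauK.
    have := tau_le (tau' None) 0%N; rewrite tauK => /(_ (AmalgamRoot _)).
    by rewrite E.
  case E : (tau' (Some t)) => [|m]; last by exists m; rewrite -E tauK.
  by have := tauK (Some t); rewrite E tau0.
- by move=> m n s t ms nt st; rewrite -ltnS; apply: tau_le; rewrite ms nt.
Qed.

Lemma enumeration_node tau m : enumeration tau -> exists t, tau m.+1 = Some t.
Proof.
move=> [tau_bij tau_le]; case E : (tau m.+1) => [t|]; first by exists t.
by have := tau_le m.+1 0%N; rewrite E => /(_ (AmalgamRoot _)).
Qed.

End AmalgamIndex.

(** * Families on the amalgamated tree *)

Section Families.
Variables (R : realType) (k : scalar_kind).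
Local Notation K := (scalar_field R k).
Variables (X : completeNormedModType K) (B : set (dual X)).
Hypotheses (B_neq0 : B !=set0) (B_convex : absolutely_convex B)
  (B_compact : weak_star_compact B).
Variables (delta theta : R) (delta_gt0 : 0 < delta) (theta_gt0 : 0 < theta).
Variables (eps : nat -> R) (eps_gt0 : forall n, 0 < eps n).
Variables (xi : nat -> ordinal_number)
  (B_szlenk : forall n, szlenk_derived (eps n) (xi n) B !=set0).
Variables (disp : Order.disp_t) (T : nat -> porderType disp).
Variables (T_tree : forall n, is_tree (T n)) (rho : nat -> ordinal_number)
  (rhoE : forall n, is_tree_rank (T n) (rho n))
  (rho_le : forall n, ole (rho n) (osucc (xi n))).
Implicit Types s t : amalgam_star T.

Lemma szlenk_derivative_sub (e : R) (A : set (dual X)) :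
  szlenk_derivative e A `<=` A.
Proof. by move=> f []. Qed.

(** Nodes get derived sets whose orders decrease along the tree; the order
    [xi n] itself is left for the base point. *)
Lemma amalgam_levels : exists (zeta : nat -> dual X) (A : amalgam_star T -> set (dual X)),
  [/\ forall n, B (zeta n), forall t, A t `<=` B,
      forall t, szlenk_derivative (eps (tag t)) (A t) (zeta (tag t)) &
      forall s t, below s t -> s <> t ->
        A s `<=` szlenk_derivative (eps (tag t)) (A t)].
Proof.
have ex n : exists o : T n -> osucc (xi n), forall u v, (u < v)%O -> olt (o v) (o u).
  exact: (tree_levels (rhoE n).1 (rho_le n)).
pose o n := sval (cid (ex n)).
have oP n u v : (u < v)%O -> olt (o n v) (o n u) := svalP (cid (ex n)) u v.
pose L n (a : osucc (xi n)) := transfinite_at (szlenk_derivative (eps n)) B a.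
have L_lt n (a b : osucc (xi n)) : olt a b -> L n b `<=` szlenk_derivative (eps n) (L n a).
  by apply: transfinite_at_lt; exact: szlenk_derivative_sub.
have L_B n (a : osucc (xi n)) : L n a `<=` B.
  by apply: transfinite_at_sub; exact: szlenk_derivative_sub.
have [zeta zetaP] := choice B_szlenk.
pose A t := L (tag t) (o (tag t) (set_val (tagged t))).
have below_top n (u : tree_star (T n)) : olt (o n (set_val u)) None.
  case: u => u /= u_min; have : ~ minimals [set: T n] u by have := set_mem u_min.
  move=> u_nmin; have [v [vu v_neq]] : exists v : T n, (v <= u)%O /\ v <> u.
    apply: contrapT => nv; apply: u_nmin; split=> // v _ vu.
    by apply: contrapT => v_neq; apply: nv; exists v.
  have /oP : (v < u)%O by rewrite lt_neqAle vu andbT; apply/eqP.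
  by rewrite /set_val /=; case: (o n u).
exists zeta, A; split.
- by move=> n; apply: (L_B n None); exact: zetaP.
- by move=> t; exact: L_B.
- by move=> t; apply: (L_lt _ _ None (below_top _ _)); exact: zetaP.
- move=> s t st s_neq; have nm := below_tag st.
  case: s t st s_neq nm => [n s] [m t] st s_neq /= nm; subst m.
  apply: L_lt; apply: oP; rewrite lt_neqAle (_ : (_ <= _)%O); last exact/belowP.
  by rewrite andbT; apply/eqP => st_eq; apply: s_neq; congr existT; exact: val_inj.
Qed.

Lemma B_bounded : exists M : R, forall f, B f -> opnorm f <= M.
Proof. exact/uniform_boundedness/weak_star_compact_pointwise_bounded. Qed.

Section Indexed.
Variables (nu : nat -> option (amalgam_star T)) (nuP : node_index nu).

Definition index_act m := exists t, nu m = Some t.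
Definition index_le l m :=
  exists s t, [/\ nu l = Some s, nu m = Some t & below s t].
Definition index_eps m := if nu m is Some t then eps (tag t) else 1.

Lemma index_levels : exists base A,
  forest_levels B index_act index_le index_eps base A.
Proof.
have [zeta [A [zeta_B A_B A_zeta A_le]]] := amalgam_levels.
exists (fun m => if nu m is Some t then zeta (tag t) else 0).
exists (fun m => if nu m is Some t then A t else set0).
split.
- by move=> m [t mt]; exists t, t; split=> //; exact: below_refl.
- move=> l m n [s [t [ls mt st]]] [t' [u [mt' nu' tu]]].
  have tt' : t = t' by apply: Some_inj; rewrite -mt.
  by exists s, u; split=> //; apply: below_trans tu; rewrite -tt'.
- by move=> l m [s [t [ls mt st]]]; exact: (index_leq nuP ls mt st).
- by move=> l m [s [t [ls _ _]]]; exists s.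
- move=> l m n [s [u [ls nu1 su]]] [t [u' [mt nu2 tu]]] lm.
  have uu' : u = u' by apply: Some_inj; rewrite -nu1.
  subst u'; exists s, t; split=> //.
  have [//|ts] := below_chain T_tree su tu.
  have lm_eq : l = m.
    by apply/eqP; rewrite eqn_leq lm (index_leq nuP mt ls ts).
  have st_eq : s = t by apply: Some_inj; rewrite -mt -ls lm_eq.
  by rewrite st_eq; exact: below_refl.
- by move=> m; rewrite /index_eps; case: (nu m).
- by move=> l m [s [t [-> -> /below_tag ->]]].
- by move=> m [t ->].
- by move=> m [t ->].
- by move=> m [t mt]; rewrite /index_eps mt.
- move=> l m [s [t [ls mt st]]] lm; rewrite /index_eps mt ls; apply: A_le => // st_eq.
  have lm_eq : l = m by apply: (index_inj nuP ls); rewrite mt st_eq.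
  by rewrite lm_eq ltnn in lm.
Qed.

Variables (F : nat -> dual X) (d : nat -> X).

Lemma index_system : exists x y xs,
  szlenk_system B delta theta F d index_act index_le index_eps x y xs.
Proof.
have [M BM] := B_bounded; have [base [A levels]] := index_levels.
exact: (szlenk_system_exists F d B_neq0 B_convex BM delta_gt0 theta_gt0 levels).
Qed.

Variables (x : nat -> X) (y xs : nat -> dual X).
Hypothesis S : szlenk_system B delta theta F d index_act index_le index_eps x y xs.

Definition node_of t : nat := sval (cid (index_surj nuP t)).

Lemma node_ofP t : nu (node_of t) = Some t.
Proof. exact: (svalP (cid (index_surj nuP t))). Qed.

Lemma index_leP s t : index_le (node_of s) (node_of t) <-> below s t.
Proof.
split=> [[s' [t' []]]|st]; last by exists s, t; split=> //; exact: node_ofP.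
by rewrite !node_ofP => -[->] [->].
Qed.

Lemma system_value j m : (j <= m)%N -> index_le j m -> xs m (x j) = y j (x j).
Proof.
move=> jm lejm; rewrite (system_sum S) dual_sumE.
have jm1 : (j < m.+1)%N by [].
rewrite (bigD1 (Ordinal jm1)) /=; last exact/asboolP.
rewrite big1 ?addr0// => i /andP[_]; rewrite -val_eqE /= => ij.
exact: (system_orth S ij).
Qed.

Lemma system_value0 j m : ~ index_le j m -> xs m (x j) = 0.
Proof.
move=> nlejm; rewrite (system_sum S) dual_sumE big1// => i /asboolP leim.
apply: (system_orth S); apply/eqP => ij; apply: nlejm; rewrite -ij.
exact: leim.
Qed.

Lemma index_admissible :
  admissible_families B theta eps (xs \o node_of) (x \o node_of).
Proof.
have act t : index_act (node_of t) by exists t; exact: node_ofP.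
split=> [t|t|s t].
- exact: (system_mem S (act t)).
- by rewrite -rnormE /= (system_norm S (act t)) of_real1.
- split=> [st|nst]; last by apply: system_value0 => /index_leP.
  have st' : index_le (node_of s) (node_of t) by exact/index_leP.
  have st_le := index_leq nuP (node_ofP s) (node_ofP t) st.
  rewrite /= system_value// system_value//; last exact/index_leP/below_refl.
  split=> //; have [r r_gt ->] := system_large S (act s).
  rewrite of_real_lt; move: r_gt; rewrite /index_eps node_ofP.
  by rewrite (below_tag st).
Qed.

Lemma index_kernel u : csub (kernel_subspace (xs \o node_of)) u <->
  forall m, index_act m -> y m u = 0.
Proof.
split=> [xsu|yu t _]; last first.
  rewrite /= (system_sum S) dual_sumE big1// => i /asboolP[s [t' [si _ _]]].
  by apply: yu; exists s.
elim/ltn_ind => m IH [t mt].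
have mE : m = node_of t by exact: (index_inj nuP mt (node_ofP t)).
have := xsu t I; rewrite /= -mE (system_sum S) dual_sumE.
have mm : index_le m m by rewrite mE; exact/index_leP/below_refl.
rewrite big_mkcond big_ord_recr /= ifT; last exact/asboolP.
rewrite big1 ?add0r// => i _; case: ifP => // /asboolP[s [t' [si _ _]]].
by apply: IH; [exact: ltn_ord|exists s].
Qed.

End Indexed.

Section Enumerated.
Variables (tau : nat -> amalgam T) (tauP : enumeration tau).
Let nu m := tau m.+1.
Let nuP : node_index nu := enumeration_index tauP.

Lemma index_act_enumeration m : index_act nu m.
Proof. exact: enumeration_node. Qed.

Lemma along_node_of (x : nat -> X) : along tau (x \o node_of nuP) = x.
Proof.
apply/funext => m; have [t mt] := enumeration_node m tauP.
rewrite /along mt /=; congr x.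
exact: (index_inj nuP (node_ofP nuP t) mt).
Qed.

Lemma enumerated_system (F : nat -> dual X) (d : nat -> X) : exists x y xs,
  szlenk_system B delta theta F d (fun=> True) (index_le nu) (index_eps nu) x y xs /\
  szlenk_system B delta theta F d (index_act nu) (index_le nu) (index_eps nu) x y xs.
Proof.
have [x [y [xs S]]] := index_system nuP F d; exists x, y, xs; split=> //.
by case: S => *; split=> // m _; auto using index_act_enumeration.
Qed.

Lemma index_eps_gt0 m : 0 < index_eps nu m.
Proof. by rewrite /index_eps; case: (nu m). Qed.

Lemma basic_families : exists xs x,
  [/\ admissible_families B theta eps xs x, basic_sequence (along tau x) &
      (basic_constant (along tau x) <= (1 + delta)%:E)%E].
Proof.
have [x [y [xs [S S']]]] := enumerated_system (fun=> 0) (fun=> 0).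
exists (xs \o node_of nuP), (x \o node_of nuP); rewrite along_node_of.
have [? ?] := system_basic delta_gt0 theta_gt0 index_eps_gt0 S.
by split=> //; exact: index_admissible S'.
Qed.

Lemma shrinking_families : norm_separable (dual X) -> exists xs x,
  let Z := kernel_subspace xs in
  let Qx := fun m => quotient_map Z (along tau x m) in
  [/\ admissible_families B theta eps xs x,
      shrinking_basic_sequence (along tau x),
      (basic_constant (along tau x) <= (1 + delta)%:E)%E &
      [/\ schauder_basis Qx, shrinking Qx &
          (basis_constant Qx <= (1 + delta)%:E)%E]].
Proof.
move=> /separable_dual_sequence[F F_dense].
have [d d_dense] := separable_predual_sequence F_dense.
have [x [y [xs [S S']]]] := enumerated_system F d.
exists (xs \o node_of nuP), (x \o node_of nuP) => /=; rewrite along_node_of.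
have [? ?] := system_basic delta_gt0 theta_gt0 index_eps_gt0 S.
have sh := system_shrinking S F_dense.
have ZP u : csub (kernel_subspace (xs \o node_of nuP)) u <-> forall m, y m u = 0.
  split=> [/(index_kernel nuP S') yu m|yu]; first exact/yu/index_act_enumeration.
  by apply/(index_kernel nuP S') => m _.
have [? ?] := system_quotient_basis delta_gt0 theta_gt0 index_eps_gt0 S d_dense ZP.
have ? := system_quotient_shrinking delta_gt0 theta_gt0 index_eps_gt0 S F_dense ZP.
by split=> //; exact: index_admissible S'.
Qed.

End Enumerated.

End Families.

Theorem theorem9 (R : realType) (k : scalar_kind)
  (X : completeNormedModType (scalar_field R k)) (K : set (dual X))
  (K_neq0 : K !=set0) (K_convex : absolutely_convex K)
  (K_compact : weak_star_compact K)
  (delta theta : R) (delta_gt0 : 0 < delta) (theta_gt0 : 0 < theta)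
  (eps : nat -> R) (eps_gt0 : forall n, 0 < eps n)
  (xi : nat -> ordinal_number) (xi_countable : forall n, countable [set: xi n])
  (K_szlenk : forall n, szlenk_derived (eps n) (xi n) K !=set0)
  (d : Order.disp_t) (T : nat -> porderType d)
  (T_tree : forall n, is_tree (T n))
  (T_countable : forall n, countable [set: T n])
  (T_wf : forall n, well_founded_tree (T n))
  (T_rooted : forall n, rooted (T n))
  (rho : nat -> ordinal_number) (rhoE : forall n, is_tree_rank (T n) (rho n))
  (rho_le : forall n, ole (rho n) (osucc (xi n))) :
  (* (i) *)
  ((exists (xs : amalgam_star T -> dual X) (x : amalgam_star T -> X),
      admissible_families K theta eps xs x) /\
   (forall tau : nat -> amalgam T, enumeration tau ->
      exists (xs : amalgam_star T -> dual X) (x : amalgam_star T -> X),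
        [/\ admissible_families K theta eps xs x,
            basic_sequence (along tau x) &
            (basic_constant (along tau x) <= (1 + delta)%:E)%E])) /\
  (* (ii) *)
  (norm_separable (dual X) ->
   forall tau : nat -> amalgam T, enumeration tau ->
      exists (xs : amalgam_star T -> dual X) (x : amalgam_star T -> X),
        let Z := kernel_subspace xs in
        let Qx := fun m => quotient_map Z (along tau x m) in
        [/\ admissible_families K theta eps xs x,
            shrinking_basic_sequence (along tau x),
            (basic_constant (along tau x) <= (1 + delta)%:E)%E &
            [/\ schauder_basis Qx, shrinking Qx &
                (basis_constant Qx <= (1 + delta)%:E)%E]]).
Proof.
split; first split.
- have [nu nuP] := node_index_exists T_tree T_countable T_wf.
  have [x [y [xs S]]] := index_system K_neq0 K_convex K_compact delta_gt0 theta_gt0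
    eps_gt0 K_szlenk T_tree rhoE rho_le nuP (fun=> 0) (fun=> 0).
  by exists (xs \o node_of nuP), (x \o node_of nuP); exact: index_admissible S.
- by move=> tau tauP; exact: basic_families.
- by move=> X_sep tau tauP; exact: shrinking_families.
Qed.
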